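(* Let $\mu$ be a positive operator-valued measure on $\mathbb{T}$ satisfying the standing assumptions listed in the context, with $\mu_0=I$, and for $n\ge0$ let $$d\mu^{(n)}(\theta)=\big[\varphi_n^R(e^{i\theta})\varphi_n^R(e^{i\theta})^\dagger\big]^{-1}\frac{d\theta}{2\pi}.$$ Then $\mu^{(n)}$ is an (operator-valued) probability measure on $\mathbb{T}$, i.e. a positive operator-valued measure with $\mu^{(n)}(\mathbb{T})=I$, whose Verblunsky coefficients are $\alpha_j(d\mu^{(n)})=\alpha_j(d\mu)$ for $j\le n-1$ and $\alpha_j(d\mu^{(n)})=0$ for $j\ge n$. As $n\to\infty$, $\mu^{(n)}\to\mu$ weakly, i.e. for every $f\in C(\mathbb{T})$, $$\lim_{n\to\infty}\int_{\mathbb{T}}f(e^{i\theta})\,d\mu^{(n)}(\theta)=\int_{\mathbb{T}}f(e^{i\theta})\,d\mu(\theta)$$ in the weak operator topology.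
   Context: $\mathcal{H}$ is a separable complex Hilbert space, $\mathcal{L}(\mathcal{H})$ its bounded operators, $A^\dagger=A^*$ the adjoint, $\mathbb{T}$ the unit circle, $C(\mathbb{T})$ the continuous complex-valued functions on $\mathbb{T}$. An operator $A$ is positive definite if $\langle Ax,x\rangle>0$ for all $x\ne0$ and $A$ has a bounded inverse. A positive operator-valued measure is a map $\mu$ from the Borel sets of $\mathbb{T}$ to $\mathcal{L}(\mathcal{H})$ such that $\sigma\mapsto\langle\mu(\sigma)h,h\rangle$ is a positive Borel measure for every $h\in\mathcal{H}$. Its moments are $\mu_j=\int_{\mathbb{T}}e^{-ij\theta}\,d\mu(\theta)\in\mathcal{L}(\mathcal{H})$, $j\in\mathbb{Z}$, so $\mu_{-j}=\mu_j^*$. For $n\ge1$ the Toeplitz operator matrices on $\mathcal{H}^n$ are $T_n^R=[\mu_{j-k}]_{j,k=0}^{n-1}$ and $T_n^L=[\mu_{k-j}]_{j,k=0}^{n-1}$. Standing assumptions on $\mu$: $\mu$ is absolutely continuous, i.e. there is a weakly measurable $\mu':\mathbb{T}\to\mathcal{L}(\mathcal{H})$, $\mu'\ge0$ a.e., with $d\langle\mu(\theta)h,h\rangle=\langle\mu'(e^{i\theta})h,h\rangle\frac{d\theta}{2\pi}$ for all $h$; and $\mu$ is nontrivial, in the sense that $T_n^R$ and $T_n^L$ are positive definite (with bounded inverse) for all $n\ge1$. Put $\nu_n=(\mu_{-n},\dots,\mu_{-1})^{T}$ and $\xi_n=(\mu_n,\dots,\mu_1)^{T}$ (block columns, entries not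 adjointed), $\kappa_n^R=\mu_0-\nu_n^*(T_n^R)^{-1}\nu_n$, $\kappa_n^L=\mu_0-\xi_n^*(T_n^L)^{-1}\xi_n$, $\kappa_0^R=\kappa_0^L=\mu_0$; these are positive definite, $\kappa_n^{R/2},\kappa_n^{L/2}$ denote their positive definite square roots and $\kappa_n^{-R/2},\kappa_n^{-L/2}$ the inverses of these. The monic right orthogonal polynomials are $\Phi_0^R=I$ and $\Phi_n^R(z)=z^nI-[I\ \ zI\ \cdots\ z^{n-1}I](T_n^R)^{-1}\nu_n$ for $n\ge1$; the normalized ones are $\varphi_n^R=\Phi_n^R\kappa_n^{-R/2}$. The Verblunsky coefficients are $\alpha_n=-\kappa_n^{-R/2}\Phi_{n+1}^R(0)^\dagger\kappa_n^{L/2}$, $n\ge0$; $\alpha_j(d\mu)$ indicates the measure, and the same definitions are applied to $\mu^{(n)}$. The operators $\varphi_n^R(z)$ are invertible for $z\in\mathbb{T}$, so $\mu^{(n)}$ is well defined. *)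

(* Defs.v *)
From HB Require Import structures.
From mathcomp Require Import all_boot all_order all_algebra.
From mathcomp Require Import all_classical all_reals all_analysis.
From mathcomp Require Import measurable_realfun complex.

Set Implicit Arguments.
Unset Strict Implicit.
Unset Printing Implicit Defensive.

Import Order.TTheory GRing.Theory Num.Theory.
Import numFieldNormedType.Exports.

Local Open Scope classical_set_scope.
Local Open Scope ring_scope.
Local Open Scope complex_scope.

HB.mixin Record CompleteNormedModule_isHilbert (R : realType) H
    of CompleteNormedModule R[i] H := {
  hdot : {dot H for (@Num.conj R[i])} ;
  hdotE : forall x : H, hdot x x = `|x| ^+ 2
}.

#[short(type="hilbertType")]
HB.structure Definition Hilbert (R : realType) :=
  {H of CompleteNormedModule R[i] H & CompleteNormedModule_isHilbert R H}.

Notation "''[' x , y ]" := (hdot x y) : ring_scope.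

Definition separable (T : topologicalType) :=
  exists D : set T, countable D /\ dense D.

Section BoundedOperators.
Context {R : realType} (H : hilbertType R).

Definition bounded_linear : {pred H -> H} :=
  [pred f : H -> H | `[< linear f /\ continuous f >]].

Fact bounded_linear_submod : submod_closed bounded_linear.
Proof.
split.
  apply/asboolP; split; last exact: cst_continuous.
  by move=> a x y /=; rewrite scaler0 addr0.
move=> a f g /asboolP[lf cf] /asboolP[lg cg]; apply/asboolP; split.
  move=> b x y; rewrite !fctE lf lg !scalerDr !scalerA mulrC.
  by rewrite addrACA.
by move=> x; apply: cvgD (cg x); apply: cvgZl_tmp; exact: cf.
Qed.

HB.instance Definition _ := GRing.isSubmodClosed.Build R[i] (H -> H)
  bounded_linear bounded_linear_submod.

Record bop := Bop { bop_fun :> H -> H ; _ : bop_fun \in bounded_linear }.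

HB.instance Definition _ := [isSub for bop_fun].
HB.instance Definition _ := [Choice of bop by <:].
HB.instance Definition _ := [SubChoice_isSubLmodule of bop by <:].

Lemma bop_linear (A : bop) : linear A.
Proof. by case: A => f /= /asboolP[]. Qed.

Lemma bop_continuous (A : bop) : continuous A.
Proof. by case: A => f /= /asboolP[]. Qed.

Fact bop_id_subproof : idfun \in bounded_linear.
Proof. by apply/asboolP; split => // x; exact: cvg_id. Qed.

Fact bop_comp_subproof (A B : bop) : (A : H -> H) \o B \in bounded_linear.
Proof.
apply/asboolP; split; first by move=> a x y /=; rewrite !bop_linear.
by move=> x; apply: continuous_comp; exact: bop_continuous.
Qed.

Definition bop_id := Bop bop_id_subproof.
Definition bop_comp A B := Bop (bop_comp_subproof A B).

Lemma bopP (A B : bop) : (A : H -> H) =1 B -> A = B.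
Proof. by move=> AB; apply/val_inj/funext. Qed.

Lemma bop_addE (A B : bop) x : (A + B) x = A x + B x.
Proof. by []. Qed.

Lemma bop_scaleE a (A : bop) x : (a *: A) x = a *: A x.
Proof. by []. Qed.

Fact bop_compA : associative bop_comp.
Proof. by move=> A B C; exact: bopP. Qed.
Fact bop_comp1l : left_id bop_id bop_comp.
Proof. by move=> A; exact: bopP. Qed.
Fact bop_comp1r : right_id bop_id bop_comp.
Proof. by move=> A; exact: bopP. Qed.
Fact bop_compDl : left_distributive bop_comp +%R.
Proof. by move=> A B C; exact: bopP. Qed.
Fact bop_compDr : right_distributive bop_comp +%R.
Proof.
move=> A B C; apply: bopP => x.
by have := bop_linear A 1 (B x) (C x); rewrite !scale1r.
Qed.

HB.instance Definition _ := GRing.Zmodule_isPzRing.Build bop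
  bop_compA bop_comp1l bop_comp1r bop_compDl bop_compDr.

End BoundedOperators.

Section Inverses.
Context {L : pzRingType}.
Implicit Types a b : L.

Definition is_inverse a b := a * b = 1 /\ b * a = 1.

Definition invertible a := exists b, is_inverse a b.

(* 0 if a is not invertible *)
Definition inverse a : L := xget 0 [set b | is_inverse a b].

End Inverses.

Section OperatorTheory.
Context {R : realType} {H : hilbertType R}.
Implicit Types A B : bop H.

(* The adjoint exists by the Riesz representation theorem. *)
Definition adjoint A : bop H :=
  xget 0 [set B : bop H | forall x y, '[A x, y] = '[x, B y]].

(* In the order of R[i], 0 <= c (resp. 0 < c) means that c is a nonnegative
   (resp. positive) real number. *)
Definition nonneg_op A := forall x : H, 0 <= '[A x, x].

Definition posdef_op A :=
  (forall x : H, x != 0 -> 0 < '[A x, x]) /\ invertible A.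

Definition sqrt_op A : bop H := xget 0 [set B : bop H | posdef_op B /\ B * B = A].

(* The bounded operators on H^n are the n x n matrices over bop H, with
   composition as matrix product; H^n is represented by column vectors. *)
Definition opmx_app n (T : 'M[bop H]_n) (x : 'cV[H]_n) : 'cV[H]_n :=
  \col_j \sum_(k < n) (T j k) (x k 0).

Definition cvdot n (x y : 'cV[H]_n) : R[i] := \sum_(j < n) '[x j 0, y j 0].

Definition posdef_opmx n (T : 'M[bop H]_n) :=
  (forall x : 'cV[H]_n, x != 0 -> 0 < cvdot (opmx_app T x) x) /\
  @invertible 'M[bop H]_n T.

Definition inverse_mx n (T : 'M[bop H]_n) : 'M[bop H]_n := @inverse 'M[bop H]_n T.

Definition adjoint_mx m n (T : 'M[bop H]_(m, n)) : 'M[bop H]_(n, m) :=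
  (map_mx adjoint T)^T.

Definition wot_cvg (A : nat -> bop H) (B : bop H) :=
  forall x y : H, (fun n => '[A n x, y] : R[i]^o) @ \oo --> ('[B x, y] : R[i]^o).

End OperatorTheory.

Section Circle.
Context (R : realType).

Definition circle : Type := [set z : R[i]^o | `|z| = 1].

HB.instance Definition _ := Topological.on circle.

Definition circle_val (z : circle) : R[i] := \val z.
Coercion circle_val : circle >-> complex.

Fact expi_subproof (t : R) :
  (cos t +i* sin t : R[i]^o) \in [set z : R[i]^o | `|z| = 1].
Proof. by rewrite inE /= normc_def /= cos2Dsin2 sqrtr1. Qed.

Definition expi (t : R) : circle := SigSub (expi_subproof t).

HB.instance Definition _ := isPointed.Build circle (expi 0).

HB.instance Definition _ :=
  Measurable.copy circle (g_sigma_algebraType (@open circle)).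

Lemma continuous_expi : continuous expi.
Proof.
apply/continuousP => _ [B oB <-]; rewrite -comp_preimage.
move: B oB; apply/continuousP => t; apply/cvgrPdist_lt => e.
rewrite ltcE /= => /andP[/eqP eIm eRe].
pose d := complex.Re e / 2.
have d0 : 0 < d by rewrite divr_gt0.
near=> s.
have -> : e = (d + d)%:C.
  rewrite /d; case: (e) eIm => a b /= -> ; by rewrite -splitr.
have h : `| (cos t - cos s) +i* (sin t - sin s) | <=
  (`|cos t - cos s| + `|sin t - sin s|)%:C :> R[i].
  have -> : (cos t - cos s) +i* (sin t - sin s) =
    (cos t - cos s)%:C + (0 +i* (sin t - sin s)) by simpc.
  rewrite (le_trans (ler_normD _ _))// !normc_def /= expr0n addr0 add0r.
  by rewrite !sqrtr_sqr rmorphD.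
apply: le_lt_trans h _; rewrite ltcR ltrD//.
  near: s; have /cvgrPdist_lt := @continuous_cos R t; exact.
near: s; have /cvgrPdist_lt := @continuous_sin R t; exact.
Unshelve. all: by end_near.
Qed.

Lemma measurable_expi :
  measurable_fun setT (expi : measurableTypeR R -> circle).
Proof.
apply: (@measurability _ _ (measurableTypeR R) circle setT expi (@open circle)).
  by [].
move=> _ [B oB <-]; rewrite setTI; apply: open_measurable.
by move/continuousP: continuous_expi; exact.
Qed.

HB.instance Definition _ := @isMeasurableFun.Build _ _ (measurableTypeR R) circle
  expi measurable_expi.

Fact inv2pi_ge0 : 0 <= (2 * pi : R)^-1.
Proof. by rewrite invr_ge0 mulr_ge0 ?pi_ge0. Qed.

Definition arc_measure : {measure set (measurableTypeR R) -> \bar R} :=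
  mscale (NngNum inv2pi_ge0)
   (mrestr lebesgue_measure (measurable_itv `[0, 2 * pi[)).

(* dtheta / 2pi *)
Definition circle_measure : set circle -> \bar R := pushforward arc_measure expi.

Let circle_measure0 : circle_measure set0 = 0%E.
Proof. by rewrite /circle_measure /pushforward preimage_set0 measure0. Qed.

Let circle_measure_ge0 A : (0 <= circle_measure A)%E.
Proof. by rewrite /circle_measure /pushforward measure_ge0. Qed.

Let circle_measure_sadd : semi_sigma_additive circle_measure.
Proof.
move=> F mF tF mUF; rewrite /circle_measure /pushforward preimage_bigcup.
have mexpi B : measurable B -> measurable (expi @^-1` B : set (measurableTypeR R)).
  by move=> mB; rewrite -[X in measurable X]setTI; exact: measurable_expi.
apply: measure_semi_sigma_additive.
- by move=> n; exact: mexpi.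
- apply/trivIsetP => /= i j _ _ ij; rewrite -preimage_setI.
  by move/trivIsetP : tF => /(_ _ _ _ _ ij) ->//; rewrite preimage_set0.
- by rewrite -preimage_bigcup; exact: mexpi.
Qed.

HB.instance Definition _ := isMeasure.Build _ _ _ circle_measure
  circle_measure0 circle_measure_ge0 circle_measure_sadd.

End Circle.

Section OperatorMeasures.
Context {R : realType} {H : hilbertType R}.
Local Notation T := (circle R).
(* Only the values on Borel sets matter. *)
Implicit Types mu : set T -> bop H.

Definition same_real (c : R[i]) (v : \bar R) := exists2 r : R, c = r%:C & v = r%:E.

Definition scalar_measure mu (h : H) (m : set T -> \bar R) :=
  forall s, measurable s -> same_real '[mu s h, h] (m s).

Definition is_povm mu :=
  forall h, exists m : {measure set T -> \bar R}, scalar_measure mu h m.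

Definition cintegral (m : {measure set T -> \bar R}) (f : T -> R[i]) : R[i] :=
  (\int[m]_z complex.Re (f z)) +i* (\int[m]_z complex.Im (f z)).

(* The operator B with <B h, h> = \int f d<mu h, h> for all h; it is unique by
   polarization, and it exists when mu is an operator-valued measure and f is
   bounded and Borel. *)
Definition povm_integral mu (f : T -> R[i]) : bop H :=
  xget 0 [set B : bop H | forall h,
    exists2 m : {measure set T -> \bar R},
      scalar_measure mu h m & '[B h, h] = cintegral m f].

Definition weakly_measurable (w : T -> bop H) := forall x y : H,
  measurable_fun setT (fun z => complex.Re '[w z x, y]) /\
  measurable_fun setT (fun z => complex.Im '[w z x, y]).

Definition density_measure (w : T -> bop H) (h : H) (s : set T) : \bar R :=
  (\int[@circle_measure R]_(z in s) (complex.Re '[w z h, h])%:E)%E.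

Definition has_density mu (w : T -> bop H) :=
  [/\ weakly_measurable w,
      {ae @circle_measure R, forall z, nonneg_op (w z)} &
      forall h, scalar_measure mu h (density_measure w h)].

Definition absolutely_continuous mu := exists w, has_density mu w.

Definition with_density (w : T -> bop H) (s : set T) : bop H :=
  xget 0 [set B : bop H | forall h, same_real '[B h, h] (density_measure w h s)].

Definition moment mu (j : int) : bop H :=
  povm_integral mu (fun z => (z : R[i]) ^ (- j)).

Definition toeplitzR mu n : 'M[bop H]_n := \matrix_(j, k) moment mu (j%:Z - k%:Z).

Definition toeplitzL mu n : 'M[bop H]_n := \matrix_(j, k) moment mu (k%:Z - j%:Z).

Definition nontrivial_povm mu := forall n, (0 < n)%N ->
  posdef_opmx (toeplitzR mu n) /\ posdef_opmx (toeplitzL mu n).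

Definition nu mu n : 'cV[bop H]_n := \col_j moment mu (j%:Z - n%:Z).

Definition xi mu n : 'cV[bop H]_n := \col_j moment mu (n%:Z - j%:Z).

(* For n = 0 the matrix products below are empty sums, so that
   kappaR mu 0 = kappaL mu 0 = moment mu 0 and PhiR mu 0 z = 1. *)
Definition kappaR mu n : bop H := moment mu 0 -
  (adjoint_mx (nu mu n) *m inverse_mx (toeplitzR mu n) *m nu mu n) 0 0.

Definition kappaL mu n : bop H := moment mu 0 -
  (adjoint_mx (xi mu n) *m inverse_mx (toeplitzL mu n) *m xi mu n) 0 0.

Definition PhiR mu n (z : R[i]) : bop H := z ^+ n *: (1 : bop H) -
  ((\row_(j < n) (z ^+ j *: (1 : bop H))) *m inverse_mx (toeplitzR mu n) *m nu mu n) 0 0.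

Definition phiR mu n (z : R[i]) : bop H :=
  PhiR mu n z * inverse (sqrt_op (kappaR mu n)).

Definition verblunsky mu n : bop H :=
  - (inverse (sqrt_op (kappaR mu n)) * adjoint (PhiR mu n.+1 0) *
     sqrt_op (kappaL mu n)).

Definition bernstein_szego_density mu n (z : T) : bop H :=
  inverse (phiR mu n z * adjoint (phiR mu n z)).

Definition bernstein_szego mu n : set T -> bop H :=
  with_density (bernstein_szego_density mu n).

End OperatorMeasures.

(* Main.v *)
From HB Require Import structures.
Require Import Defs.
From mathcomp Require Import all_boot all_order all_algebra.
From mathcomp Require Import all_classical all_reals all_analysis.
From mathcomp Require Import measurable_realfun complex zify ring lra.
(** Let s be the moment sequence of mu, T the Toeplitz matrix of s of size n + 1, and
    Phi_n, kappa_n the monic orthogonal polynomial and its square norm. On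
    polynomials of degree at most n with values in H, with the scalar product of T,
    let A be the orthogonal projection to degree less than n followed by
    multiplication by z ([companion]). Multiplication by z is isometric, and the
    projection forgets the component along Phi_n, whence the Stein equation ([stein])
      <T A f, A g> = <T f, g> - <kappa_n f_n, g_n>.
    A small perturbation of T is then a strict Lyapunov function for A ([lyapunov]),
    so 1 - A/z is invertible, uniformly for z on the circle, and the powers of A tend
    to zero along subsequences.

    A corner entry of the resolvent (1 - A/z)^-1 is Phi_n(z)^-1 ([Phi_inverse]), so
    the Bernstein-Szego density is W_n = (Phi_n^-1)^* kappa_n Phi_n^-1. By the Stein
    equation again its forms are linear in the resolvent and its conjugate
    ([bs_dens_resolvent]), and the Neumann expansion of the resolvent gives all the
    moments of W_n ([bs_dens_fourier]): the moment of order -m is T A^m at constant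
    polynomials. For m <= n no reduction occurs and it equals s_(-m)
    ([bs_moment_agree]); beyond n the moments follow the linear recursion with
    characteristic polynomial Phi_n ([bs_moment_recursion]).

    The rest is formal. The first n Verblunsky coefficients only involve moments of
    order at most n. By the recursion the orthogonal polynomials of W_n of degree
    j + 1 > n are z^(j+1-n) Phi_n, which vanish at 0 ([Phi_recursion]), and so do the
    corresponding Verblunsky coefficients. Each moment of W_n is eventually that of mu,
    all the measures have total mass 1, and continuous functions are uniformly
    approximated by Fejer means; this gives weak convergence ([fourier_agree_cvg]).

    Two supporting theories are developed on the way. The operators occurring in the
    definitions are characterized by properties and obtained by choice, so their
    existence has to be proved: adjoints by Riesz, inverses by Neumann series and
    block elimination ([coercive_mx_invertible]), square roots by a fixed point
    ([coercive_sqrt_exists]). Integrals against an operator measure with a density are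
    reduced to scalar integrals of the forms of the density ([povm_integralE]). *)

Set Implicit Arguments.
Unset Strict Implicit.
Unset Printing Implicit Defensive.

Import Order.TTheory GRing.Theory Num.Theory.
Import numFieldNormedType.Exports.
Local Open Scope classical_set_scope.
Local Open Scope ring_scope.
Local Open Scope complex_scope.

Local Notation Re := complex.Re.
Local Notation Im := complex.Im.


(** * Complex numbers *)

Section ComplexParts.
Context {R : realType}.
Implicit Types a b : R[i].

Lemma cReD a b : Re (a + b) = Re a + Re b.
Proof. by case: a b => [? ?] []. Qed.

Lemma cImD a b : Im (a + b) = Im a + Im b.
Proof. by case: a b => [? ?] []. Qed.

Lemma cReN a : Re (- a) = - Re a.
Proof. by case: a. Qed.

Lemma cImN a : Im (- a) = - Im a.
Proof. by case: a. Qed.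

Lemma cReB a b : Re (a - b) = Re a - Re b.
Proof. by rewrite cReD cReN. Qed.

Lemma cImB a b : Im (a - b) = Im a - Im b.
Proof. by rewrite cImD cImN. Qed.

Lemma cReM a b : Re (a * b) = Re a * Re b - Im a * Im b.
Proof. by case: a b => [? ?] []. Qed.

Lemma cImM a b : Im (a * b) = Re a * Im b + Im a * Re b.
Proof. by case: a b => [? ?] []. Qed.

Lemma cReZ (r : R) a : Re (r%:C * a) = r * Re a.
Proof. by rewrite cReM /= mul0r subr0. Qed.

Lemma cImZ (r : R) a : Im (r%:C * a) = r * Im a.
Proof. by rewrite cImM /= mul0r addr0. Qed.

Lemma conjE a : Num.conj a = (a^*)%C.
Proof. by []. Qed.

Lemma cconjM a b : Num.conj (a * b) = Num.conj a * Num.conj b.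
Proof. exact: (rmorphM (@Num.conj R[i])). Qed.

Lemma cconj_real (r : R) : Num.conj (r%:C : R[i]) = r%:C.
Proof. exact: conjc_real. Qed.

Lemma cconj_sum I (r : seq I) (P : pred I) (F : I -> R[i]) :
  Num.conj (\sum_(i <- r | P i) F i) = \sum_(i <- r | P i) Num.conj (F i).
Proof. exact: (rmorph_sum (@Num.conj R[i])). Qed.

Lemma cReJ a : Re (Num.conj a) = Re a.
Proof. by case: a. Qed.

Lemma cImJ a : Im (Num.conj a) = - Im a.
Proof. by case: a. Qed.

Lemma Re_sum I (r : seq I) (P : pred I) (F : I -> R[i]) :
  Re (\sum_(i <- r | P i) F i) = \sum_(i <- r | P i) Re (F i).
Proof. exact: (big_morph _ cReD (erefl _)). Qed.

Lemma eqcP a b : Re a = Re b -> Im a = Im b -> a = b.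
Proof. by case: a b => [? ?] [? ?] /= -> ->. Qed.

(** The norms of R[i] and of H take values in R[i]; [mod] and [nrm] are their real
    versions, on which the linear arithmetic tactics work. *)
Definition mod a : R := Re `|a|.

Lemma modC a : `|a| = (mod a)%:C.
Proof. by rewrite /mod normc_def. Qed.

Lemma mod_ge0 a : 0 <= mod a.
Proof. by rewrite -lecR -modC; exact: normr_ge0. Qed.

Lemma mod0 : mod 0 = 0.
Proof. by rewrite /mod normr0. Qed.

Lemma mod_sqr a : mod a ^+ 2 = Re a ^+ 2 + Im a ^+ 2.
Proof. by apply: complexI; rewrite rmorphXn /= -modC -add_Re2_Im2. Qed.

Lemma mod1 : mod 1 = 1.
Proof. by rewrite /mod normr1. Qed.

Lemma modM a b : mod (a * b) = mod a * mod b.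
Proof. by apply: complexI; rewrite -modC normrM rmorphM /= -!modC. Qed.

Lemma modD a b : mod (a + b) <= mod a + mod b.
Proof. by rewrite -lecR rmorphD /= -!modC ler_normD. Qed.

Lemma modN a : mod (- a) = mod a.
Proof. by rewrite /mod normrN. Qed.

Lemma modJ a : mod (Num.conj a) = mod a.
Proof. by rewrite /mod normcJ. Qed.

Lemma mod_real (r : R) : mod r%:C = `|r|.
Proof. by rewrite /mod normc_def /= expr0n /= addr0 sqrtr_sqr. Qed.

Lemma ler_Re_mod a : `|Re a| <= mod a.
Proof. by rewrite -lecR -modC normc_ge_Re. Qed.

Lemma ler_Im_mod a : `|Im a| <= mod a.
Proof.
by rewrite -(ler_pXn2r (n := 2)) ?nnegrE ?mod_ge0 //= mod_sqr real_normK ?num_real // lerDr sqr_ge0.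
Qed.

Lemma mod_eq0 a : mod a = 0 -> a = 0.
Proof. by move=> h; apply/eqP; rewrite -normr_eq0 modC h. Qed.

(** Taking u to be the conjugate phase of a: a bound on real parts that is stable
    under multiplication by unimodular numbers is a bound on the modulus. *)
Lemma mod_phase a : exists2 u : R[i], mod u = 1 & Re (u * a) = mod a.
Proof.
have [->|a0] := eqVneq a 0.
  by exists 1; rewrite ?mulr0 ?mod0 ?mod1.
have m0 : `|a| != 0 by rewrite normr_eq0.
exists (Num.conj a / `|a|).
  apply: complexI; rewrite -modC normrM normfV normr_id.
  by rewrite conjE normcJ divff.
rewrite mulrAC [_ * a]mulrC -(sqr_normc a) expr2 mulfK //.
Qed.

End ComplexParts.

(** * Hilbert space geometry *)

Section Geometry.
Context {R : realType} {H : hilbertType R}.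
Implicit Types x y z : H.

Lemma hdotDl x y z : '[x + y, z] = '[x, z] + '[y, z] :> R[i].
Proof. exact: (linearDl (@hdot R H) z x y). Qed.

Lemma hdotDr x y z : '[x, y + z] = '[x, y] + '[x, z] :> R[i].
Proof. exact: (linearDr (@hdot R H) x y z). Qed.

Lemma hdotNl x y : '[- x, y] = - '[x, y] :> R[i].
Proof. exact: (linearNl (@hdot R H) y x). Qed.

Lemma hdotNr x y : '[x, - y] = - '[x, y] :> R[i].
Proof. exact: (linearNr (@hdot R H) x y). Qed.

Lemma hdotBl x y z : '[x - y, z] = '[x, z] - '[y, z] :> R[i].
Proof. exact: (linearBl (@hdot R H) z x y). Qed.

Lemma hdotBr x y z : '[x, y - z] = '[x, y] - '[x, z] :> R[i].
Proof. exact: (linearBr (@hdot R H) x y z). Qed.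

Lemma hdotZl a x y : '[a *: x, y] = a * '[x, y] :> R[i].
Proof. exact: (linearZl_LR (@hdot R H) y a x). Qed.

Lemma hdotZr a x y : '[x, a *: y] = Num.conj a * '[x, y] :> R[i].
Proof. exact: (linearZr_LR (@hdot R H) x a y). Qed.

Lemma hdot0l x : '[0, x] = 0 :> R[i].
Proof. exact: (linear0l (@hdot R H) x). Qed.

Lemma hdot0r x : '[x, 0] = 0 :> R[i].
Proof. exact: (linear0r (@hdot R H) x). Qed.

Lemma hdotC x y : '[x, y] = Num.conj '[y, x] :> R[i].
Proof. by rewrite (hermC (@hdot R H)) expr0 mul1r. Qed.

Lemma hdot_suml I (r : seq I) (P : pred I) (F : I -> H) y :
  '[\sum_(i <- r | P i) F i, y] = \sum_(i <- r | P i) '[F i, y] :> R[i].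
Proof. exact: (big_morph (fun x => '[x, y] : R[i]) (fun u v => hdotDl u v y) (hdot0l y)). Qed.

Lemma hdot_sumr I (r : seq I) (P : pred I) (F : I -> H) y :
  '[y, \sum_(i <- r | P i) F i] = \sum_(i <- r | P i) '[y, F i] :> R[i].
Proof. exact: (big_morph (fun x => '[y, x] : R[i]) (hdotDr y) (hdot0r y)). Qed.

Definition nrm x : R := Re `|x|.

Lemma nrmC x : `|x| = (nrm x)%:C.
Proof.
by rewrite /nrm -{1}[`|x|](RRe_real (ger0_real (normr_ge0 x))).
Qed.

Lemma nrm_ge0 x : 0 <= nrm x.
Proof. by rewrite -lecR -nrmC; exact: normr_ge0. Qed.

Lemma nrm0 : nrm 0 = 0.
Proof. by rewrite /nrm normr0. Qed.

Lemma nrm_eq0 x : (nrm x == 0) = (x == 0).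
Proof.
apply/eqP/eqP => [h|->]; last exact: nrm0.
by apply/eqP; rewrite -normr_eq0 nrmC h.
Qed.

Lemma nrm_gt0 x : (0 < nrm x) = (x != 0).
Proof. by rewrite lt_neqAle nrm_ge0 andbT eq_sym nrm_eq0. Qed.

Lemma nrmN x : nrm (- x) = nrm x.
Proof. by rewrite /nrm normrN. Qed.

Lemma nrmB x y : nrm (x - y) = nrm (y - x).
Proof. by rewrite -nrmN opprB. Qed.

Lemma nrmD x y : nrm (x + y) <= nrm x + nrm y.
Proof. by rewrite -lecR rmorphD /= -!nrmC ler_normD. Qed.

Lemma nrm_subD x y z : nrm (x - z) <= nrm (x - y) + nrm (y - z).
Proof. by rewrite -[x - z](subrKA y) nrmD. Qed.

Lemma nrmZ a x : nrm (a *: x) = mod a * nrm x.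
Proof. by apply: complexI; rewrite rmorphM /= -!nrmC normrZ modC. Qed.

Lemma nrm_sum I (r : seq I) (P : pred I) (F : I -> H) :
  nrm (\sum_(i <- r | P i) F i) <= \sum_(i <- r | P i) nrm (F i).
Proof.
elim/big_rec2: _ => [|i y1 y2 _ h]; first by rewrite nrm0.
by apply: le_trans (nrmD _ _) _; rewrite lerD2l.
Qed.

Lemma hdotxx x : '[x, x] = (nrm x ^+ 2)%:C.
Proof. by rewrite hdotE nrmC rmorphXn. Qed.

Lemma Re_hdotxx x : Re '[x, x] = nrm x ^+ 2.
Proof. by rewrite hdotxx. Qed.

Lemma Re_hdotC x y : Re '[x, y] = Re '[y, x] :> R.
Proof. by rewrite hdotC cReJ. Qed.

Lemma nrm_sqrD x y : nrm (x + y) ^+ 2 = nrm x ^+ 2 + nrm y ^+ 2 + 2 * Re '[x, y].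
Proof.
rewrite -!Re_hdotxx hdotDl !hdotDr !cReD (Re_hdotC y x); ring.
Qed.

Lemma nrm_sqrB x y : nrm (x - y) ^+ 2 = nrm x ^+ 2 + nrm y ^+ 2 - 2 * Re '[x, y].
Proof. by rewrite nrm_sqrD nrmN hdotNr cReN mulrN. Qed.

Lemma parallelogram x y :
  nrm (x + y) ^+ 2 + nrm (x - y) ^+ 2 = 2 * nrm x ^+ 2 + 2 * nrm y ^+ 2.
Proof. by rewrite nrm_sqrD nrm_sqrB; ring. Qed.

Lemma Re_hdot_le x y : Re '[x, y] <= nrm x * nrm y.
Proof.
have := nrmD x y; rewrite -(ler_pXn2r (n := 2)) ?nnegrE ?addr_ge0 ?nrm_ge0 //.
by rewrite nrm_sqrD; lra.
Qed.

Lemma hdot_le x y : mod '[x, y] <= nrm x * nrm y.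
Proof.
have [u u1 <-] := mod_phase '[x, y].
by rewrite -hdotZl (le_trans (Re_hdot_le _ _)) // nrmZ u1 mul1r.
Qed.

Lemma hdot_eq0 x : (forall y, '[x, y] = 0 :> R[i]) -> x = 0.
Proof.
move=> h; apply/eqP; rewrite -nrm_eq0 -sqrf_eq0; apply/eqP.
by apply: complexI; rewrite -hdotxx h.
Qed.

Lemma hdot_inj x y : (forall z, '[x, z] = '[y, z] :> R[i]) -> x = y.
Proof.
by move=> h; apply/eqP; rewrite -subr_eq0; apply/eqP/hdot_eq0 => z; rewrite hdotBl h subrr.
Qed.

Lemma nrm_complete (u : nat -> H) :
  (forall e : R, 0 < e -> exists N, forall m n, (N <= m)%N -> (N <= n)%N ->
     nrm (u m - u n) < e) ->
  exists l, forall e : R, 0 < e -> exists N, forall n, (N <= n)%N -> nrm (u n - l) < e.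
Proof.
move=> cu.
have real_pos (e : R[i]) : 0 < e -> exists2 r : R, 0 < r & e = r%:C.
  move=> e0; exists (Re e); last by rewrite RRe_real ?gtr0_real.
  by move: e0; rewrite ltcE => /andP[].
have /cauchy_cvgP : cauchy (u @ \oo).
  apply/cauchy_ballP => e /real_pos[r r0 ->].
  have [N hN] := cu r r0.
  exists (u @` [set n | (N <= n)%N], u @` [set n | (N <= n)%N]).
    by split; (exists N => // n /= Nn; exists n).
  move=> [x y] /= [[m Nm <-] [n Nn <-]].
  by rewrite -ball_normE /= nrmC ltcR hN.
move=> /cvg_ex[l hl]; exists l => e e0.
have : 0 < e%:C by rewrite ltcR.
move/cvgrPdist_lt : hl => /[apply] -[N _ hN].
by exists N => n /hN; rewrite distrC nrmC ltcR.
Qed.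

Lemma nrm_lim_unique (u : nat -> H) l l' :
  (forall e : R, 0 < e -> exists N, forall n, (N <= n)%N -> nrm (u n - l) < e) ->
  (forall e : R, 0 < e -> exists N, forall n, (N <= n)%N -> nrm (u n - l') < e) ->
  l = l'.
Proof.
move=> ul ul'; apply/eqP; rewrite -subr_eq0 -nrm_eq0 eq_le nrm_ge0 andbT.
apply/ler_addgt0Pr => e e0; rewrite add0r.
have e20 : 0 < e / 2 by rewrite divr_gt0.
have [N hN] := ul _ e20; have [N' hN'] := ul' _ e20.
have := hN (maxn N N') (leq_maxl _ _); have := hN' (maxn N N') (leq_maxr _ _).
have := nrm_subD l (u (maxn N N')) l'; rewrite (nrmB l (u _)).
by lra.
Qed.

End Geometry.

(** * Elementary limits *)

Lemma inv_nat_small {R : realType} (e : R) : 0 < e ->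
  exists N, forall n, (N <= n)%N -> n.+1%:R^-1 < e.
Proof.
move=> e0; have [N hN] := ltr_add_invr e0.
exists N => n Nn; apply: le_lt_trans hN; rewrite add0r.
by rewrite lef_pV2 ?posrE // ler_nat.
Qed.

Lemma geometric_small {R : realType} (K q e : R) : 0 <= q -> q < 1 -> 0 < e ->
  exists N, forall n, (N <= n)%N -> K * q ^+ n < e.
Proof.
move=> q0 q1 e0.
have : (fun n => K * q ^+ n) @ \oo --> K * 0.
  by apply: cvgMr; apply: cvg_expr; rewrite ger0_norm.
rewrite mulr0 => /cvgrPdist_lt /(_ e e0)[N _ hN].
exists N => n /hN; rewrite sub0r normrN; exact/le_lt_trans/ler_norm.
Qed.

(** * Bounded operators, adjoints and inverses *)

Section InverseTheory.
Context {L : pzRingType}.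
Implicit Types a b c : L.

Lemma is_inverse_inj a b c : is_inverse a b -> is_inverse a c -> b = c.
Proof. by move=> [ab ba] [ac ca]; rewrite -[b]mulr1 -ac mulrA ba mul1r. Qed.

Lemma inverseP a : invertible a -> is_inverse a (inverse a).
Proof. by move=> [b hb]; exact: (xgetPex 0 (ex_intro _ b hb)). Qed.

Lemma inverseE a b : is_inverse a b -> inverse a = b.
Proof. by move=> h; apply: (@is_inverse_inj a) => //; apply: inverseP; exists b. Qed.

Lemma is_inverseM a b c d : is_inverse a b -> is_inverse c d ->
  is_inverse (a * c) (d * b).
Proof.
move=> [ab ba] [cd dc]; split.
  by rewrite mulrA -(mulrA a) cd mulr1 ab.
by rewrite mulrA -(mulrA d) ba mulr1 dc.
Qed.

Lemma is_inverse_sym a b : is_inverse a b -> is_inverse b a.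
Proof. by case. Qed.

End InverseTheory.

Section Operators.
Context {R : realType} {H : hilbertType R}.
Implicit Types (A B : bop H) (x y z : H).

Lemma bopD A x y : A (x + y) = A x + A y.
Proof. by have := bop_linear A 1 x y; rewrite !scale1r. Qed.

Lemma bop0 A : A 0 = 0.
Proof. by apply: (addrI (A 0)); rewrite -bopD !addr0. Qed.

Lemma bopZ A a x : A (a *: x) = a *: A x.
Proof. by have := bop_linear A a x 0; rewrite bop0 !addr0. Qed.

Lemma bopN A x : A (- x) = - A x.
Proof. by rewrite -scaleN1r bopZ scaleN1r. Qed.

Lemma bopB A x y : A (x - y) = A x - A y.
Proof. by rewrite bopD bopN. Qed.

Lemma bop_sumr A I (r : seq I) (P : pred I) (F : I -> H) :
  A (\sum_(i <- r | P i) F i) = \sum_(i <- r | P i) A (F i).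
Proof. exact: (big_morph _ (bopD A) (bop0 A)). Qed.

Lemma bop_mulE A B x : (A * B) x = A (B x).
Proof. by []. Qed.

Lemma bop_oneE x : (1 : bop H) x = x.
Proof. by []. Qed.

Lemma bop_zeroE x : (0 : bop H) x = 0.
Proof. by []. Qed.

Lemma bop_oppE A x : (- A) x = - A x.
Proof. by []. Qed.

Lemma bop_subE A B x : (A - B) x = A x - B x.
Proof. by []. Qed.

Lemma bop_suml I (r : seq I) (P : pred I) (F : I -> bop H) x :
  (\sum_(i <- r | P i) F i) x = \sum_(i <- r | P i) F i x.
Proof. by apply: (big_morph (fun B : bop H => B x)). Qed.

Definition bopE := (bop_mulE, bop_oneE, bop_zeroE, bop_oppE, @bop_addE R H,
  @bop_scaleE R H, bop_suml).

Lemma bop_scaleAl a A B : (a *: A) * B = a *: (A * B).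
Proof. by apply: bopP => x. Qed.

Lemma bop_scaleAr a A B : A * (a *: B) = a *: (A * B).
Proof. by apply: bopP => x; rewrite !bopE bopZ. Qed.

Lemma bop_bounded A : exists2 M : R, 0 < M & forall x, nrm (A x) <= M * nrm x.
Proof.
pose f : {linear H -> H} := HB.pack (A : H -> H)
  (GRing.isLinear.Build R[i] H H _ (A : H -> H) (bop_linear A)).
have /linear_boundedP : bounded_near f (nbhs 0).
  exact/continuous_linear_bounded/(@bop_continuous R H A 0).
move=> [M [Mr hM]]; exists (Num.max (Re M + 1) 1); first by rewrite lt_max ltr01 orbT.
move=> x; rewrite -lecR rmorphM /= -!nrmC; apply: hM.
rewrite -[M](RRe_real Mr) ltcR lt_max; apply/orP; left.
by rewrite RRe_real // ltrDl.
Qed.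

Lemma bounded_bop (f : H -> H) (M : R) : linear f ->
  (forall x, nrm (f x) <= M * nrm x) -> exists B, (B : H -> H) =1 f.
Proof.
move=> lf fM.
pose g : {linear H -> H} := HB.pack f (GRing.isLinear.Build R[i] H H _ f lf).
have cf : continuous g.
  apply: bounded_linear_continuous; apply/linear_boundedP.
  exists M%:C; split; first by apply/complex_realP; exists M.
  move=> r hr x; rewrite nrmC.
  apply: (le_trans (y := (M * nrm x)%:C)); first by rewrite lecR.
  by rewrite rmorphM /= -nrmC ler_wpM2r // ltW.
have bf : f \in @bounded_linear R H by apply/asboolP.
by exists (Bop bf).
Qed.

(** Riesz: a minimizing sequence of |x|^2 - 2 Re phi x is Cauchy by the
    parallelogram law, and its limit represents phi. *)
Lemma riesz (phi : H -> R[i]) (M : R) :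
  (forall a x y, phi (a *: x + y) = a * phi x + phi y) ->
  (forall x, mod (phi x) <= M * nrm x) ->
  exists y, forall x, phi x = '[x, y].
Proof.
move=> lphi bphi.
have phiD x y : phi (x + y) = phi x + phi y.
  by have := lphi 1 x y; rewrite scale1r mul1r.
have phi0 : phi 0 = 0 by apply: (addrI (phi 0)); rewrite -phiD !addr0.
have phiZ a x : phi (a *: x) = a * phi x.
  by have := lphi a x 0; rewrite phi0 !addr0.
pose J x := nrm x ^+ 2 - 2 * Re (phi x).
have Jlb x : - (M ^+ 2) <= J x.
  have := le_trans (ler_norm _) (le_trans (ler_Re_mod _) (bphi x)).
  by have := sqr_ge0 (nrm x - M); rewrite /J; nra.
have hinf : has_inf (range J).
  split; first by exists (J 0), 0.
  by exists (- (M ^+ 2)) => _ [x _ <-].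
pose d := inf (range J).
have dJ x : d <= J x by apply: ge_inf; [exact: hinf.2 | exists x].
have [u uJ] : exists u : nat -> H, forall n, J (u n) < d + n.+1%:R^-1.
  suff /choice[u hu] : forall n, exists x, J x < d + n.+1%:R^-1 by exists u.
  move=> n; have n0 : 0 < n.+1%:R^-1 :> R by rewrite invr_gt0.
  by have [_ [x _ <-] hx] := inf_adherent n0 hinf; exists x.
(* u is a minimizing sequence; by the midpoint identity it is Cauchy *)
have Jmid x y : J x + J y - 2 * J ((2^-1)%:C *: (x + y)) = nrm (x - y) ^+ 2 / 2.
  have := parallelogram x y.
  rewrite /J phiZ nrmZ mod_real phiD exprMn real_normK ?num_real // !cReM !cReD /= mul0r subr0.
  by move=> h; lra.
have [l hl] : exists l, forall e : R, 0 < e ->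
    exists N, forall n, (N <= n)%N -> nrm (u n - l) < e.
  apply: nrm_complete => e e0.
  have e20 : 0 < e ^+ 2 / 4 by rewrite divr_gt0 // exprn_gt0.
  have [N hN] := inv_nat_small e20; exists N => m n Nm Nn.
  rewrite -(ltr_pXn2r (n := 2)) ?nnegrE ?nrm_ge0 ?ltW //.
  have := Jmid (u m) (u n); have := dJ ((2^-1)%:C *: (u m + u n)).
  have := uJ m; have := uJ n; have := hN m Nm; have := hN n Nn.
  by move: (m.+1%:R^-1) (n.+1%:R^-1) => a b; lra.
(* the limit l minimizes J, so the first variation of J at l is zero *)
have step h : 0 <= nrm h ^+ 2 + 2 * (Re '[l, h] - Re (phi h)).
  apply/ler_addgt0Pr => e e0.
  pose K := 2 * (nrm h + 1) + 1.
  have K0 : 0 < K by rewrite /K; have := nrm_ge0 h; lra.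
  have [f fK] : exists f, f * K = e by exists (e / K); rewrite divfK // gt_eqF.
  have f0 : 0 < f by rewrite -(pmulr_lgt0 _ K0) fK.
  have [N hN] := inv_nat_small f0; have [N' hN'] := hl _ f0.
  pose n := maxn N N'.
  have h1 := hN n (leq_maxl _ _); have h2 := hN' n (leq_maxr _ _).
  have h3 := dJ (u n + h); have h4 := uJ n.
  have h5 := Re_hdot_le (u n - l) h.
  have h6 : nrm (u n - l) * nrm h <= f * nrm h.
    by rewrite ler_wpM2r ?nrm_ge0 // ltW.
  move: h3 h4 h5 h1 h6 fK; rewrite /J nrm_sqrD phiD !cReD hdotBl cReB /K.
  by move: (n.+1%:R^-1) (nrm (u n - l) * nrm h) => a b; lra.
have rstep h : Re '[l, h] = Re (phi h).
  set b := Re '[l, h] - Re (phi h).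
  suff : b = 0 by rewrite /b; lra.
  pose a := nrm h ^+ 2.
  have a0 : 0 <= a by rewrite sqr_ge0.
  pose t := - b / (a + 1).
  have ta : t * (a + 1) = - b by rewrite divfK // gt_eqF //; lra.
  have := step (t%:C *: h).
  rewrite nrmZ exprMn mod_real real_normK ?num_real // phiZ hdotZr.
  rewrite !cReM cReJ cImJ /= oppr0 !mul0r !subr0 -mulrBr -/b -/a => hb.
  have b2 : t ^+ 2 * (a + 2) <= 0.
    move: hb ta; move: (t) (b) => s c hs hc.
    have {}hc : c = - (s * (a + 1)) by lra.
    by move: hs; rewrite hc; lra.
  have : t = 0.
    apply/eqP; rewrite -sqrf_eq0; apply/eqP.
    have := sqr_ge0 t; nra.
  by move=> t0; move: ta; rewrite t0 mul0r => /eqP; rewrite eq_sym oppr_eq0 => /eqP.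
exists l => x; apply: eqcP; first by rewrite Re_hdotC rstep.
have := rstep ('i%C *: x); rewrite hdotZr phiZ !cReM cReJ cImJ /= => h.
by rewrite hdotC cImJ; lra.
Qed.

(** Riesz for each fixed x; the representing vector depends linearly and boundedly
    on x because the form does. *)
Lemma form_bop (b : H -> H -> R[i]) (M : R) :
  (forall a x x' y, b (a *: x + x') y = a * b x y + b x' y) ->
  (forall a x y y', b x (a *: y + y') = Num.conj a * b x y + b x y') ->
  (forall x y, mod (b x y) <= M * (nrm x * nrm y)) ->
  exists B, forall x y, '[B x, y] = b x y.
Proof.
move=> bl br bM.
have /choice[f fb] : forall x, exists v, forall y, '[v, y] = b x y.
  move=> x; have [||v hv] := @riesz (fun y => Num.conj (b x y)) (M * nrm x).
  - by move=> a y y'; rewrite br rmorphD rmorphM /= conjCK.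
  - by move=> y; rewrite modJ -mulrA.
  by exists v => y; rewrite hdotC -hv conjCK.
have [||B hB] := @bounded_bop f M.
- move=> a x y; apply: hdot_inj => z.
  by rewrite hdotDl hdotZl !fb bl.
- move=> x; have := bM x (f x); rewrite -fb hdotxx mod_real ger0_norm ?sqr_ge0 //.
  rewrite mulrA expr2; have [->|fx0] := eqVneq (f x) 0.
    rewrite nrm0 => _; have := le_trans (mod_ge0 _) (bM x x).
    rewrite mulrA; have [->|x0] := eqVneq x 0; first by rewrite nrm0 !mulr0.
    by rewrite pmulr_lge0 // nrm_gt0.
  by rewrite ler_pM2r // nrm_gt0.
by exists B => x y; rewrite hB fb.
Qed.

(** The adjoint is defined by choice, so its defining property requires existence. *)
Lemma adjointE A x y : '[A x, y] = '[x, adjoint A y].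
Proof.
move: x y; suff h : [set B : bop H | forall x y, '[A x, y] = '[x, B y]] !=set0.
  exact: (xgetPex 0 h).
have [M M0 hM] := bop_bounded A.
have [|||B hB] := @form_bop (fun x y => '[x, A y]) M.
- by move=> a x x' y; rewrite hdotDl hdotZl.
- by move=> a x y y'; rewrite bopD bopZ hdotDr hdotZr.
- move=> x y; apply: le_trans (hdot_le _ _) _.
  by rewrite mulrCA ler_wpM2l ?nrm_ge0.
by exists B => x y; rewrite hdotC [in RHS]hdotC hB.
Qed.

Lemma adjointEr A x y : '[x, A y] = '[adjoint A x, y].
Proof. by rewrite hdotC adjointE -hdotC. Qed.

Lemma adjoint_unique A B : (forall x y, '[A x, y] = '[x, B y]) -> adjoint A = B.
Proof.
move=> h; apply: bopP => y; apply: hdot_inj => x.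
by rewrite hdotC -adjointE h -hdotC.
Qed.

Lemma adjointM A B : adjoint (A * B) = adjoint B * adjoint A.
Proof. by apply: adjoint_unique => x y; rewrite !bopE !adjointE. Qed.

Lemma adjointD A B : adjoint (A + B) = adjoint A + adjoint B.
Proof.
by apply: adjoint_unique => x y; rewrite !bopE hdotDl hdotDr !adjointE.
Qed.

Lemma adjointZ a A : adjoint (a *: A) = Num.conj a *: adjoint A.
Proof.
by apply: adjoint_unique => x y; rewrite !bopE hdotZl hdotZr adjointE conjCK.
Qed.

Lemma adjoint1 : adjoint (1 : bop H) = 1.
Proof. exact: adjoint_unique. Qed.

Lemma adjoint0 : adjoint (0 : bop H) = 0.
Proof. by apply: adjoint_unique => x y; rewrite hdot0l hdot0r. Qed.

Lemma adjoint_is_inverse A B : is_inverse A B -> is_inverse (adjoint A) (adjoint B).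
Proof. by move=> [ab ba]; split; rewrite -adjointM ?ab ?ba adjoint1. Qed.

Lemma polarization A x y :
  4 * '[A x, y] = '[A (x + y), x + y] - '[A (x - y), x - y]
    + 'i%C * ('[A (x + 'i%C *: y), x + 'i%C *: y] - '[A (x - 'i%C *: y), x - 'i%C *: y]).
Proof.
have conji : Num.conj ('i%C : R[i]) = - 'i%C by apply: eqcP => /=; rewrite ?oppr0.
have i2 : 'i%C * 'i%C = -1 :> R[i] by rewrite -expr2 sqr_i.
rewrite !(bopD, bopN, bopZ) !(hdotDl, hdotDr, hdotNl, hdotNr, hdotZl, hdotZr) conji.
set a := '[A x, y]; set b := '[A y, x].
move: i2; move: ('i%C : R[i]) => i i2.
set c := '[A x, x]; set d := '[A y, y].
transitivity (a + a + b + b + (i * i) * (- (a + a) + b + b)); last by ring.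
by rewrite i2; ring.
Qed.

Lemma bop_eq_diag A B : (forall x, '[A x, x] = '[B x, x]) -> A = B.
Proof.
move=> h; apply: bopP => x; apply: hdot_inj => y.
apply: (mulfI (_ : 4 != 0 :> R[i])); first by rewrite pnatr_eq0.
by rewrite !polarization !h.
Qed.

(** An operator and its adjoint have conjugate diagonals, and the diagonal determines
    the operator. *)
Lemma real_diag_selfadjoint A : (forall x, Im '[A x, x] = 0) -> adjoint A = A.
Proof.
move=> h; apply: bop_eq_diag => x.
by rewrite -adjointEr hdotC; apply: eqcP; rewrite ?cReJ // cImJ h oppr0.
Qed.

Lemma selfadjoint_diag A x : adjoint A = A -> '[A x, x] = (Re '[A x, x])%:C.
Proof.
move=> hA; apply: eqcP => //=; have := congr1 (fun c : R[i] => Im c) (hdotC (A x) x).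
by rewrite cImJ adjointEr hA; lra.
Qed.

Lemma nonneg_op_selfadjoint A : nonneg_op A -> adjoint A = A.
Proof. by move=> h; apply: real_diag_selfadjoint => x; rewrite ger0_Im. Qed.

End Operators.

(** * Coercive operators and square roots *)

Section OperatorLimits.
Context {R : realType} {H : hilbertType R}.
Implicit Types (A B : bop H) (x y z : H).

(** The pointwise limit exists by completeness of H; the geometric tail estimate
    passes to the limit, and makes it bounded. *)
Lemma bop_geometric_limit (B : nat -> bop H) (C q : R) : 0 <= C -> 0 <= q -> q < 1 ->
  (forall k x, nrm ((B k.+1 - B k) x) <= C * q ^+ k * nrm x) ->
  exists L, forall k x, nrm ((L - B k) x) <= C / (1 - q) * q ^+ k * nrm x.
Proof.
move=> C0 q0 q1 hB.
have [D DE] : exists D, D = C / (1 - q) by exists (C / (1 - q)).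
have q10 : 1 - q != 0 by rewrite subr_eq0 gt_eqF.
have D0 : 0 <= D by rewrite DE divr_ge0 // subr_ge0 ltW.
have CD : C = D * (1 - q) by rewrite DE divfK.
have tail n m x : nrm (B (n + m)%N x - B n x) <= D * q ^+ n * (1 - q ^+ m) * nrm x.
  elim: m => [|m IH]; first by rewrite addn0 subrr nrm0 expr0 subrr mulr0 mul0r.
  rewrite addnS; apply: le_trans (nrm_subD _ (B (n + m)%N x) _) _.
  apply: le_trans (lerD (hB _ _) IH) _.
  by rewrite CD exprD exprS -mulrDl ler_wpM2r ?nrm_ge0 // le_eqVlt; apply/orP; left; apply/eqP; ring.
have tail' n m x : (n <= m)%N -> nrm (B m x - B n x) <= D * q ^+ n * nrm x.
  move=> nm; rewrite -(subnKC nm); apply: le_trans (tail _ _ _) _.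
  rewrite ler_wpM2r ?nrm_ge0 // ler_piMr ?mulr_ge0 ?exprn_ge0 //.
  by rewrite lerBlDr lerDl exprn_ge0.
have /choice[f hf] : forall x, exists l, forall e : R, 0 < e ->
    exists N, forall n, (N <= n)%N -> nrm (B n x - l) < e.
  move=> x; apply: nrm_complete => e e0.
  have [N hN] := @geometric_small _ (D * nrm x) q _ q0 q1 e0.
  exists N => m n Nm Nn; wlog mn : m n Nm Nn / (n <= m)%N.
    by move=> hw; have [/hw|/ltnW/hw] := leqP n m; [exact|rewrite nrmB; exact].
  by apply: le_lt_trans (tail' _ _ _ mn) _; rewrite mulrAC hN.
have lim_le n x : nrm (f x - B n x) <= D * q ^+ n * nrm x.
  apply/ler_addgt0Pr => e e0; have [N hN] := hf x e e0.
  have := hN (maxn N n) (leq_maxl _ _); have := tail' n (maxn N n) x (leq_maxr _ _).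
  have := nrm_subD (f x) (B (maxn N n) x) (B n x); rewrite (nrmB (f x) (B (maxn N n) x)).
  lra.
have [M M0 hM] := bop_bounded (B 0).
have [||L hL] := @bounded_bop _ _ f (D + M).
- move=> a x y; apply: (@nrm_lim_unique _ _ (fun n => B n (a *: x + y))).
    exact: hf.
  move=> e e0; have m0 := mod_ge0 a.
  have e10 : 0 < e / 2 / (mod a + 1) by rewrite !divr_gt0 //; lra.
  have e20 : 0 < e / 2 by rewrite divr_gt0.
  have [N hN] := hf x _ e10; have [N' hN'] := hf y _ e20.
  exists (maxn N N') => n; rewrite geq_max => /andP[/hN + /hN'].
  rewrite bopD bopZ ltr_pdivlMr; last by lra.
  move=> h1 h2.
  have -> : a *: B n x + B n y - (a *: f x + f y) = a *: (B n x - f x) + (B n y - f y).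
    by rewrite scalerBr opprD addrACA.
  apply: le_lt_trans (nrmD _ _) _; rewrite nrmZ.
  have := nrm_ge0 (B n x - f x); move: h1 h2; nra.
- move=> x; have := lim_le 0%N x; rewrite expr0 mulr1.
  have := nrmD (f x - B 0%N x) (B 0%N x); rewrite subrK; have := hM x.
  lra.
by exists L => k x; rewrite bop_subE hL -DE.
Qed.

(** With X = 1 - A, the partial sums of the Neumann series multiply A, on either
    side, to 1 - X^k. *)
Lemma neumann A (q : R) : 0 <= q -> q < 1 ->
  (forall x, nrm ((1 - A) x) <= q * nrm x) -> invertible A.
Proof.
move=> q0 q1 hA; pose X : bop H := 1 - A.
have XA : A = 1 - X by rewrite /X opprB addrC subrK.
have hX k x : nrm ((X ^+ k) x) <= q ^+ k * nrm x.
  elim: k x => [|k IH] x; first by rewrite !expr0 mul1r.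
  rewrite !exprS bop_mulE -mulrA; apply: le_trans (hA _) _.
  by rewrite ler_wpM2l.
pose S k : bop H := \sum_(i < k) X ^+ i.
have SX k : S k * A = 1 - X ^+ k /\ A * S k = 1 - X ^+ k.
  rewrite XA; elim: k => [|k [IH1 IH2]].
    by rewrite /S big_ord0 mul0r mulr0 expr0 subrr.
  rewrite /S big_ord_recr /= -/(S k) [_ * (_ + X ^+ k)]mulrDr [(_ + X ^+ k) * _]mulrDl.
  rewrite IH1 IH2 mulrBr mulrBl mulr1 mul1r -exprS -exprSr.
  by split; rewrite addrA subrK.
have [|L hL] := @bop_geometric_limit S 1 q ler01 q0 q1.
  by move=> k x; rewrite /S big_ord_recr /= addrC addKr mul1r.
have [M M0 hM] := bop_bounded A.
have small (y : H) (K : R) : (forall k, nrm y <= K * q ^+ k) -> y = 0.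
  move=> h; apply/eqP; rewrite -nrm_eq0 eq_le nrm_ge0 andbT.
  apply/ler_addgt0Pr => e e0; rewrite add0r.
  have [N hN] := geometric_small K q0 q1 e0.
  exact: le_trans (h N) (ltW (hN N (leqnn N))).
exists L; split; apply: bopP => x; apply/eqP; rewrite -subr_eq0; apply/eqP.
  apply: (small _ ((M / (1 - q) + 1) * nrm x)) => k.
  have -> : (A * L) x - (1 : bop H) x = A ((L - S k) x) - (X ^+ k) x.
    have e2 : A (S k x) = x - (X ^+ k) x by rewrite -[LHS]/((A * S k) x) (SX k).2.
    by rewrite !bop_mulE bop_oneE bop_subE bopB e2 opprB addrA addrAC addrK.
  apply: le_trans (nrmD _ _) _; rewrite nrmN.
  have := hL k x; have := hX k x; have := hM ((L - S k) x).
  rewrite div1r => h1 h2 h3.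
  have : M * nrm ((L - S k) x) <= M * ((1 - q)^-1 * q ^+ k * nrm x) by rewrite ler_pM2l.
  lra.
apply: (small _ ((M / (1 - q) + 1) * nrm x)) => k.
have -> : (L * A) x - (1 : bop H) x = (L - S k) (A x) - (X ^+ k) x.
  have e2 : S k (A x) = x - (X ^+ k) x by rewrite -[LHS]/((S k * A) x) (SX k).1.
  by rewrite !bop_mulE bop_oneE bop_subE e2 opprB addrA addrAC addrK.
apply: le_trans (nrmD _ _) _; rewrite nrmN.
have := hL k (A x); have := hX k x; have := hM x.
rewrite div1r => h1 h2 h3.
have qk : 0 <= (1 - q)^-1 * q ^+ k.
  by rewrite mulr_ge0 ?invr_ge0 ?exprn_ge0 // subr_ge0 ltW.
have : (1 - q)^-1 * q ^+ k * nrm (A x) <= (1 - q)^-1 * q ^+ k * (M * nrm x) by rewrite ler_wpM2l.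
lra.
Qed.

(** A coercive operator, once rescaled, differs from the identity by a strict
    contraction: |x - tAx|^2 <= (1 - 2tc + t^2 M^2) |x|^2. *)
Lemma coercive_contraction A (c : R) : 0 < c ->
  (forall x, c * nrm x ^+ 2 <= Re '[A x, x]) ->
  exists t q : R, [/\ 0 < t, 0 <= q, q < 1 &
    forall x, nrm ((1 - t%:C *: A) x) <= q * nrm x].
Proof.
move=> c0 hc; have [M0 M00 hM0] := bop_bounded A.
pose M := M0 + c.
have Mp : 0 < M by rewrite addr_gt0.
have hM x : nrm (A x) <= M * nrm x.
  by apply: le_trans (hM0 x) _; rewrite ler_wpM2r ?nrm_ge0 // lerDl ltW.
have r0 : 0 <= (c / M) ^+ 2 by rewrite sqr_ge0.
have r1 : (c / M) ^+ 2 <= 1.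
  by rewrite expr_le1 // ?ler_pdivrMr ?mul1r ?lerDr ?divr_ge0 // ltW.
exists (c / M ^+ 2), (Num.sqrt (1 - (c / M) ^+ 2)); split.
- by rewrite divr_gt0 // exprn_gt0.
- exact: sqrtr_ge0.
- rewrite -[ltRHS]sqrtr1 ltr_sqrt ?ltr01 // ltrBlDr ltrDl exprn_gt0 //.
  by rewrite divr_gt0.
move=> x; rewrite -(ler_pXn2r (n := 2)) ?nnegrE ?mulr_ge0 ?nrm_ge0 ?sqrtr_ge0 //.
rewrite exprMn sqr_sqrtr ?subr_ge0 // bop_subE !bopE nrm_sqrB.
rewrite nrmZ mod_real ger0_norm ?divr_ge0 ?sqr_ge0 ?(ltW c0) // hdotZr cReM cReJ cImJ /=.
rewrite oppr0 mul0r subr0 Re_hdotC.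
have h1 : nrm (A x) ^+ 2 <= M ^+ 2 * nrm x ^+ 2.
  by rewrite -exprMn ler_pXn2r // ?nnegrE ?mulr_ge0 ?nrm_ge0 // ltW.
have h2 := hc x.
pose t := c / M ^+ 2.
have t0 : 0 < t by rewrite divr_gt0 // exprn_gt0.
have tM : t * M ^+ 2 = c by rewrite divfK // gt_eqF // exprn_gt0.
have -> : (c / M) ^+ 2 = t * c by rewrite /t exprMn exprVn; ring.
rewrite -/t exprMn.
have h3 : t ^+ 2 * nrm (A x) ^+ 2 <= t * c * nrm x ^+ 2.
  apply: le_trans (_ : t ^+ 2 * (M ^+ 2 * nrm x ^+ 2) <= _).
    by rewrite ler_wpM2l ?sqr_ge0.
  by rewrite mulrA -tM [t ^+ 2]expr2 -!mulrA.
have h4 : t * (c * nrm x ^+ 2) <= t * Re '[A x, x] by rewrite ler_pM2l.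
lra.
Qed.

Lemma invertible_scale (a : R[i]) A : a != 0 -> invertible (a *: A) -> invertible A.
Proof.
move=> a0 [B [h1 h2]]; exists (a *: B).
by split; [rewrite bop_scaleAr -bop_scaleAl|rewrite bop_scaleAl -bop_scaleAr].
Qed.

(** Lax-Milgram: some positive multiple of A is within distance less than 1 of the
    identity. *)
Lemma coercive_invertible A (c : R) : 0 < c ->
  (forall x, c * nrm x ^+ 2 <= Re '[A x, x]) -> invertible A.
Proof.
move=> c0 hc; have [t [q [t0 q0 q1 h]]] := coercive_contraction c0 hc.
apply: (@invertible_scale t%:C); first by rewrite (inj_eq (@complexI R)) gt_eqF.
exact: neumann q0 q1 h.
Qed.

(** The square root of 1 - X, for a strict contraction X, is 1 - Y where Y is
    the fixed point of Y |-> (X + Y^2)/2; a coercive self-adjoint operator is a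
    positive multiple of such a 1 - X. *)
Lemma coercive_sqrt_exists A (c : R) : 0 < c -> adjoint A = A ->
  (forall x, c * nrm x ^+ 2 <= Re '[A x, x]) ->
  exists B, posdef_op B /\ B * B = A.
Proof.
move=> c0 sA hc; have [t [q [t0 q0 q1 hX]]] := coercive_contraction c0 hc.
have [X XE] : exists X : bop H, X = 1 - t%:C *: A by exists (1 - t%:C *: A).
rewrite -XE in hX.
have sX : adjoint X = X.
  rewrite XE -[in LHS]scaleN1r adjointD adjoint1 !adjointZ sA.
  by rewrite -[in RHS]scaleN1r; congr (_ + (_ *: (_ *: _))); apply: eqcP => /=; rewrite ?oppr0.
pose half : R[i] := (2^-1)%:C.
have half2 : half + half = 1 by rewrite /half -rmorphD /= -[2^-1]mul1r -splitr.
pose F (Y : bop H) : bop H := half *: (X + Y * Y).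
have [Y [Y0 YS]] : exists Y : nat -> bop H, Y 0%N = 0 /\ forall k, Y k.+1 = F (Y k).
  by exists (fun k => iter k F 0).
have FE Z x : F Z x = half *: (X x + Z (Z x)) by [].
have mod_half : mod half = 2^-1 by rewrite mod_real ger0_norm ?invr_ge0.
have hY k x : nrm (Y k x) <= q * nrm x.
  elim: k x => [|k IH] x; first by rewrite Y0 nrm0 mulr_ge0 ?nrm_ge0.
  rewrite YS FE nrmZ mod_half.
  have h1 := nrmD (X x) (Y k (Y k x)); have h2 := hX x.
  have h3 := IH (Y k x); have h4 := IH x.
  have h5 : q * nrm (Y k x) <= q * (q * nrm x) by rewrite ler_wpM2l.
  have h6 : q * (q * nrm x) <= 1 * (q * nrm x).
    by rewrite ler_wpM2r ?mulr_ge0 ?nrm_ge0 // ltW.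
  by rewrite ler_pdivrMl //; lra.
have dY k x : nrm ((Y k.+1 - Y k) x) <= 1 * q ^+ k * nrm x.
  rewrite mul1r; elim: k x => [|k IH] x.
    by rewrite expr0 mul1r Y0 subr0; apply: le_trans (hY 1%N x) _; rewrite ler_piMl ?nrm_ge0 // ltW.
  have -> : (Y k.+2 - Y k.+1) x =
      half *: (Y k.+1 ((Y k.+1 - Y k) x) + (Y k.+1 - Y k) (Y k x)).
    have e1 : Y k.+2 x = half *: (X x + Y k.+1 (Y k.+1 x)) by rewrite YS.
    have e2 : Y k.+1 x = half *: (X x + Y k (Y k x)) by rewrite YS.
    rewrite bop_subE e1 [X in _ - X]e2 -scalerBr !bop_subE bopB; congr (_ *: _).
    by rewrite addrA subrK opprD addrA [X x + _]addrC addrK.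
  rewrite nrmZ mod_half ler_pdivrMl // exprS.
  apply: le_trans (nrmD _ _) _.
  have h1 := hY k.+1 ((Y k.+1 - Y k) x); have h2 := IH x.
  have h3 := IH (Y k x); have h4 := hY k x.
  have qk : 0 <= q ^+ k by rewrite exprn_ge0.
  have h5 : q ^+ k * nrm (Y k x) <= q ^+ k * (q * nrm x) by rewrite ler_wpM2l.
  have h6 : q * nrm ((Y k.+1 - Y k) x) <= q * (q ^+ k * nrm x) by rewrite ler_wpM2l.
  lra.
have [L hL] := bop_geometric_limit ler01 q0 q1 dY.
have K0 : 0 <= (1 - q)^-1 by rewrite invr_ge0 subr_ge0 ltW.
have limL x e : 0 < e -> exists N, forall n, (N <= n)%N -> nrm (Y n x - L x) < e.
  move=> e0; have [N hN] := @geometric_small _ ((1 - q)^-1 * nrm x) q e q0 q1 e0.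
  exists N => n /hN; rewrite mulrAC => h; rewrite nrmB; apply: le_lt_trans h.
  by have := hL n x; rewrite div1r.
have nL x : nrm (L x) <= q * nrm x.
  apply/ler_addgt0Pr => e /(limL x)[N /(_ N (leqnn N)) h].
  by have := nrmD (L x - Y N x) (Y N x); rewrite subrK nrmB; have := hY N x; lra.
have fixL : L = F L.
  apply: bopP => x; apply: (@nrm_lim_unique _ _ (fun n => Y n.+1 x)).
    by move=> e /(limL x)[N hN]; exists N => n Nn; apply: hN; apply: leqW.
  move=> e e0; have e20 : 0 < e by [].
  have [N hN] := limL x e e0; have [N' hN'] := limL (L x) e e0.
  exists (maxn N N') => n; rewrite geq_max => /andP[/hN h1 /hN' h2].
  have -> : Y n.+1 x - F L x = half *: (Y n (Y n x - L x) + (Y n (L x) - L (L x))).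
    rewrite YS !FE -scalerBr bopB; congr (_ *: _).
    by rewrite addrA subrK opprD addrA [X x + _]addrC addrK.
  rewrite nrmZ mod_half mulrC ltr_pdivrMr //.
  apply: le_lt_trans (nrmD _ _) _.
  have := hY n (Y n x - L x); have : q * nrm (Y n x - L x) <= 1 * nrm (Y n x - L x).
    by rewrite ler_wpM2r ?nrm_ge0 // ltW.
  lra.
have sY k : adjoint (Y k) = Y k.
  elim: k => [|k IH]; first by rewrite Y0 adjoint0.
  rewrite YS /F adjointZ adjointD adjointM IH sX; congr (_ *: _).
  by apply: eqcP => /=; rewrite ?oppr0.
have sL : adjoint L = L.
  apply: adjoint_unique => x y; apply/eqP; rewrite -subr_eq0; apply/eqP/mod_eq0/eqP.
  rewrite eq_le mod_ge0 andbT; apply/ler_addgt0Pr => e e0; rewrite add0r.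
  pose s := nrm x + nrm y + 1.
  have s0 : 0 < s by rewrite ltr_wpDl ?addr_ge0 ?nrm_ge0.
  have es : 0 < e / s by rewrite divr_gt0.
  have [N hN] := limL x _ es; have [N' hN'] := limL y _ es.
  pose n := maxn N N'.
  have := hN n (leq_maxl _ _); have := hN' n (leq_maxr _ _).
  rewrite !ltr_pdivlMr // /s => h1 h2.
  have -> : '[L x, y] - '[x, L y] = '[x, Y n y - L y] - '[Y n x - L x, y].
    by rewrite hdotBl hdotBr (adjointEr (Y n)) sY; ring.
  apply: le_trans (modD _ _) _; rewrite modN.
  have := hdot_le x (Y n y - L y); have := hdot_le (Y n x - L x) y.
  have := nrm_ge0 (Y n y - L y); have := nrm_ge0 (Y n x - L x).
  have := nrm_ge0 x; have := nrm_ge0 y; nra.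
pose s : R := Num.sqrt t.
have s0 : 0 < s by rewrite sqrtr_gt0.
have ss : s * s = t by rewrite -expr2 sqr_sqrtr // ltW.
pose B0 : bop H := 1 - L.
have B02 : B0 * B0 = t%:C *: A.
  have -> : t%:C *: A = 1 - X by rewrite XE opprB addrC subrK.
  rewrite /B0 mulrBl mul1r mulrBr mulr1.
  have -> : X = L + L - L * L.
    by rewrite {1 2}fixL /F -scalerDl half2 scale1r addrK.
  by rewrite !opprB opprD !addrA; congr (_ - _); rewrite addrAC.
have sB0 : adjoint B0 = B0.
  rewrite /B0 -scaleN1r adjointD adjoint1 adjointZ sL; congr (_ + _ *: _).
  by apply: eqcP => /=; rewrite ?oppr0.
have cB0 x : (1 - q) * nrm x ^+ 2 <= Re '[B0 x, x].
  rewrite bop_subE hdotBl cReB Re_hdotxx.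
  have := Re_hdot_le (L x) x.
  have : nrm (L x) * nrm x <= q * nrm x * nrm x by rewrite ler_wpM2r ?nrm_ge0.
  lra.
have q10 : 0 < 1 - q by rewrite subr_gt0.
have [C hC] := coercive_invertible q10 cB0.
exists (s^-1%:C *: B0); split; last first.
  rewrite bop_scaleAl bop_scaleAr B02 !scalerA -!rmorphM /= -ss.
  suff -> : s^-1 * s^-1 * (s * s) = 1 by rewrite scale1r.
  by rewrite mulrACA mulVf ?gt_eqF // mulr1.
split; last first.
  exists (s%:C *: C); case: hC => h1 h2.
  rewrite /is_inverse !bop_scaleAl !bop_scaleAr !scalerA -!rmorphM /=.
  by rewrite h1 h2 mulVf ?mulfV ?gt_eqF // scale1r.
move=> x x0; rewrite bop_scaleE hdotZl selfadjoint_diag // -rmorphM ltcR /=.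
rewrite mulr_gt0 ?invr_gt0 //; apply: lt_le_trans (cB0 x).
by rewrite mulr_gt0 // exprn_gt0 // nrm_gt0.
Qed.

Lemma sqrt_opP A (c : R) : 0 < c -> adjoint A = A ->
  (forall x, c * nrm x ^+ 2 <= Re '[A x, x]) ->
  posdef_op (sqrt_op A) /\ sqrt_op A * sqrt_op A = A.
Proof.
move=> c0 sA hA; have [B hB] := coercive_sqrt_exists c0 sA hA.
exact: (xgetPex 0 (ex_intro [set B : bop H | posdef_op B /\ B * B = A] B hB)).
Qed.

End OperatorLimits.

(** * Operator matrices *)

Section OperatorMatrices.
Context {R : realType} {H : hilbertType R}.
Local Notation L := (bop H).

(** [opmx_app] for rectangular matrices. *)
Definition mxapp m n (T : 'M[L]_(m, n)) (x : 'cV[H]_n) : 'cV[H]_m :=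
  \col_j \sum_(k < n) (T j k) (x k 0).

Definition vscale n (a : R[i]) (x : 'cV[H]_n) : 'cV[H]_n := \col_j (a *: x j 0).

Definition cnrm2 n (x : 'cV[H]_n) : R := \sum_j nrm (x j 0) ^+ 2.

Lemma mxappE m n (T : 'M[L]_(m, n)) x i : mxapp T x i 0 = \sum_k (T i k) (x k 0).
Proof. by rewrite mxE. Qed.

Lemma mxappM m n p (A : 'M[L]_(m, n)) (B : 'M[L]_(n, p)) x :
  mxapp (A *m B) x = mxapp A (mxapp B x).
Proof.
apply/colP => i; rewrite !mxappE.
under eq_bigr do rewrite mxE bop_suml.
rewrite exchange_big /=; apply: eq_bigr => k _.
by rewrite mxappE bop_sumr.
Qed.

Lemma mxappDl m n (A B : 'M[L]_(m, n)) x : mxapp (A + B) x = mxapp A x + mxapp B x.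
Proof.
apply/colP => i; rewrite [RHS]mxE !mxappE -big_split /=.
by apply: eq_bigr => k _; rewrite mxE.
Qed.

Lemma mxappNl m n (A : 'M[L]_(m, n)) x : mxapp (- A) x = - mxapp A x.
Proof.
apply/colP => i; rewrite [RHS]mxE !mxappE -sumrN.
by apply: eq_bigr => k _; rewrite mxE.
Qed.

Lemma mxappBl m n (A B : 'M[L]_(m, n)) x : mxapp (A - B) x = mxapp A x - mxapp B x.
Proof. by rewrite mxappDl mxappNl. Qed.

Lemma mxappDr m n (A : 'M[L]_(m, n)) x y : mxapp A (x + y) = mxapp A x + mxapp A y.
Proof.
apply/colP => i; rewrite [RHS]mxE !mxappE -big_split /=.
by apply: eq_bigr => k _; rewrite mxE bopD.
Qed.

Lemma mxappZr m n (A : 'M[L]_(m, n)) a x : mxapp A (vscale a x) = vscale a (mxapp A x).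
Proof.
apply/colP => i; rewrite [RHS]mxE !mxappE scaler_sumr.
by apply: eq_bigr => k _; rewrite mxE bopZ.
Qed.

Lemma mxapp0r m n (A : 'M[L]_(m, n)) : mxapp A 0 = 0.
Proof. by apply: (addrI (mxapp A 0)); rewrite -mxappDr !addr0. Qed.

Lemma mxappNr m n (A : 'M[L]_(m, n)) x : mxapp A (- x) = - mxapp A x.
Proof. by apply: (addrI (mxapp A x)); rewrite -mxappDr !subrr mxapp0r. Qed.

Lemma mxappBr m n (A : 'M[L]_(m, n)) x y : mxapp A (x - y) = mxapp A x - mxapp A y.
Proof. by rewrite mxappDr mxappNr. Qed.

Lemma mxapp1 n x : mxapp (1%:M : 'M[L]_n) x = x.
Proof.
apply/colP => i; rewrite mxappE (bigD1 i) //= mxE eqxx big1 ?addr0 // => k ki.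
by rewrite mxE eq_sym (negbTE ki).
Qed.

Lemma adjoint_mxE m n (A : 'M[L]_(m, n)) i j : adjoint_mx A i j = adjoint (A j i).
Proof. by rewrite !mxE. Qed.

Lemma cvdotDl n (x y z : 'cV[H]_n) : cvdot (x + y) z = cvdot x z + cvdot y z.
Proof. by rewrite /cvdot -big_split /=; apply: eq_bigr => i _; rewrite mxE hdotDl. Qed.

Lemma cvdotDr n (x y z : 'cV[H]_n) : cvdot z (x + y) = cvdot z x + cvdot z y.
Proof. by rewrite /cvdot -big_split /=; apply: eq_bigr => i _; rewrite mxE hdotDr. Qed.

Lemma cvdotZl n a (x z : 'cV[H]_n) : cvdot (vscale a x) z = a * cvdot x z.
Proof. by rewrite /cvdot mulr_sumr; apply: eq_bigr => i _; rewrite mxE hdotZl. Qed.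

Lemma cvdotZr n a (x z : 'cV[H]_n) : cvdot z (vscale a x) = Num.conj a * cvdot z x.
Proof. by rewrite /cvdot mulr_sumr; apply: eq_bigr => i _; rewrite mxE hdotZr. Qed.

Lemma cvdotNl n (x z : 'cV[H]_n) : cvdot (- x) z = - cvdot x z.
Proof. by rewrite /cvdot -sumrN; apply: eq_bigr => i _; rewrite mxE hdotNl. Qed.

Lemma cvdotNr n (x z : 'cV[H]_n) : cvdot z (- x) = - cvdot z x.
Proof. by rewrite /cvdot -sumrN; apply: eq_bigr => i _; rewrite mxE hdotNr. Qed.

Lemma cvdotC n (x y : 'cV[H]_n) : cvdot x y = Num.conj (cvdot y x).
Proof. by rewrite /cvdot rmorph_sum; apply: eq_bigr => i _; exact: hdotC. Qed.

Lemma Re_cvdotC n (x y : 'cV[H]_n) : Re (cvdot x y) = Re (cvdot y x).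
Proof. by rewrite cvdotC cReJ. Qed.

Lemma cvdotxx n (x : 'cV[H]_n) : cvdot x x = (cnrm2 x)%:C.
Proof.
rewrite /cvdot /cnrm2 rmorph_sum; apply: eq_bigr => i _; exact: hdotxx.
Qed.

Lemma cvdot_adjoint m n (A : 'M[L]_(m, n)) x y :
  cvdot (mxapp A x) y = cvdot x (mxapp (adjoint_mx A) y).
Proof.
rewrite /cvdot; under eq_bigr do rewrite mxappE hdot_suml.
rewrite exchange_big /=; apply: eq_bigr => i _.
rewrite mxappE hdot_sumr; apply: eq_bigr => j _.
by rewrite adjoint_mxE adjointE.
Qed.

Lemma cnrm2_ge0 n (x : 'cV[H]_n) : 0 <= cnrm2 x.
Proof. by apply: sumr_ge0 => i _; rewrite sqr_ge0. Qed.

Lemma cnrm2_coord n (x : 'cV[H]_n) i : nrm (x i 0) ^+ 2 <= cnrm2 x.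
Proof. by rewrite /cnrm2 (bigD1 i) //= lerDl sumr_ge0 // => j _; rewrite sqr_ge0. Qed.

Lemma cnrm2_eq0 n (x : 'cV[H]_n) : cnrm2 x = 0 -> x = 0.
Proof.
move=> h; apply/colP => i; rewrite mxE; apply/eqP; rewrite -nrm_eq0 -sqrf_eq0.
by rewrite eq_le sqr_ge0 andbT -h cnrm2_coord.
Qed.

Lemma cnrm2_gt0 n (x : 'cV[H]_n) : x != 0 -> 0 < cnrm2 x.
Proof.
move=> x0; rewrite lt_neqAle cnrm2_ge0 andbT eq_sym.
by apply: contra x0 => /eqP/cnrm2_eq0 ->.
Qed.

Lemma cnrm2Z n (a : R[i]) (x : 'cV[H]_n) : cnrm2 (vscale a x) = mod a ^+ 2 * cnrm2 x.
Proof. by rewrite /cnrm2 mulr_sumr; apply: eq_bigr => i _; rewrite mxE nrmZ exprMn. Qed.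

Lemma cnrm2B n (x y : 'cV[H]_n) :
  cnrm2 (x - y) = cnrm2 x + cnrm2 y - 2 * Re (cvdot x y).
Proof.
rewrite /cnrm2 /cvdot Re_sum -big_split mulr_sumr -sumrB /=.
by apply: eq_bigr => i _; rewrite !mxE nrm_sqrB.
Qed.

(** Cauchy-Schwarz in additive form, which avoids square roots of [cnrm2]. *)
Lemma cvdot_amgm n (s : R) (x y : 'cV[H]_n) : 0 < s ->
  2 * mod (cvdot x y) <= s * cnrm2 x + s^-1 * cnrm2 y.
Proof.
move=> s0; have [u u1 <-] := mod_phase (cvdot x y).
have := cnrm2_ge0 (vscale (s%:C * u) x - y); rewrite cnrm2B cnrm2Z modM u1 mulr1.
rewrite mod_real ger0_norm ?(ltW s0) // cvdotZl -mulrA cReZ.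
have : s * s^-1 = 1 by rewrite mulfV // gt_eqF.
move: (Re _) (cnrm2 x) (cnrm2 y) (s^-1) => a b c t st h.
have t0 : 0 < t by rewrite -(pmulr_rgt0 _ s0) st.
have := mulr_ge0 (ltW t0) h.
have -> : t * (s ^+ 2 * b + c - 2 * (s * a)) =
  (s * t) * s * b + t * c - 2 * ((s * t) * a) by ring.
by rewrite st; lra.
Qed.

Lemma mxapp_bounded m n (A : 'M[L]_(m, n)) :
  exists2 M : R, 0 < M & forall x, cnrm2 (mxapp A x) <= M * cnrm2 x.
Proof.
suff /choice[M hM] : forall i, exists M : R, 0 <= M /\
    forall x, nrm (mxapp A x i 0) ^+ 2 <= M * cnrm2 x.
  exists (\sum_i M i + 1).
    by apply: ltr_wpDl => //; apply: sumr_ge0 => i _; exact: (hM i).1.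
  move=> x; apply: le_trans (_ : (\sum_i M i) * cnrm2 x <= _); last first.
    by rewrite ler_wpM2r ?cnrm2_ge0 // lerDl.
  by rewrite mulr_suml; apply: ler_sum => i _; exact: (hM i).2.
move=> i; have /choice[B hB] : forall k, exists M : R, 0 < M /\
    forall x, nrm (A i k x) <= M * nrm x.
  by move=> k; have [M] := bop_bounded (A i k); exists M.
pose S := \sum_k B k; exists (S ^+ 2); split; first exact: sqr_ge0.
move=> x; rewrite mxappE -[cnrm2 x]sqr_sqrtr ?cnrm2_ge0 // -exprMn.
have S0 : 0 <= S by apply: sumr_ge0 => k _; apply/ltW; exact: (hB k).1.
rewrite ler_pXn2r ?nnegrE ?nrm_ge0 ?mulr_ge0 ?sqrtr_ge0 //.
apply: le_trans (nrm_sum _ _ _) _; rewrite mulr_suml; apply: ler_sum => k _.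
apply: le_trans ((hB k).2 _) _; rewrite ler_pM2l; last exact: (hB k).1.
rewrite -[leLHS]ger0_norm ?nrm_ge0 // -sqrtr_sqr ler_sqrt ?cnrm2_ge0 //.
exact: cnrm2_coord.
Qed.

Lemma mxapp_block m1 m2 n1 n2 (a : 'M[L]_(m1, n1)) (b : 'M[L]_(m1, n2))
    (c : 'M[L]_(m2, n1)) (d : 'M[L]_(m2, n2)) x y :
  mxapp (block_mx a b c d) (col_mx x y) =
    col_mx (mxapp a x + mxapp b y) (mxapp c x + mxapp d y).
Proof.
apply/colP => i; rewrite mxappE big_split_ord /=.
case: (splitP i) => j ij.
  have -> : i = lshift m2 j by apply: val_inj.
  rewrite col_mxEu mxE !mxappE; congr (_ + _); apply: eq_bigr => k _.
    by rewrite block_mxEul col_mxEu.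
  by rewrite block_mxEur col_mxEd.
have -> : i = rshift m1 j by apply: val_inj.
rewrite col_mxEd mxE !mxappE; congr (_ + _); apply: eq_bigr => k _.
  by rewrite block_mxEdl col_mxEu.
by rewrite block_mxEdr col_mxEd.
Qed.

Lemma cvdot_col m n (x x' : 'cV[H]_m) (y y' : 'cV[H]_n) :
  cvdot (col_mx x y) (col_mx x' y') = cvdot x x' + cvdot y y'.
Proof.
rewrite /cvdot big_split_ord /=; congr (_ + _); apply: eq_bigr => k _.
  by rewrite !col_mxEu.
by rewrite !col_mxEd.
Qed.

Lemma cnrm2_col m n (x : 'cV[H]_m) (y : 'cV[H]_n) :
  cnrm2 (col_mx x y) = cnrm2 x + cnrm2 y.
Proof. by apply: complexI; rewrite rmorphD /= -!cvdotxx cvdot_col. Qed.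

Lemma invertible_block_diag m n (a : 'M[L]_m) (d : 'M[L]_n) :
  @invertible 'M[L]_m a -> @invertible 'M[L]_n d ->
  @invertible 'M[L]_(m + n) (block_mx a 0 0 d).
Proof.
move=> [a' [a1 a2]] [d' [d1 d2]]; exists (block_mx a' 0 0 d').
rewrite /is_inverse -!mulmxE !mulmx_block !mulmx0 !mul0mx !addr0 !add0r !mulmxE.
by rewrite a1 a2 d1 d2 -scalar_mx_block.
Qed.

(** Block Gauss elimination; the middle factor contains the Schur complement of a. *)
Lemma block_factorization n (a a' : 'M[L]_1) (b : 'M[L]_(1, n)) (d : 'M[L]_(n, 1))
    (e : 'M[L]_n) : is_inverse a a' ->
  block_mx a b d e = block_mx 1%:M 0 (d *m a') 1%:M *m
    block_mx a 0 0 (e - d *m a' *m b) *m block_mx 1%:M (a' *m b) 0 1%:M.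
Proof.
rewrite /is_inverse -!mulmxE -idmxE => -[aa' a'a].
rewrite !mulmx_block !mulmx0 !mul0mx !mul1mx !mulmx1 ?addr0 ?add0r.
by rewrite -!mulmxA a'a mulmx1 !mulmxA -(mulmxA d) a'a mulmx1 aa' mul1mx addrC subrK.
Qed.

Lemma unitriangular_invertible m n (u : 'M[L]_(m, n)) (l : 'M[L]_(n, m)) :
  @invertible 'M[L]_(m + n) (block_mx 1%:M u 0 1%:M) /\
  @invertible 'M[L]_(m + n) (block_mx 1%:M 0 l 1%:M).
Proof.
split; [exists (block_mx 1%:M (- u) 0 1%:M)|exists (block_mx 1%:M 0 (- l) 1%:M)];
  rewrite /is_inverse -!mulmxE -idmxE !mulmx_block !mulmx0 !mul0mx !mul1mx !mulmx1;
  by rewrite ?addr0 ?add0r ?addNr ?subrr -scalar_mx_block.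
Qed.

(** Lax-Milgram for operator matrices, by block elimination: the Schur
    complement of a coercive matrix is coercive. *)
Lemma coercive_mx_invertible n (A : 'M[L]_n) (c : R) : 0 < c ->
  (forall x, c * cnrm2 x <= Re (cvdot (mxapp A x) x)) -> @invertible 'M[L]_n A.
Proof.
move=> c0; elim: n A => [|n IH] A hA.
  by exists A; split; apply/matrixP => -[].
move: hA; rewrite -[A](@submxK _ 1 n 1 n).
move: (ulsubmx _) (ursubmx _) (dlsubmx _) (drsubmx _) => a b d e.
rewrite -[n.+1]/(1 + n)%N => hA.
have [a' aa'] : @invertible 'M[L]_1 a.
  have [|a' [h1 h2]] := @coercive_invertible _ _ (a 0 0) c c0.
    move=> x; have := hA (@col_mx _ 1 n 1 (\col_i x) 0).
    rewrite mxapp_block !mxapp0r !addr0 cvdot_col cnrm2_col.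
    by rewrite /cvdot /cnrm2 !big_ord1 !big1 ?addr0 => [|i _|i _];
      rewrite ?mxappE ?big_ord1 !mxE ?hdot0r ?nrm0 ?expr0n.
  exists (\matrix_(i, j) a'); split; apply/matrixP => i j; rewrite !mxE big_ord1 !mxE;
    by rewrite !ord1 // eqxx.
rewrite (block_factorization b d e aa').
have [S' hS] : @invertible 'M[L]_n (e - d *m a' *m b).
  apply: IH => y; pose x := - mxapp a' (mxapp b y).
  have := hA (col_mx x y); rewrite mxapp_block cvdot_col cnrm2_col.
  have -> : mxapp a x + mxapp b y = 0.
    by rewrite mxappNr -mxappM mulmxE aa'.1 mxapp1 addNr.
  have -> : mxapp d x + mxapp e y = mxapp (e - d *m a' *m b) y.
    by rewrite mxappBl !mxappM mxappNr addrC.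
  have -> : cvdot 0 x = 0.
    by rewrite /cvdot big1 // => i _; rewrite mxE hdot0l.
  rewrite add0r mulrDr => h; apply: le_trans h.
  by rewrite lerDr mulr_ge0 ?cnrm2_ge0 // ltW.
have [[u' hu] [l' hl]] := unitriangular_invertible (a' *m b) (d *m a').
have [D hD] := invertible_block_diag (ex_intro _ a' aa') (ex_intro _ S' hS).
exists (u' * (D * l')); rewrite !mulmxE; apply: is_inverseM => //; exact: is_inverseM.
Qed.

(** The lower bound comes from the inverse Ti: expanding
    0 <= <T (x - s Ti x), x - s Ti x> bounds <T x, x> from below by
    2 s |x|^2 - s^2 <x, Ti x>, and s is chosen small against the norm of Ti. *)
Lemma posdef_opmx_coercive n (T : 'M[L]_n) : adjoint_mx T = T -> posdef_opmx T ->
  exists2 c : R, 0 < c & forall x, c * cnrm2 x <= Re (cvdot (mxapp T x) x).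
Proof.
move=> sT [pT [Ti [h1 h2]]].
have p0 x : 0 <= Re (cvdot (mxapp T x) x).
  have [->|/pT] := eqVneq x 0; last by rewrite ltcE => /andP[_ /ltW].
  by rewrite /cvdot Re_sum big1 // => i _; rewrite [X in '[_, X]]mxE hdot0r.
have [M M0 hM] := mxapp_bounded Ti.
pose s := (M + 1)^-1.
have s0 : 0 < s by rewrite invr_gt0 addr_gt0.
exists s => // x; pose y := mxapp Ti x.
have Ty : mxapp T y = x by rewrite -mxappM mulmxE h1 mxapp1.
have := p0 (x - vscale s%:C y).
rewrite mxappBr mxappZr Ty cvdotDl cvdotDr cvdotNr cvdotNl cvdotDr cvdotNr.
rewrite !cvdotZr !cvdotZl (cvdot_adjoint T x y) sT Ty cvdotxx.
rewrite conjE conjc_real !(cReD, cReN, cReZ) /= opprD opprK.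
have := hM x; rewrite -/y => hy.
have := @cvdot_amgm _ 1 x y ltr01; have := ler_norm (Re (cvdot x y)).
have := ler_Re_mod (cvdot x y); rewrite mul1r invr1 mul1r => k1 k2 k3.
have sM : s * (M + 1) = 1 by rewrite mulVf // gt_eqF // addr_gt0.
have k4 : 2 * Re (cvdot x y) <= (M + 1) * cnrm2 x by lra.
have k5 : s * (s * (2 * Re (cvdot x y))) <= s * (s * ((M + 1) * cnrm2 x)).
  by rewrite !ler_pM2l.
have k6 : s * (s * ((M + 1) * cnrm2 x)) = s * cnrm2 x by rewrite [s * (_ * cnrm2 x)]mulrA sM mul1r.
have := mulr_ge0 (ltW s0) (cnrm2_ge0 x).
lra.
Qed.

Lemma coercive_posdef_opmx n (T : 'M[L]_n) (c : R) : adjoint_mx T = T -> 0 < c ->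
  (forall x, c * cnrm2 x <= Re (cvdot (mxapp T x) x)) -> posdef_opmx T.
Proof.
move=> sT c0 hT; split; last exact: coercive_mx_invertible hT.
move=> x x0; rewrite -[opmx_app T x]/(mxapp T x) ltcE /=; apply/andP; split.
  have := congr1 (fun z : R[i] => Im z) (cvdotC (mxapp T x) x).
  rewrite cImJ cvdot_adjoint sT => h; apply/eqP.
  by lra.
by apply: lt_le_trans (hT x); rewrite mulr_gt0 // cnrm2_gt0.
Qed.

End OperatorMatrices.

(** * Complex integrals on the circle *)

Section ComplexIntegral.
Context {R : realType}.
Local Notation T := (circle R).
Implicit Types (m : {measure set T -> \bar R}) (f g : T -> R[i]).

Definition cmeasurable f :=
  measurable_fun setT (fun z => Re (f z)) /\ measurable_fun setT (fun z => Im (f z)).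

Definition cbounded (C : R) f := forall z, mod (f z) <= C.

Definition cintegrable m f :=
  m.-integrable setT (fun z => (Re (f z))%:E) /\
  m.-integrable setT (fun z => (Im (f z))%:E).

Lemma cmeasurableD f g : cmeasurable f -> cmeasurable g ->
  cmeasurable (fun z => f z + g z).
Proof.
move=> [f1 f2] [g1 g2]; split.
  by under eq_fun do rewrite cReD; exact: measurable_funD.
by under eq_fun do rewrite cImD; exact: measurable_funD.
Qed.

Lemma cmeasurableM f g : cmeasurable f -> cmeasurable g ->
  cmeasurable (fun z => f z * g z).
Proof.
move=> [f1 f2] [g1 g2]; split.
  under eq_fun do rewrite cReM.
  by apply: measurable_funB; exact: measurable_funM.
under eq_fun do rewrite cImM.
by apply: measurable_funD; exact: measurable_funM.
Qed.

Lemma cmeasurable_cst a : cmeasurable (fun=> a).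
Proof. by split; exact: measurable_cst. Qed.

Lemma eq_cmeasurable f g : (forall z, f z = g z) -> cmeasurable f -> cmeasurable g.
Proof. by move=> /funext ->. Qed.

Lemma cmeasurableJ f : cmeasurable f -> cmeasurable (fun z => Num.conj (f z)).
Proof.
move=> [f1 f2]; split; first by under eq_fun do rewrite cReJ.
by under eq_fun do rewrite cImJ; exact: measurable_funN.
Qed.

Lemma cmeasurableX f k : cmeasurable f -> cmeasurable (fun z => f z ^+ k).
Proof.
move=> mf; elim: k => [|k IH]; first exact: cmeasurable_cst.
rewrite (_ : (fun z => _) = (fun z => f z * f z ^+ k)); last first.
  by apply/funext => z; rewrite exprS.
exact: cmeasurableM.
Qed.

Lemma open_measurable_real (f : T -> R) : continuous f -> measurable_fun setT f.
Proof.
move=> cf; apply: (measurability _ (RGenOpens.measurableE R)).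
move=> _ [_ [a [b ->] <-]]; rewrite setTI.
apply: sub_sigma_algebra.
by move/continuousP : cf; apply; exact: interval_open.
Qed.

Lemma Re_continuous : continuous (fun a : R[i]^o => Re a).
Proof.
move=> a; apply/(@cvgrPdist_lt _ _ _ (nbhs (a : R[i]^o))) => e e0.
have e0' : 0 < e%:C :> R[i] by rewrite ltcR.
have h : \forall b \near a, `|a - b| < e%:C by exact: (@cvgr_dist_lt _ _ _ (nbhs (a : R[i]^o)) _ id a (@cvg_id _ _) _ e0').
by apply: filterS h => b; rewrite modC ltcR -cReB; exact/le_lt_trans/ler_Re_mod.
Qed.

Lemma Im_continuous : continuous (fun a : R[i]^o => Im a).
Proof.
move=> a; apply/(@cvgrPdist_lt _ _ _ (nbhs (a : R[i]^o))) => e e0.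
have e0' : 0 < e%:C :> R[i] by rewrite ltcR.
have h : \forall b \near a, `|a - b| < e%:C by exact: (@cvgr_dist_lt _ _ _ (nbhs (a : R[i]^o)) _ id a (@cvg_id _ _) _ e0').
by apply: filterS h => b; rewrite modC ltcR -cImB; exact/le_lt_trans/ler_Im_mod.
Qed.

Lemma continuous_cmeasurable (f : T -> R[i]^o) : continuous f -> cmeasurable f.
Proof.
move=> cf; split; apply: open_measurable_real => z.
  by apply: (@continuous_comp _ _ _ f (fun a : R[i]^o => Re a)); [exact: cf|exact: Re_continuous].
by apply: (@continuous_comp _ _ _ f (fun a : R[i]^o => Im a)); [exact: cf|exact: Im_continuous].
Qed.

Lemma continuous_circle_val : continuous (fun z : T => (z : R[i]) : R[i]^o).
Proof. exact: initial_continuous. Qed.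

Lemma cintegrableD m f g : cintegrable m f -> cintegrable m g ->
  cintegrable m (fun z => f z + g z).
Proof.
move=> [f1 f2] [g1 g2]; split.
  by under eq_fun do rewrite cReD EFinD; exact: integrableD.
by under eq_fun do rewrite cImD EFinD; exact: integrableD.
Qed.

Lemma cintegrableZ m a f : cintegrable m f -> cintegrable m (fun z => a * f z).
Proof.
move=> [f1 f2]; split.
  under eq_fun do rewrite cReM EFinB !EFinM.
  by apply: integrableB => //; exact: integrableZl.
under eq_fun do rewrite cImM EFinD !EFinM.
by apply: integrableD => //; exact: integrableZl.
Qed.

Lemma eq_cintegrable m f g : (forall z, f z = g z) -> cintegrable m f -> cintegrable m g.
Proof. by move=> /funext ->. Qed.

Lemma eq_cintegral m f g : (forall z, f z = g z) -> cintegral m f = cintegral m g.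
Proof. by move=> /funext ->. Qed.

Lemma cintegralD m f g : cintegrable m f -> cintegrable m g ->
  cintegral m (fun z => f z + g z) = cintegral m f + cintegral m g.
Proof.
move=> [f1 f2] [g1 g2]; apply: eqcP => /=.
  by rewrite -RintegralD //; apply: eq_Rintegral => z _; rewrite cReD.
by rewrite -RintegralD //; apply: eq_Rintegral => z _; rewrite cImD.
Qed.

Lemma cintegralZ m a f : cintegrable m f ->
  cintegral m (fun z => a * f z) = a * cintegral m f.
Proof.
move=> [f1 f2].
have s1 (k : R) : m.-integrable setT (EFin \o (fun z => k * Re (f z))).
  exact: (integrableZl measurableT k f1).
have s2 (k : R) : m.-integrable setT (EFin \o (fun z => k * Im (f z))).
  exact: (integrableZl measurableT k f2).
apply: eqcP; rewrite ?cReM ?cImM /= -!RintegralZl //.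
  rewrite -RintegralB //.
  by apply: eq_Rintegral => z _; rewrite cReM.
rewrite -RintegralD //.
by apply: eq_Rintegral => z _; rewrite cImM.
Qed.

Lemma cintegralJ m f : cintegrable m f ->
  cintegral m (fun z => Num.conj (f z)) = Num.conj (cintegral m f).
Proof.
move=> [f1 f2]; apply: eqcP; rewrite ?cReJ ?cImJ /=.
  by apply: eq_Rintegral => z _; rewrite cReJ.
rewrite -mulN1r -RintegralZl //.
by apply: eq_Rintegral => z _; rewrite cImJ mulN1r.
Qed.

Lemma cintegrableJ m f : cintegrable m f -> cintegrable m (fun z => Num.conj (f z)).
Proof.
move=> [f1 f2]; split; first by under eq_fun do rewrite cReJ.
by under eq_fun do rewrite cImJ EFinN; exact: integrableN.
Qed.

Lemma cintegrable0 m : cintegrable m (fun=> 0).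
Proof. by split; exact: integrable0. Qed.

Lemma cintegral0 m : cintegral m (fun=> 0) = 0.
Proof.
apply: eqcP => /=.
  by rewrite /Rintegral integral0.
by rewrite /Rintegral integral0.
Qed.

Lemma cintegrable_sum m I (r : seq I) (P : pred I) (F : I -> T -> R[i]) :
  (forall i, P i -> cintegrable m (F i)) ->
  cintegrable m (fun z => \sum_(i <- r | P i) F i z).
Proof.
move=> h; elim: r => [|i r IH].
  by apply: eq_cintegrable (cintegrable0 m) => z; rewrite big_nil.
have [Pi|Pi] := boolP (P i).
  apply: eq_cintegrable (cintegrableD (h i Pi) IH) => z.
  by rewrite big_cons Pi.
by apply: eq_cintegrable IH => z; rewrite big_cons (negbTE Pi).
Qed.

Lemma cintegral_sum m I (r : seq I) (P : pred I) (F : I -> T -> R[i]) :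
  (forall i, P i -> cintegrable m (F i)) ->
  cintegral m (fun z => \sum_(i <- r | P i) F i z) =
    \sum_(i <- r | P i) cintegral m (F i).
Proof.
move=> h; elim: r => [|i r IH].
  by rewrite big_nil -[RHS](cintegral0 m); apply: eq_cintegral => z; rewrite big_nil.
rewrite big_cons; case: ifPn => Pi.
  rewrite -IH -cintegralD; [|exact: h|exact: cintegrable_sum].
  by apply: eq_cintegral => z; rewrite big_cons Pi.
by rewrite -IH; apply: eq_cintegral => z; rewrite big_cons (negbTE Pi).
Qed.

(** Multiplying f by a constant phase turns the modulus of the integral into a real part. *)
Lemma cintegral_le m f (g : T -> R) : cintegrable m f ->
  m.-integrable setT (EFin \o g) -> (forall z, mod (f z) <= g z) ->
  mod (cintegral m f) <= \int[m]_z g z.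
Proof.
move=> intf intg fg; have [u u1 <-] := mod_phase (cintegral m f).
have intuf := cintegrableZ u intf.
rewrite -cintegralZ //=; apply: le_Rintegral => //; first exact: intuf.1.
move=> z _; apply: le_trans (ler_norm _) (le_trans (ler_Re_mod _) _).
by rewrite modM u1 mul1r.
Qed.

Lemma cbounded_ge0 C f : cbounded C f -> 0 <= C.
Proof. by move=> /(_ point); exact/le_trans/mod_ge0. Qed.

Lemma measurable_bounded_fun C f : cbounded C f ->
  [bounded Re (f z) | z in setT] /\ [bounded Im (f z) | z in setT].
Proof.
move=> bf; split; exists C; split; rewrite ?num_real // => r Cr z _ /=;
  apply: le_trans (ltW Cr); apply: le_trans (bf z).
  exact: ler_Re_mod.
exact: ler_Im_mod.
Qed.

Lemma cintegrable_bounded m C f : (m setT < +oo)%E -> cmeasurable f -> cbounded C f ->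
  cintegrable m f.
Proof.
move=> moo [f1 f2] /measurable_bounded_fun [b1 b2].
by split; apply: measurable_bounded_integrable.
Qed.

Lemma cintegrableM m C f g : cmeasurable f -> cbounded C f -> cintegrable m g ->
  cintegrable m (fun z => f z * g z).
Proof.
move=> [f1 f2] /measurable_bounded_fun [b1 b2] [g1 g2]; split.
  under eq_fun do rewrite cReM EFinB !EFinM.
  by apply: integrableB => //; exact: integrableMr.
under eq_fun do rewrite cImM EFinD !EFinM.
by apply: integrableD => //; exact: integrableMr.
Qed.

End ComplexIntegral.

(** * Operator densities *)

Section CircleMeasure.
Context {R : realType}.
Local Notation T := (circle R).

Lemma circle_measureT : @circle_measure R setT = 1%E.
Proof.
rewrite /circle_measure /pushforward preimage_setT /arc_measure /= /mscale /=.
rewrite /mrestr setTI lebesgue_measure_itv /= lte_fin mulr_gt0 ?pi_gt0 //.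
by rewrite oppr0 adde0 -EFinM mulVf // mulf_neq0 // gt_eqF ?pi_gt0.
Qed.

Fact circle_measure_finite : fin_num_fun (@circle_measure R).
Proof. by apply: lty_fin_num_fun; rewrite /= circle_measureT ltry. Qed.

HB.instance Definition _ := @Measure_isFinite.Build _ _ _ (@circle_measure R)
  circle_measure_finite.

Lemma circle_bounded_cintegrable C f : cmeasurable f -> cbounded C f ->
  cintegrable (@circle_measure R) f.
Proof.
by apply: cintegrable_bounded; rewrite [X in (X < _)%E]circle_measureT ltry.
Qed.

(** By Radon-Nikodym, of which g is a version; bounded integrands suffice here. *)
Lemma density_Rintegral (m : {measure set T -> \bar R}) (g : T -> R) (f : T -> R) :
  (@circle_measure R).-integrable setT (EFin \o g) ->
  (forall s, measurable s -> m s = \int[@circle_measure R]_(z in s) (g z)%:E)%E ->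
  measurable_fun setT f -> [bounded f z | z in setT] ->
  \int[m]_z f z = \int[@circle_measure R]_z (f z * g z).
Proof.
move=> intg mE mf bf.
have mfin : (m setT < +oo)%E by rewrite mE //; exact: integrable_lty.
pose m' : {finite_measure set T -> \bar R} := mfrestr measurableT mfin.
have m'E s : m' s = m s by rewrite /m' /= /mfrestr /mrestr setIT.
have dom : m' `<< @circle_measure R.
  apply/null_content_dominatesP => s ms s0; rewrite m'E mE //.
  apply: null_set_integral => //.
  exact: measurable_funS (measurable_int _ intg).
have intf : m'.-integrable setT (EFin \o f).
  apply: measurable_bounded_integrable => //.
  by rewrite ltey_eq fin_num_measure.
have cov := @Radon_Nikodym_change_of_variables _ _ _ m' (@circle_measure R) dom _ setT measurableT intf.
have intRN := @Radon_Nikodym_integrable _ _ _ (charge_of_finite_measure m') (@circle_measure R) dom.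
have ae : ae_eq (@circle_measure R) setT
    (Radon_Nikodym (charge_of_finite_measure m') (@circle_measure R)) (EFin \o g).
  apply: integral_ae_eq => //.
    exact: measurable_int intg.
  by move=> E _ mE'; rewrite -Radon_Nikodym_integral // -mE // -m'E.
congr fine; transitivity (\int[m']_z (f z)%:E)%E.
  by apply: eq_measure_integral => s _ _; exact: esym (m'E s).
rewrite -[LHS]cov; apply: ae_eq_integral => //.
- apply: emeasurable_funM; first exact: measurable_int intf.
  exact: measurable_int intRN.
- by apply/measurable_EFinP/measurable_funM => //; apply/measurable_EFinP; exact: measurable_int intg.
- by apply: filterS ae => x /(_ I) -> _; rewrite /= EFinM.
Qed.

Lemma same_real_eq (c : R[i]) (u v : \bar R) : same_real c u -> same_real c v -> u = v.
Proof. by move=> [r -> ->] [r' /complexI -> ->]. Qed.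

End CircleMeasure.

Section Densities.
Context {R : realType} {H : hilbertType R}.
Local Notation T := (circle R).
Local Notation lambda := (@circle_measure R).
Implicit Types (w : T -> bop H) (f : T -> R[i]).

(** Nonnegativity everywhere makes each w z self-adjoint, and K bounds all integrals
    of bounded functions against the forms of w ([density_form_le]). Every density of
    an operator measure is, up to a null set, of this kind ([has_density_regular],
    [has_density_form]). *)
Definition form_density w (K : R) :=
  [/\ weakly_measurable w, forall z, nonneg_op (w z) &
    forall h, lambda.-integrable setT (fun z => (Re '[w z h, h])%:E) /\
      \int[lambda]_z Re '[w z h, h] <= K * nrm h ^+ 2].

Lemma nonneg_op_diag (A : bop H) h : nonneg_op A ->
  '[A h, h] = (Re '[A h, h])%:C /\ 0 <= Re '[A h, h].
Proof.
move=> /(_ h); rewrite lecE => /andP[/eqP /= h0 ->]; split => //.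
exact: eqcP.
Qed.

(** Setting the density to 0 on a null set containing the bad points changes no
    integral. *)
Lemma has_density_regular (mu : set T -> bop H) w : has_density mu w ->
  exists2 w', forall z, nonneg_op (w' z) & has_density mu w'.
Proof.
move=> [mw [N [mN N0 subN]] wmu].
have zero_nonneg : nonneg_op (0 : bop H) by move=> x; rewrite hdot0l.
pose w' z := if z \in N then 0 else w z.
have nw' z : nonneg_op (w' z).
  rewrite /w'; case: ifPn => // /negP zN; apply: contrapT => nw.
  by apply: zN; rewrite inE; exact: subN.
have mNb : measurable_fun setT (fun z : T => z \in N).
  apply: (measurable_fun_bool true); rewrite setTI (_ : _ @^-1` _ = N) //.
  by apply/seteqP; split => z /= h; [exact: set_mem|exact: mem_set].
have mw' : weakly_measurable w'.
  move=> x y; have [m1 m2] := mw x y.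
  split.
    rewrite (_ : (fun z => _) = (fun z => if z \in N then 0 else Re '[w z x, y])).
      exact: measurable_fun_ifT.
    by apply/funext => z; rewrite /w'; case: ifP => //; rewrite hdot0l.
  rewrite (_ : (fun z => _) = (fun z => if z \in N then 0 else Im '[w z x, y])).
    exact: measurable_fun_ifT.
  by apply/funext => z; rewrite /w'; case: ifP => //; rewrite hdot0l.
exists w' => //; split => //; first exact: aeW.
move=> h s ms; rewrite (_ : density_measure w' h s = density_measure w h s); first exact: wmu.
rewrite /density_measure; apply: ae_eq_integral => //.
- by apply/measurable_EFinP/measurable_funTS; have [] := mw' h h.
- by apply/measurable_EFinP/measurable_funTS; have [] := mw h h.
- exists N; split => // z /= hz; apply: contrapT => zN; apply: hz => _.
  by rewrite /w' (_ : z \in N = false) //; apply/negP; rewrite inE.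
Qed.

(** The constant is the norm of the total mass of mu. *)
Lemma has_density_form (mu : set T -> bop H) w : has_density mu w ->
  (forall z, nonneg_op (w z)) -> exists K, form_density w K.
Proof.
move=> [mw _ wmu] nw; have [M M0 hM] := bop_bounded (mu setT).
exists M; split => // h; have [r r1 r2] := wmu h setT measurableT.
have nn z : (0 <= (Re '[w z h, h])%:E)%E.
  by rewrite lee_fin; have [] := nonneg_op_diag h (nw z).
split.
  apply/integrableP; split; first by apply/measurable_EFinP; have [] := mw h h.
  under eq_integral => z _ do rewrite gee0_abs //.
  by rewrite -[X in (X < _)%E]/(density_measure w h setT) r2 ltry.
rewrite /Rintegral -[X in fine X]/(density_measure w h setT) r2 /=.
have := le_trans (ler_norm _) (le_trans (ler_Re_mod _) (hdot_le (mu setT h) h)).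
by rewrite r1 /= => /le_trans; apply; rewrite expr2 mulrA ler_wpM2r ?nrm_ge0.
Qed.

Section FormDensity.
Variables (w : T -> bop H) (K : R).
Hypothesis dw : form_density w K.

Let q h z : R[i] := '[w z h, h].

Lemma density_diag_cintegrable h : cintegrable lambda (q h).
Proof.
have [mw nw /(_ h)[iw _]] := dw; split => //.
rewrite (_ : (fun z => _) = (fun=> 0%E)); first exact: integrable0.
by apply/funext => z; rewrite /q (nonneg_op_diag h (nw z)).1.
Qed.

Lemma density_polarization x y z :
  '[w z x, y] = 4^-1 * (q (x + y) z + -1 * q (x - y) z +
     'i%C * (q (x + 'i%C *: y) z + -1 * q (x - 'i%C *: y) z)).
Proof. by rewrite !mulN1r -polarization mulKf // pnatr_eq0. Qed.

Lemma density_cintegrable x y : cintegrable lambda (fun z => '[w z x, y]).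
Proof.
apply: eq_cintegrable (fun z => esym (density_polarization x y z)) _.
by do ?[apply: cintegrableZ | apply: cintegrableD]; exact: density_diag_cintegrable.
Qed.

Section Integrand.
Variables (f : T -> R[i]) (C : R).
Hypotheses (mf : cmeasurable f) (bf : cbounded C f).

Lemma density_cintegrableM x y : cintegrable lambda (fun z => f z * '[w z x, y]).
Proof. exact: cintegrableM mf bf (density_cintegrable x y). Qed.

(** On the diagonal w is a nonnegative function, so a bound on f is a bound on the
    integral by the total mass. *)
Lemma density_diag_le h :
  mod (cintegral lambda (fun z => f z * q h z)) <= C * (K * nrm h ^+ 2).
Proof.
have [mw nw /(_ h)[iw hK]] := dw.
apply: le_trans (_ : C * \int[lambda]_z Re '[w z h, h] <= _); last first.
  by rewrite ler_wpM2l // (cbounded_ge0 bf).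
rewrite -RintegralZl //; apply: cintegral_le.
- exact: cintegrableM mf bf (density_diag_cintegrable h).
- exact: (integrableZl measurableT C iw).
- move=> z; have [e p] := nonneg_op_diag h (nw z).
  by rewrite modM /q e mod_real /= ger0_norm // ler_wpM2r.
Qed.

(** Polarization of [density_diag_le]; the parallelogram law adds up the four bounds. *)
Lemma density_form_le x y :
  mod (cintegral lambda (fun z => f z * '[w z x, y])) <=
    C * K * (nrm x ^+ 2 + nrm y ^+ 2).
Proof.
pose Q h := cintegral lambda (fun z => f z * q h z).
have iq h : cintegrable lambda (fun z => f z * q h z).
  exact: cintegrableM mf bf (density_diag_cintegrable h).
have -> : cintegral lambda (fun z => f z * '[w z x, y]) =
    4^-1 * (Q (x + y) + -1 * Q (x - y) + 'i%C * (Q (x + 'i%C *: y) + -1 * Q (x - 'i%C *: y))).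
  rewrite /Q -!cintegralZ // -!cintegralD //; try exact: cintegrableZ.
  rewrite -cintegralZ; last by apply: cintegrableD => //; exact: cintegrableZ.
  rewrite -cintegralD; last 2 first.
  - by apply: cintegrableD => //; exact: cintegrableZ.
  - by apply/cintegrableZ/cintegrableD => //; exact: cintegrableZ.
  rewrite -cintegralZ; last first.
    apply: cintegrableD; last apply: cintegrableZ;
      by apply: cintegrableD => //; exact: cintegrableZ.
  by apply: eq_cintegral => z; rewrite density_polarization; ring.
have modi : mod 'i%C = 1 :> R.
  by apply: complexI; rewrite -modC normc_def /= expr0n add0r expr1n sqrtr1.
have modN1 : mod (-1) = 1 :> R by rewrite modN mod1.
have mod4 : mod 4^-1 = 4^-1 :> R.
  have -> : 4^-1 = (4^-1 : R)%:C :> R[i] by rewrite fmorphV rmorph_nat.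
  by rewrite mod_real ger0_norm // invr_ge0.
rewrite modM mod4 ler_pdivrMl //.
have hQ h : mod (Q h) <= C * (K * nrm h ^+ 2) := density_diag_le h.
have t1 := modD (Q (x + y) + -1 * Q (x - y)) ('i%C * (Q (x + 'i%C *: y) + -1 * Q (x - 'i%C *: y))).
rewrite [X in _ <= _ + X]modM modi mul1r in t1.
have t2 := modD (Q (x + y)) (-1 * Q (x - y)); rewrite [X in _ <= _ + X]modM modN1 mul1r in t2.
have t3 := modD (Q (x + 'i%C *: y)) (-1 * Q (x - 'i%C *: y)).
rewrite [X in _ <= _ + X]modM modN1 mul1r in t3.
have h1 := hQ (x + y); have h2 := hQ (x - y).
have h3 := hQ (x + 'i%C *: y); have h4 := hQ (x - 'i%C *: y).
have := congr1 (fun t => C * (K * t)) (parallelogram x y).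
have := congr1 (fun t => C * (K * t)) (parallelogram x ('i%C *: y)).
by rewrite /= nrmZ modi mul1r; lra.
Qed.

End Integrand.
End FormDensity.
End Densities.

(** * Operator integrals against a density *)

Section DensityOperators.
Context {R : realType} {H : hilbertType R}.
Local Notation T := (circle R).
Local Notation lambda := (@circle_measure R).
Implicit Types (w : T -> bop H) (f : T -> R[i]).

(** Applying the additive bound to normalized vectors makes it multiplicative. *)
Lemma form_bound_scale (b : H -> H -> R[i]) (D : R) :
  (forall a x x' y, b (a *: x + x') y = a * b x y + b x' y) ->
  (forall a x y y', b x (a *: y + y') = Num.conj a * b x y + b x y') ->
  (forall x y, mod (b x y) <= D * (nrm x ^+ 2 + nrm y ^+ 2)) ->
  forall x y, mod (b x y) <= D * 2 * (nrm x * nrm y).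
Proof.
move=> bl br bD x y.
have b0l y' : b 0 y' = 0.
  by apply: (addrI (b 0 y')); rewrite -{1}[b 0 y']mul1r -bl scaler0 !addr0.
have b0r x' : b x' 0 = 0.
  by have := br 1 x' 0 0; rewrite scaler0 addr0 rmorph1 mul1r => /(congr1 (fun t => t - b x' 0)); rewrite subrr addrK.
have bZl a x' y' : b (a *: x') y' = a * b x' y' by have := bl a x' 0 y'; rewrite b0l !addr0.
have bZr a x' y' : b x' (a *: y') = Num.conj a * b x' y' by have := br a x' y' 0; rewrite b0r !addr0.
have [->|x0] := eqVneq x 0; first by rewrite b0l mod0 nrm0 mul0r mulr0.
have [->|y0] := eqVneq y 0; first by rewrite b0r mod0 nrm0 !mulr0.
have nx : 0 < nrm x by rewrite nrm_gt0.
have ny : 0 < nrm y by rewrite nrm_gt0.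
have := bD ((nrm x)^-1%:C *: x) ((nrm y)^-1%:C *: y).
rewrite bZl bZr !modM modJ !nrmZ !mod_real !ger0_norm ?invr_ge0 ?nrm_ge0 //.
rewrite !mulVf ?gt_eqF // expr1n -(ler_pM2l (mulr_gt0 nx ny)).
have -> : nrm x * nrm y * ((nrm x)^-1 * ((nrm y)^-1 * mod (b x y))) = mod (b x y).
  by field; rewrite !gt_eqF.
by move=> h; lra.
Qed.

Lemma density_op w K f C : form_density w K -> cmeasurable f -> cbounded C f ->
  exists B : bop H, forall x y, '[B x, y] = cintegral lambda (fun z => f z * '[w z x, y]).
Proof.
move=> dw mf bf; have I := density_cintegrableM dw mf bf.
have bl a x x' y : cintegral lambda (fun z => f z * '[w z (a *: x + x'), y]) =
    a * cintegral lambda (fun z => f z * '[w z x, y]) +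
    cintegral lambda (fun z => f z * '[w z x', y]).
  rewrite -cintegralZ // -cintegralD //; last exact: cintegrableZ.
  by apply: eq_cintegral => z; rewrite bopD bopZ hdotDl hdotZl; ring.
have br a x y y' : cintegral lambda (fun z => f z * '[w z x, a *: y + y']) =
    Num.conj a * cintegral lambda (fun z => f z * '[w z x, y]) +
    cintegral lambda (fun z => f z * '[w z x, y']).
  rewrite -cintegralZ // -cintegralD //; last exact: cintegrableZ.
  by apply: eq_cintegral => z; rewrite hdotDr hdotZr; ring.
have bb x y := density_form_le dw mf bf x y.
exact: form_bop bl br (form_bound_scale bl br bb).
Qed.

Lemma scalar_measure_cintegral (mu : set T -> bop H) w K f C h
    (m : {measure set T -> \bar R}) :
  has_density mu w -> form_density w K -> scalar_measure mu h m ->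
  cmeasurable f -> cbounded C f ->
  cintegral m f = cintegral lambda (fun z => f z * '[w z h, h]).
Proof.
move=> [_ _ wmu] [mw nw iw] mh [mf1 mf2] bf.
have mE s : measurable s -> m s = (\int[lambda]_(z in s) (Re '[w z h, h])%:E)%E.
  by move=> ms; apply: same_real_eq (mh s ms) (wmu h s ms).
have [b1 b2] := measurable_bounded_fun bf.
apply: eqcP => /=; rewrite (density_Rintegral (iw h).1 mE) //;
  apply: eq_Rintegral => z _; have [e _] := nonneg_op_diag h (nw z).
  by rewrite e cReM /= mulr0 subr0.
by rewrite e cImM /= mulr0 add0r.
Qed.

(** The operator of [density_op] satisfies the condition that defines the operator
    integral, and by polarization it is the only one that does. *)
Lemma povm_integralE (mu : set T -> bop H) w K f C : is_povm mu -> has_density mu w ->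
  form_density w K -> cmeasurable f -> cbounded C f -> forall x y,
  '[povm_integral mu f x, y] = cintegral lambda (fun z => f z * '[w z x, y]).
Proof.
move=> pmu dmu dw mf bf.
have [B hB] := density_op dw mf bf.
have hex : [set B : bop H | forall h, exists2 m : {measure set T -> \bar R},
    scalar_measure mu h m & '[B h, h] = cintegral m f] !=set0.
  exists B => h; have [m mh] := pmu h; exists m => //.
  by rewrite hB (scalar_measure_cintegral dmu dw mh mf bf).
have hP : forall h, exists2 m : {measure set T -> \bar R},
    scalar_measure mu h m & '[povm_integral mu f h, h] = cintegral m f.
  exact: (xgetPex 0 hex).
suff -> : povm_integral mu f = B by [].
apply: bop_eq_diag => h; have [m mh ->] := hP h.
by rewrite hB (scalar_measure_cintegral dmu dw mh mf bf).
Qed.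

(** A name depending on the proof of [form_density], so that the measure instance
    below can be attached to it. *)
Definition form_density_measure w K (dw : form_density w K) h : set T -> \bar R :=
  density_measure w h.

Section FormDensityMeasure.
Variables (w : T -> bop H) (K : R) (dw : form_density w K) (h : H).

Let dens0 : form_density_measure dw h set0 = 0%E.
Proof. by rewrite /form_density_measure /density_measure integral_set0. Qed.

Let dens_ge0 s : (0 <= form_density_measure dw h s)%E.
Proof.
apply: integral_ge0 => z _; rewrite lee_fin.
by have [_ /(_ z)/(nonneg_op_diag h)[]] := dw.
Qed.

Let dens_sadd : semi_sigma_additive (form_density_measure dw h).
Proof.
move=> F mF tF mUF; rewrite /form_density_measure /density_measure.
have [mw nw iw] := dw.
apply: cvg_toP.
  apply: ereal_nondecreasing_is_cvgn => m n mn.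
  by apply: lee_sum_nneg_natr => // k _ _; exact: dens_ge0.
rewrite ge0_integral_bigcup //.
- by apply/measurable_EFinP/measurable_funTS; have [] := mw h h.
- by move=> z _; rewrite lee_fin; have [] := nonneg_op_diag h (nw z).
Qed.

HB.instance Definition _ := isMeasure.Build _ _ _ (form_density_measure dw h)
  dens0 dens_ge0 dens_sadd.

End FormDensityMeasure.

Lemma form_density_fin w K h s : form_density w K -> measurable s ->
  density_measure w h s = (\int[lambda]_(z in s) Re '[w z h, h])%:E.
Proof.
move=> [mw nw iw] ms; rewrite /Rintegral fineK //.
apply: integrable_fin_num => //.
exact: integrableS (iw h).1.
Qed.

Lemma with_densityE w K s h : form_density w K -> measurable s ->
  same_real '[with_density w s h, h] (density_measure w h s).
Proof.
move=> dw ms.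
pose f (z : T) : R[i] := (\1_s z)%:C.
have mf : cmeasurable f.
  by split; [exact: measurable_indic|exact: measurable_cst].
have bf : cbounded 1 f.
  by move=> z; rewrite mod_real ger0_norm // indicE lern1 leq_b1.
have [B hB] := density_op dw mf bf.
have hex : [set B : bop H | forall h, same_real '[B h, h] (density_measure w h s)] !=set0.
  exists B => k /=; rewrite (form_density_fin k dw ms).
  exists (\int[lambda]_(z in s) Re '[w z k, k]) => //.
  rewrite hB; have [_ nw _] := dw; apply: eqcP => /=.
    rewrite [RHS]Rintegral_mkcond; apply: eq_Rintegral => z _.
    by rewrite cReZ patchE indicE; case: ifP; rewrite ?mul1r ?mul0r.
  rewrite /Rintegral integral0_eq // => z _.
  by rewrite cImZ (nonneg_op_diag k (nw z)).1 /= mulr0.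
exact: (xgetPex 0 hex).
Qed.

Lemma with_density_has_density w K : form_density w K -> has_density (with_density w) w.
Proof.
move=> dw; have [mw nw _] := dw; split => //; first exact: aeW.
by move=> h s ms; exact: with_densityE dw ms.
Qed.

Lemma with_density_povm w K : form_density w K -> is_povm (with_density w).
Proof.
move=> dw h; exists (form_density_measure dw h) => s ms.
exact: with_densityE dw ms.
Qed.

End DensityOperators.

(** * Fourier analysis on the circle *)

Section CircleFourier.
Context {R : realType}.
Local Notation T := (circle R).
Local Notation lambda := (@circle_measure R).
Implicit Types (z : T).

Lemma circle_mod z : mod (z : R[i]) = 1.
Proof.
suff h : `|z : R[i]| = 1 by rewrite /mod h.
exact: (set_valP z).
Qed.

Lemma circle_neq0 z : (z : R[i]) != 0.
Proof. by apply: contraTneq (oner_neq0 R) => z0; rewrite -(circle_mod z) z0 mod0 eqxx. Qed.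

Lemma circle_mulJ z : (z : R[i]) * Num.conj (z : R[i]) = 1.
Proof. by rewrite -sqr_normc modC circle_mod expr1n. Qed.

Lemma circle_inv z : (z : R[i])^-1 = Num.conj (z : R[i]).
Proof. by rewrite -[LHS]mulr1 -(circle_mulJ z) mulKf // circle_neq0. Qed.

Lemma circle_modX z (k : int) : mod ((z : R[i]) ^ k) = 1.
Proof.
have e (n : nat) : mod ((z : R[i]) ^+ n) = 1.
  by elim: n => [|n IH]; rewrite ?exprS ?modM ?circle_mod ?IH ?mulr1 ?mod1.
case: k => n; first exact: e.
by rewrite -[_ ^ Negz n]/((z : R[i]) ^- n.+1) -exprVn circle_inv -rmorphXn modJ e.
Qed.

Lemma circle_conjX z (k : int) : Num.conj ((z : R[i]) ^ k) = (z : R[i]) ^ (- k).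
Proof.
transitivity ((Num.conj (z : R[i])) ^ k); last by rewrite -circle_inv exprz_inv.
case: k => n; first exact: (rmorphXn (@Num.conj (R[i]))).
by rewrite /= fmorphV; congr (_^-1); exact: (rmorphXn (@Num.conj (R[i]))).
Qed.

Lemma cmeasurable_circleX (k : int) : cmeasurable (fun z : T => (z : R[i]) ^ k).
Proof.
have e (n : nat) : cmeasurable (fun z : T => (z : R[i]) ^+ n).
  by apply: cmeasurableX; apply: continuous_cmeasurable; exact: continuous_circle_val.
case: k => n; first exact: e.
rewrite (_ : (fun z => _) = (fun z : T => Num.conj ((z : R[i]) ^+ n.+1))).
  exact: cmeasurableJ.
by apply/funext => z; rewrite (circle_conjX z n.+1).
Qed.

Lemma cbounded_circleX (k : int) : cbounded 1 (fun z : T => (z : R[i]) ^ k).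
Proof. by move=> z; rewrite circle_modX. Qed.

Lemma cintegrable_circleX (k : int) : cintegrable lambda (fun z : T => (z : R[i]) ^ k).
Proof. exact: (circle_bounded_cintegrable (cmeasurable_circleX k) (cbounded_circleX k)). Qed.

Lemma expi_exp (t : R) (k : nat) :
  (expi t : R[i]) ^+ k = cos (k%:R * t) +i* sin (k%:R * t).
Proof.
elim: k => [|k IH]; first by rewrite expr0 mul0r cos0 sin0.
rewrite exprS IH -natr1 mulrDl mul1r cosD sinD /circle_val /=.
by simpc; congr (_ +i* _); ring.
Qed.

(** On the closed interval the fundamental theorem of calculus applies. *)
Lemma ge0_circle_integral (f : T -> R) : measurable_fun setT f ->
  (forall z, 0 <= f z) ->
  (\int[lambda]_z (f z)%:E =
    ((2 * pi)^-1)%R%:E * \int[lebesgue_measure]_(t in `[0%R, (2 * pi)%R]) (f (expi t))%:E)%E.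
Proof.
move=> mf f0.
have mfe : measurable_fun setT (fun t : measurableTypeR R => (f (expi t))%:E).
  have mf' : measurable_fun setT (f \o (@expi R : measurableTypeR R -> T)).
    exact: (measurableT_comp mf (@measurable_expi R)).
  exact/measurable_EFinP.
rewrite /circle_measure (ge0_integral_pushforward (@measurable_expi R)) //; last 2 first.
- exact/measurable_EFinP.
- by move=> z _; rewrite lee_fin.
rewrite preimage_setT /arc_measure ge0_integral_mscale //; last first.
  by move=> t _; rewrite lee_fin.
congr (_ * _)%E.
pose D : set (measurableTypeR R) := `[0, 2 * pi[%classic.
rewrite (@ge0_negligible_integral _ _ _ _ setT (~` D)) //; last 3 first.
- by apply: measurableC; exact: measurable_itv.
- by move=> t _; rewrite lee_fin.
- by rewrite /= /mrestr setICl measure0.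
rewrite setTD setCK -integral_itv_bndo_bndc; last first.
  by apply: measurable_funTS.
by apply: eq_measure_integral => A mA AD; rewrite /= /mrestr setIidl.
Qed.

(** The summand 1 makes the integrand nonnegative when |f| <= 1, as
    [ge0_circle_integral] requires. *)
Lemma integral_one_plus (f F : R -> R) : continuous f ->
  (forall t : R, is_derive t 1 F (f t)) -> F (2 * pi) = F 0 ->
  (\int[lebesgue_measure]_(t in `[0%R, (2 * pi)%R]) (1 + f t)%R%:E = (2 * pi)%R%:E)%E.
Proof.
move=> cf dF FF.
have dG (t : R) : is_derive t 1 (fun t => t + F t) (1 + f t).
  exact: is_deriveD.
have cG : continuous (fun t => t + F t).
  move=> t; apply: differentiable_continuous; apply/derivable1_diffP.
  by have [] := dG t.
rewrite (@continuous_FTC2 _ _ (fun t => t + F t)).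
- by rewrite FF -EFinB; congr (_%:E); rewrite add0r addrK.
- by rewrite mulr_gt0 ?pi_gt0.
- apply: continuous_subspaceT => t; apply: cvgD; [exact: cvg_cst|exact: cf].
- split.
  + by move=> t _; have [] := dG t.
  + apply: cvg_at_right_filter; exact: cG.
  + apply: cvg_at_left_filter; exact: cG.
- by move=> t _; rewrite derive1E; have [_] := dG t.
Qed.

Lemma circle_integral_oscillating (f : T -> R) (g F : R -> R) :
  measurable_fun setT f -> (forall z, `|f z| <= 1) -> (forall t, f (expi t) = g t) ->
  continuous g -> (forall t : R, is_derive t 1 F (g t)) -> F (2 * pi) = F 0 ->
  \int[lambda]_z f z = 0.
Proof.
move=> mf f1 fg cg dF FF.
have intf : lambda.-integrable setT (EFin \o f).
  apply: measurable_bounded_integrable => //.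
    by rewrite [X in (X < _)%E]circle_measureT ltry.
  exists 1; split => // r r1 z _ /=; exact: le_trans (f1 z) (ltW r1).
have int1 : lambda.-integrable setT (EFin \o (fun=> 1 : R)).
  apply: measurable_bounded_integrable => //.
    by rewrite [X in (X < _)%E]circle_measureT ltry.
  exists 1; split => // r r1 z _ /=; rewrite normr1; exact: ltW.
have : \int[lambda]_z (1 + f z) = 1.
  rewrite /Rintegral ge0_circle_integral; last 2 first.
  - exact: measurable_funD.
  - by move=> z; have := f1 z; rewrite ler_norml => /andP[+ _]; lra.
  under eq_integral => t _ do rewrite fg.
  by rewrite (integral_one_plus cg dF FF) -EFinM /= mulVf // mulf_neq0 // gt_eqF ?pi_gt0.
rewrite RintegralD // Rintegral_cst //.
by rewrite [X in fine X](@circle_measureT R) /= mulr1; lra.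
Qed.

Lemma circle_fourier (k : int) : cintegral lambda (fun z => (z : R[i]) ^ k) = (k == 0)%:R.
Proof.
have pos (n : nat) : cintegral lambda (fun z => (z : R[i]) ^+ n.+1) = 0.
  pose a : R := n.+1%:R.
  have a0 : a != 0 by rewrite pnatr_eq0.
  have a2pi : cos (a * (2 * pi)) = 1 /\ sin (a * (2 * pi)) = 0.
    rewrite mulr_natl; have := expi_exp (pi *+ 2) n.+1.
    rewrite /circle_val /= cos2pi sin2pi -/a.
    have -> : (1 +i* 0 : R[i]) = 1 by [].
    by rewrite expr1n => -[<- <-].
  have [m1 m2] := cmeasurable_circleX n.+1.
  have b z : `|Re ((z : R[i]) ^+ n.+1)| <= 1 /\ `|Im ((z : R[i]) ^+ n.+1)| <= 1.
    rewrite -(circle_modX z n.+1); split; [exact: ler_Re_mod|exact: ler_Im_mod].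
  apply: eqcP => /=.
    apply: (@circle_integral_oscillating _ (fun t => cos (a * t)) (fun t => a^-1 * sin (a * t))) => //.
    - by move=> z; exact: (b z).1.
    - by move=> t; rewrite expi_exp.
    - by move=> t; apply: (@continuous_comp _ _ _ (fun t => a * t) cos);
        [exact: mulrl_continuous|exact: continuous_cos].
    - move=> t; apply: is_derive_eq.
      by rewrite /= !scaler1 ?scaler0 ?addr0; rewrite -?[_ *: _]/(_ * _); field.
    - by rewrite a2pi.2 !mulr0 sin0 mulr0.
  apply: (@circle_integral_oscillating _ (fun t => sin (a * t)) (fun t => - a^-1 * cos (a * t))) => //.
  - by move=> z; exact: (b z).2.
  - by move=> t; rewrite expi_exp.
  - by move=> t; apply: (@continuous_comp _ _ _ (fun t => a * t) sin);
      [exact: mulrl_continuous|exact: continuous_sin].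
  - move=> t; apply: is_derive_eq.
    by rewrite /= !scaler1 ?scaler0 ?addr0; rewrite -?[_ *: _]/(_ * _); field.
  - by rewrite a2pi.1 mulr0 cos0.
case: k => [[|n]|n].
- rewrite eqxx; apply: eqcP => /=.
    transitivity (\int[lambda]_z (1 : R)); first exact: eq_Rintegral.
    by rewrite Rintegral_cst // [X in fine X](@circle_measureT R) mulr1.
  by rewrite /Rintegral integral0_eq.
- exact: pos.
have -> : cintegral lambda (fun z => (z : R[i]) ^ Negz n) =
    Num.conj (cintegral lambda (fun z => (z : R[i]) ^+ n.+1)).
  rewrite -cintegralJ; last exact: (cintegrable_circleX n.+1).
  by apply: eq_cintegral => z; rewrite (circle_conjX z n.+1) NegzE.
by rewrite pos conjE conjc0.
Qed.

End CircleFourier.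

(** * Uniform approximation by Fejer means *)

Section Fejer.
Context {R : realType}.
Local Notation T := (circle R).
Local Notation lambda := (@circle_measure R).

Lemma circle_nbhs_mod (z : T) (A : set T) : nbhs z A ->
  exists2 d : R, 0 < d & forall v : T, mod ((circle_val v) - (circle_val z)) < d -> A v.
Proof.
move=> [_ [[B oB <-] Bz sBA]].
have /nbhs_ballP[e e0 eB] : nbhs (\val z : R[i]^o) B by exact: open_nbhs_nbhs.
have e0' : 0 < e by [].
move: (e0'); rewrite ltcE /= => /andP[/eqP e1 e2].
exists (Re e) => // v vz; apply: sBA => /=; apply: eB.
rewrite -ball_normE /= (_ : e = (Re e)%:C); last exact: eqcP.
by rewrite modC ltcR -modN opprB.
Qed.

(** The circle is the image of a segment under [expi]. *)
Lemma circle_compact : compact [set: T].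
Proof.
have -> : [set: T] = (@expi R) @` `[0, 2 * pi].
  apply/seteqP; split => // z _; have z1 : Re (circle_val z) ^+ 2 + Im (circle_val z) ^+ 2 = 1.
    by rewrite -mod_sqr circle_mod expr1n.
  have inj (u v : T) : (u : R[i]) = v -> u = v by exact: val_inj.
  move: z1; set a := Re _; set b := Im _ => ab1.
  have p0 := pi_ge0 R.
  have a1 : -1 <= a <= 1 by have := sqr_ge0 b; nra.
  have a1' : a \in `[-1, 1] by rewrite in_itv.
  have bE : Num.sqrt (1 - a ^+ 2) = `|b| by rewrite -ab1 addrAC subrr add0r sqrtr_sqr.
  have [t0 t1] : 0 <= acos a /\ acos a <= pi by split; [exact: acos_ge0|exact: acos_lepi].
  have [b0|b0] := leP 0 b.
    exists (acos a); first by rewrite /= in_itv /= t0; lra.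
    apply: inj; apply: eqcP; rewrite /circle_val /=; first by rewrite acosK.
    by rewrite sin_acos // bE ger0_norm.
  exists (2 * pi - acos a); first by rewrite /= in_itv /=; apply/andP; split; lra.
  apply: inj; apply: eqcP; rewrite /circle_val /= mulr_natl.
    by rewrite cosB cos2pi sin2pi mul1r mul0r addr0 acosK.
  by rewrite sinB cos2pi sin2pi mul1r mul0r sub0r sin_acos // bE ltr0_norm // opprK.
apply: continuous_compact; last exact: segment_compact.
by apply: continuous_subspaceT; exact: continuous_expi.
Qed.

Section Continuous.
Variables (f : T -> R[i]^o) (cf : continuous f).

Lemma circle_continuous_at (z : T) (e : R) : 0 < e -> exists2 d : R, 0 < d &
  forall v : T, mod ((circle_val v) - (circle_val z)) < d -> mod (f v - f z) < e.
Proof.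
move=> e0; have e0' : 0 < e%:C :> R[i] by rewrite ltcR.
have h : \forall v \near z, `|f z - f v| < e%:C.
  by move/cvgrPdist_lt: (@cf z); apply.
have [d d0 hd] := circle_nbhs_mod h; exists d => // v /hd /=.
by rewrite modC ltcR -modN opprB.
Qed.

Lemma circle_nbhs_ball (z : T) (d : R) : 0 < d ->
  nbhs z [set v : T | mod ((circle_val v) - (circle_val z)) < d].
Proof.
move=> d0; have d0' : 0 < d%:C :> R[i] by rewrite ltcR.
have h : \forall v \near z, `|(circle_val z) - (circle_val v)| < d%:C.
  by move/cvgrPdist_lt: (@continuous_circle_val R z); apply.
by apply: filterS h => v; rewrite /= modC ltcR -modN opprB.
Qed.

Lemma circle_uniform_continuous (e : R) : 0 < e -> exists2 d : R, 0 < d &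
  forall z v : T, mod ((circle_val v) - (circle_val z)) < d -> mod (f v - f z) < e.
Proof.
move=> e0; have e20 : 0 < e / 2 by rewrite divr_gt0.
pose P (n : nat) (z : T) := forall v : T, mod ((circle_val v) - (circle_val z)) < n.+1%:R^-1 ->
  mod (f v - f z) < e.
have /compact_near_coveringP/(_ _ \oo P) := circle_compact.
case=> [z _|N _ hN].
  have [d d0 hd] := circle_continuous_at z e20.
  have d20 : 0 < d / 2 by rewrite divr_gt0.
  have [N hN] := inv_nat_small d20.
  exists ([set v : T | mod ((circle_val v) - (circle_val z)) < d / 2], [set n | (N <= n)%N]).
    by split; [exact: circle_nbhs_ball|exists N].
  move=> [x n] /= [xz Nn] v vx.
  have vz : mod ((circle_val v) - (circle_val z)) < d.
    rewrite -(subrKA (circle_val x)); apply: le_lt_trans (modD _ _) _.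
    by have := lt_trans vx (hN n Nn); lra.
  have xz' : mod ((circle_val x) - (circle_val z)) < d by lra.
  rewrite -(subrKA (f z)); apply: le_lt_trans (modD _ _) _.
  by have := hd v vz; have := hd x xz'; rewrite -[mod (f x - _)]modN opprB; lra.
exists N.+1%:R^-1; first by rewrite invr_gt0.
by move=> z v; exact: (hN N (leqnn N) z I).
Qed.

Lemma circle_bounded : exists C : R, cbounded C f.
Proof.
pose P (n : nat) (z : T) := mod (f z) <= n%:R.
have /compact_near_coveringP/(_ _ \oo P) := circle_compact.
case=> [z _|N _ hN]; last by exists N%:R => z; exact: (hN N (leqnn N) z I).
have [d d0 hd] := circle_continuous_at z ltr01.
pose N := Num.trunc (mod (f z) + 1).
exists ([set v : T | mod ((circle_val v) - (circle_val z)) < d], [set n | (N.+1 <= n)%N]).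
  by split; [exact: circle_nbhs_ball|exists N.+1].
move=> [x n] /= [/hd xz Nn]; rewrite /P.
have h1 : mod (f z) + 1 < N.+1%:R by apply: truncnS_gt.
have h2 : N.+1%:R <= n%:R :> R by rewrite ler_nat.
have := modD (f x - f z) (f z); rewrite subrK; lra.
Qed.

Definition fourier_coef (k : int) : R[i] :=
  cintegral lambda (fun w => f w * (w : R[i]) ^ (- k)).

(** The double sum contains the coefficient of index k once for each pair with
    a - b = k, that is N + 1 - |k| times: the usual Fejer weights. *)
Definition fejer_mean (N : nat) (z : T) : R[i] :=
  (N.+1%:R^-1)%:C * \sum_(a < N.+1) \sum_(b < N.+1)
    fourier_coef (a%:Z - b%:Z) * (circle_val z) ^ (a%:Z - b%:Z).

Definition fejer_kernel (N : nat) (z w : T) : R :=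
  N.+1%:R^-1 * mod (\sum_(a < N.+1) ((circle_val z) * Num.conj (circle_val w)) ^+ a) ^+ 2.

Lemma fejer_kernelE N z w : (fejer_kernel N z w)%:C = (N.+1%:R^-1)%:C *
  \sum_(a < N.+1) \sum_(b < N.+1)
    (circle_val z) ^ (a%:Z - b%:Z) * (circle_val w) ^ (- (a%:Z - b%:Z)).
Proof.
rewrite /fejer_kernel rmorphM; congr (_ * _).
rewrite rmorphXn /= -modC sqr_normc -conjE rmorph_sum mulr_suml.
apply: eq_bigr => a _; rewrite mulr_sumr; apply: eq_bigr => b _.
have z0 := circle_neq0 z; have w0 := circle_neq0 w.
have e (v : T) k : Num.conj (circle_val v) ^+ k = Num.conj (circle_val v ^+ k).
  exact: esym (rmorphXn (@Num.conj R[i]) k (circle_val v)).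
rewrite opprB !expfzDr // -!circle_conjX -!exprnP !exprMn !e rmorphM /= conjCK.
by move: (Num.conj _) (Num.conj _) => zb wa; ring.
Qed.

Lemma fejer_kernel_ge0 N z w : 0 <= fejer_kernel N z w.
Proof. by rewrite mulr_ge0 ?invr_ge0 ?sqr_ge0. Qed.

(** The geometric sum of u = z / w is at most 2 / |u - 1|. *)
Lemma fejer_kernel_far N z w (d : R) : 0 < d -> d <= mod ((circle_val w) - (circle_val z)) ->
  fejer_kernel N z w <= N.+1%:R^-1 * (4 / d ^+ 2).
Proof.
move=> d0 dzw; rewrite ler_pM2l ?invr_gt0 //.
set u := (circle_val z) * Num.conj (circle_val w).
have u1 : mod u = 1 by rewrite modM modJ !circle_mod mulr1.
have mu1 : mod (u - 1) = mod ((circle_val w) - (circle_val z)).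
  rewrite -(circle_mulJ w) -mulrBl modM modJ circle_mod mulr1.
  by rewrite -modN opprB.
have := congr1 (@mod R) (subrX1 u N.+1); rewrite modM mu1.
have : mod (u ^+ N.+1 - 1) <= 2.
  apply: le_trans (modD _ _) _; rewrite modN.
  rewrite mod1.
  have -> : mod (u ^+ N.+1) = 1; last by lra.
  have e (n : nat) : mod (u ^+ n) = 1.
    elim: n => [|n IH]; first by rewrite expr0 mod1.
    by rewrite exprS modM [mod u]u1 IH mulr1.
  exact: e.
set S := \sum_(a < _) _ => h1 h2.
have S0 := mod_ge0 S.
have dS : d * mod S <= 2.
  by apply: le_trans h1; rewrite h2 ler_wpM2r.
rewrite ler_pdivlMr ?exprn_gt0 //.
have : (d * mod S) ^+ 2 <= 2 ^+ 2.
  by rewrite ler_pXn2r ?nnegrE ?mulr_ge0 ?(ltW d0).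
rewrite exprMn; lra.
Qed.

Let lambda_finite : (lambda setT < +oo)%E.
Proof. by rewrite [X in (X < _)%E]circle_measureT ltry. Qed.

Let cintX (k : int) : cintegrable lambda (fun z => (circle_val z) ^ k) := cintegrable_circleX k.

Lemma fejer_kernel_cintegrable N z : cintegrable lambda (fun w => (fejer_kernel N z w)%:C).
Proof.
apply: (eq_cintegrable (fun w => esym (fejer_kernelE N z w))).
apply: cintegrableZ; apply: cintegrable_sum => a _; apply: cintegrable_sum => b _.
exact: cintegrableZ.
Qed.

Lemma fejer_kernel_cintegral N z :
  cintegral lambda (fun w => (fejer_kernel N z w)%:C) = 1.
Proof.
rewrite (eq_cintegral _ (fejer_kernelE N z)) cintegralZ; last first.
  apply: cintegrable_sum => a _; apply: cintegrable_sum => b _; exact: cintegrableZ.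
rewrite cintegral_sum; last first.
  by move=> a _; apply: cintegrable_sum => b _; exact: cintegrableZ.
transitivity ((N.+1%:R^-1)%:C * \sum_(a < N.+1) (1 : R[i])).
  congr (_ * _); apply: eq_bigr => a _.
  rewrite cintegral_sum; last by move=> b _; exact: cintegrableZ.
  rewrite (bigD1 a) //= cintegralZ // circle_fourier subrr oppr0 eqxx expr0z mulr1.
  rewrite big1 ?addr0 // => b ba; rewrite cintegralZ // circle_fourier oppr_eq0 subr_eq0.
  by rewrite eqz_nat eq_sym (negbTE ba : (val b == val a) = false) mulr0.
by rewrite sumr_const card_ord fmorphV rmorph_nat mulVf //.
Qed.

Let mf : cmeasurable f := continuous_cmeasurable cf.

Lemma fejer_meanE N z : fejer_mean N z =
  cintegral lambda (fun w => f w * (fejer_kernel N z w)%:C).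
Proof.
have [C bf] := circle_bounded.
have int1 (k : int) : cintegrable lambda (fun w => f w * (circle_val w) ^ k).
  exact: cintegrableM mf bf (cintX k).
pose G (a b : 'I_N.+1) w := (circle_val z) ^ (a%:Z - b%:Z) *
  (f w * (circle_val w) ^ (- (a%:Z - b%:Z))).
have iG a b : cintegrable lambda (G a b) by exact: cintegrableZ.
transitivity (cintegral lambda (fun w => (N.+1%:R^-1)%:C *
    \sum_(a < N.+1) \sum_(b < N.+1) G a b w)).
  rewrite cintegralZ; last first.
    by apply: cintegrable_sum => a _; exact: cintegrable_sum.
  congr (_ * _); rewrite cintegral_sum; last by move=> a _; exact: cintegrable_sum.
  apply: eq_bigr => a _; rewrite cintegral_sum //; apply: eq_bigr => b _.
  by rewrite cintegralZ // mulrC.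
apply: eq_cintegral => w; rewrite fejer_kernelE mulrCA; congr (_ * _).
rewrite mulr_sumr; apply: eq_bigr => a _; rewrite mulr_sumr; apply: eq_bigr => b _.
by rewrite mulrCA.
Qed.

(** Fejer: the kernel is an approximate identity, by orthogonality of the
    characters and by its decay away from the diagonal. *)
Lemma fejer (e : R) : 0 < e -> exists N, forall z, mod (f z - fejer_mean N z) < e.
Proof.
move=> e0; have [C bf] := circle_bounded.
have C0 := cbounded_ge0 bf.
have e20 : 0 < e / 2 by rewrite divr_gt0.
have [d d0 hd] := circle_uniform_continuous e20.
pose D := 2 * C * (4 / d ^+ 2) + 1.
have D0 : 0 < D.
  by rewrite ltr_wpDl // !mulr_ge0 // invr_ge0 exprn_ge0 // ltW.
have eD : 0 < e / 2 / D by rewrite divr_gt0.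
have [N hN] := inv_nat_small eD; exists N => z.
have intK := fejer_kernel_cintegrable N z.
have -> : f z - fejer_mean N z =
    cintegral lambda (fun w => (f z - f w) * (fejer_kernel N z w)%:C).
  rewrite fejer_meanE -[X in X - _ = _]mulr1 -[X in _ * X - _](fejer_kernel_cintegral N z) -cintegralZ //.
  rewrite -mulN1r -cintegralZ; last exact: cintegrableM mf bf intK.
  rewrite -cintegralD; last 2 first.
  - exact: cintegrableZ.
  - by apply: cintegrableZ; exact: cintegrableM mf bf intK.
  by apply: eq_cintegral => w; rewrite mulrBl mulN1r.
have iK : lambda.-integrable setT (EFin \o fejer_kernel N z) := intK.1.
have K1 : \int[lambda]_w fejer_kernel N z w = 1.
  by have := congr1 (@complex.Re R) (fejer_kernel_cintegral N z).
have int1 : lambda.-integrable setT (EFin \o (fun=> N.+1%:R^-1 * D : R)).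
  apply: measurable_bounded_integrable => //.
  exists (N.+1%:R^-1 * D); split; rewrite ?num_real // => r r1 w _ /=.
  by rewrite ger0_norm ?mulr_ge0 ?invr_ge0 // ltW.
have bound w : mod ((f z - f w) * (fejer_kernel N z w)%:C) <=
    e / 2 * fejer_kernel N z w + N.+1%:R^-1 * D.
  have K0 := fejer_kernel_ge0 N z w.
  rewrite modM mod_real ger0_norm //.
  have ND : 0 <= N.+1%:R^-1 * D by rewrite mulr_ge0 ?invr_ge0 // ltW.
  have [far|near] := leP d (mod ((circle_val w) - (circle_val z))).
    have h1 := fejer_kernel_far N d0 far.
    have h2 : mod (f z - f w) <= 2 * C.
      by apply: le_trans (modD _ _) _; rewrite modN; have := bf z; have := bf w; lra.
    have h3 : mod (f z - f w) * fejer_kernel N z w <= 2 * C * (N.+1%:R^-1 * (4 / d ^+ 2)).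
      by apply: ler_pM; rewrite ?mod_ge0.
    have h4 : 0 <= e / 2 * fejer_kernel N z w by rewrite mulr_ge0 // ltW.
    have h5 : 0 <= N.+1%:R^-1 :> R by rewrite invr_ge0.
    have -> : N.+1%:R^-1 * D = 2 * C * (N.+1%:R^-1 * (4 / d ^+ 2)) + N.+1%:R^-1.
      by rewrite /D mulrDr mulr1; ring.
    by move: (N.+1%:R^-1) h3 h5 => a h3 h5; lra.
  have := hd z w near; rewrite -[mod (f w - _)]modN opprB => h.
  apply: le_trans (_ : e / 2 * fejer_kernel N z w <= _); last by rewrite lerDl.
  by rewrite ler_wpM2r // ltW.
apply: le_lt_trans (cintegral_le _ _ bound) _.
- have bf2 : cbounded (C + C) (fun w => f z - f w).
    by move=> w; apply: le_trans (modD _ _) _; rewrite modN lerD.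
  apply: cintegrableM bf2 intK.
  apply: cmeasurableD; first exact: cmeasurable_cst.
  apply: (eq_cmeasurable (fun w => mulN1r (f w))).
  exact: (cmeasurableM (cmeasurable_cst _) mf).
- exact: (integrableD measurableT (integrableZl measurableT (e / 2) iK) int1).
rewrite RintegralD //; last exact: (integrableZl measurableT (e / 2) iK).
rewrite RintegralZl // K1 mulr1 Rintegral_cst // [X in fine X](@circle_measureT R) /= mulr1.
have := hN N (leqnn N); rewrite ltr_pdivlMr //; move: (N.+1%:R^-1 * D) => t; lra.
Qed.

End Continuous.
End Fejer.

(** * Block Toeplitz matrices and the companion operator *)

Section ToeplitzSequences.
Context {R : realType} {H : hilbertType R}.
Implicit Types (s : int -> bop H) (m : nat).

(** The objects attached to mu as functions of the moment sequence alone: for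
    s = moment mu, [toep], [toep_col], [kap] and [Phi] are convertible to [toeplitzR],
    [nu], [kappaR] and [PhiR]. *)
Definition toep s m : 'M[bop H]_m := \matrix_(j, k) s (j%:Z - k%:Z).

Definition toep_col s m : 'cV[bop H]_m := \col_j s (j%:Z - m%:Z).

(** The coefficients of the orthogonal projection of z^m on the polynomials of
    lower degree. *)
Definition toep_coef s m : 'cV[bop H]_m := inverse_mx (toep s m) *m toep_col s m.

Definition kap s m : bop H :=
  s 0 - (adjoint_mx (toep_col s m) *m inverse_mx (toep s m) *m toep_col s m) 0 0.

Definition Phi s m (z : R[i]) : bop H := z ^+ m *: (1 : bop H) -
  ((\row_(j < m) (z ^+ j *: (1 : bop H))) *m inverse_mx (toep s m) *m toep_col s m) 0 0.

Definition hermitian_seq s := forall j, adjoint (s j) = s (- j).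

Definition posdef_seq s := forall m, (0 < m)%N -> posdef_opmx (toep s m).

Lemma toep_adjoint s m : hermitian_seq s -> adjoint_mx (toep s m) = toep s m.
Proof. by move=> hs; apply/matrixP => j k; rewrite adjoint_mxE !mxE hs opprB. Qed.

Lemma toep_invertible s m : posdef_seq s -> @invertible 'M[bop H]_m (toep s m).
Proof.
move=> ps; case: m => [|m]; last by have [] := ps m.+1 isT.
by exists 0; split; apply/matrixP => -[].
Qed.

(** The coefficients are characterized by the normal equations; this identifies them
    when a solution is known ([Phi_recursion]). *)
Lemma toep_coefE s m (c : 'cV[bop H]_m) : posdef_seq s ->
  toep s m *m c = toep_col s m <-> c = toep_coef s m.
Proof.
move=> ps; have [h1 h2] := inverseP (toep_invertible m ps).
split=> [h|->].
  by rewrite /toep_coef -h mulmxA mulmxE [inverse_mx _ * _]h2 mul1mx.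
by rewrite /toep_coef mulmxA mulmxE [_ * inverse_mx _]h1 mul1mx.
Qed.

End ToeplitzSequences.

Section Companion.
Context {R : realType} {H : hilbertType R}.
Variables (s : int -> bop H) (n : nat).
Hypotheses (hs : hermitian_seq s) (ps : posdef_seq s).

Local Notation T := (toep s n.+1).
Local Notation kappa := (kap s n).
Implicit Types (f g : 'cV[H]_n.+1) (x y : H).

(** Indexing the coefficients by natural numbers, with value 0 out of range, avoids
    casts between ordinals. *)
Definition cn (l : nat) : bop H := if insub l is Some i then toep_coef s n i 0 else 0.

Lemma cnE (i : 'I_n) : cn i = toep_coef s n i 0.
Proof. by rewrite /cn valK. Qed.

Lemma cn_orth i : (i < n)%N ->
  \sum_(l < n) s (i%:Z - l%:Z) * cn l = s (i%:Z - n%:Z).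
Proof.
move=> ni; have /matrixP/(_ (Ordinal ni) 0) := (toep_coefE (toep_coef s n) ps).2 erefl.
rewrite !mxE /= => <-; apply: eq_bigr => l _.
by rewrite cnE !mxE.
Qed.

Lemma cn_kappa : s 0 - \sum_(l < n) s (n%:Z - l%:Z) * cn l = kappa.
Proof.
rewrite /kap -mulmxA [X in _ = _ - X]mxE; congr (_ - _); apply: eq_bigr => l _.
by rewrite cnE adjoint_mxE [toep_col _ _ _ _]mxE hs opprB.
Qed.

(* so that simplification does not unfold the matrix product in kap *)
Opaque kap.

(** Natural number indices, so that shifts of coordinates need no casts. *)
Definition crd (f : 'cV[H]_n.+1) (j : nat) : H := f (inord j) 0.

Definition vec (u : nat -> H) : 'cV[H]_n.+1 := \col_j u j.

Lemma crd_vec u j : (j < n.+1)%N -> crd (vec u) j = u j.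
Proof. by move=> jn; rewrite /crd mxE inordK. Qed.

Lemma crd_ord f (i : 'I_n.+1) : f i 0 = crd f i.
Proof. by rewrite /crd inord_val. Qed.

Lemma crdP f g : (forall j, (j < n.+1)%N -> crd f j = crd g j) -> f = g.
Proof. by move=> h; apply/colP => i; rewrite !crd_ord h. Qed.

Lemma crdD f g j : crd (f + g) j = crd f j + crd g j.
Proof. by rewrite /crd mxE. Qed.

Lemma crd_scale a f j : crd (vscale a f) j = a *: crd f j.
Proof. by rewrite /crd mxE. Qed.

Lemma cvdot_crd f g : cvdot f g = \sum_(i < n.+1) '[crd f i, crd g i].
Proof. by apply: eq_bigr => i _; rewrite !crd_ord. Qed.

Lemma cnrm2_crd f : cnrm2 f = \sum_(i < n.+1) nrm (crd f i) ^+ 2.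
Proof. by apply: eq_bigr => i _; rewrite crd_ord. Qed.

Lemma crd_toep f j : (j < n.+1)%N ->
  crd (mxapp T f) j = \sum_(k < n.+1) s (j%:Z - k%:Z) (crd f k).
Proof.
move=> jn; rewrite /crd mxappE; apply: eq_bigr => k _.
by rewrite mxE inordK // inord_val.
Qed.

(** Multiplication by z followed by reduction modulo z Phi_n, on polynomials of
    degree at most n: multiplication by z after the orthogonal projection on
    degree less than n. *)
Definition companion : 'M[bop H]_n.+1 := \matrix_(j, k)
  if k == n :> nat then (if j : nat is j'.+1 then cn j' else 0)
  else if j == k.+1 :> nat then 1 else 0.

Lemma crd_companion0 f : crd (mxapp companion f) 0 = 0.
Proof.
rewrite /crd mxappE big1 // => k _; rewrite mxE inordK //=.
by case: ifP.
Qed.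

Lemma crd_companionS f j : (j < n)%N ->
  crd (mxapp companion f) j.+1 = crd f j + cn j (crd f n).
Proof.
move=> jn; rewrite {1}/crd mxappE big_ord_recr /= mxE eqxx inordK // crd_ord /=; congr (_ + _).
rewrite (bigD1 (Ordinal jn)) //= mxE /= inordK // eqxx ltn_eqF // crd_ord /=.
rewrite big1 ?addr0 // => k kj.
by rewrite mxE /= inordK // ltn_eqF // eqSS eq_sym (negbTE kj : (val k == j) = false).
Qed.

Definition proj_vec f := vec (fun j => if j == n then 0 else crd f j + cn j (crd f n)).

(** The coefficients of Phi_n x. *)
Definition Phi_vec x := vec (fun j => if j == n then x else - cn j x).

Lemma proj_vecK f : f = proj_vec f + Phi_vec (crd f n).
Proof.
apply: crdP => j jn; rewrite crdD !crd_vec //.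
by case: eqP => [->|_]; rewrite ?add0r // addrK.
Qed.

(** The polynomial Phi_n is orthogonal to lower degrees, and kappa is its square
    norm. *)
Lemma crd_toep_Phi x j : (j < n.+1)%N ->
  crd (mxapp T (Phi_vec x)) j = if j == n then kappa x else 0.
Proof.
move=> jn; rewrite crd_toep // big_ord_recr /= crd_vec // eqxx.
have -> : \sum_(i < n) s (j%:Z - i%:Z) (crd (Phi_vec x) i) =
    - (\sum_(l < n) s (j%:Z - l%:Z) * cn l) x.
  rewrite bop_suml -sumrN; apply: eq_bigr => l _.
  by rewrite crd_vec ?ltn_eqF // ?bopN // ltnS ltnW.
case: eqP => [->|/eqP jn'].
  by rewrite -cn_kappa bop_subE subrr addrC.
rewrite cn_orth ?addNr // ltn_neqAle jn'; exact: jn.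
Qed.

Lemma cvdot_toep_Phi x g : cvdot (mxapp T (Phi_vec x)) g = '[kappa x, crd g n].
Proof.
rewrite cvdot_crd big_ord_recr /= crd_toep_Phi // eqxx big1 ?add0r // => i _.
by rewrite crd_toep_Phi ?ltn_eqF ?hdot0l // ltnS ltnW.
Qed.

Lemma toep_selfadjoint f g : cvdot (mxapp T f) g = cvdot f (mxapp T g).
Proof. by rewrite cvdot_adjoint toep_adjoint. Qed.

Lemma kappa_adjoint : adjoint kappa = kappa.
Proof.
apply: adjoint_unique => x y.
have e u : crd (Phi_vec u) n = u by rewrite crd_vec // eqxx.
rewrite -{1}[y]e -cvdot_toep_Phi toep_selfadjoint cvdotC cvdot_toep_Phi e.
by rewrite -hdotC.
Qed.

(** The companion operator is [proj_vec] followed by the shift of coordinates, and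
    the Toeplitz form is invariant under shifts. *)
Lemma toep_companion_proj f g :
  cvdot (mxapp T (mxapp companion f)) (mxapp companion g) =
  cvdot (mxapp T (proj_vec f)) (proj_vec g).
Proof.
rewrite !cvdot_crd big_ord_recl big_ord_recr /= crd_companion0 hdot0r add0r.
rewrite crd_vec // eqxx hdot0r addr0; apply: eq_bigr => j _.
have jn : (j < n.+1)%N by rewrite ltnS ltnW.
rewrite -[bump 0 j]/j.+1 crd_companionS // crd_vec // ltn_eqF //; congr ('[_, _]).
have jn' : (j.+1 < n.+1)%N by rewrite ltnS.
rewrite (crd_toep _ jn') (crd_toep _ jn) big_ord_recl big_ord_recr /= crd_companion0 bop0 add0r.
rewrite crd_vec // eqxx bop0 addr0; apply: eq_bigr => k _.
rewrite -[bump 0 k]/k.+1 crd_companionS // crd_vec ?ltn_eqF //; last by rewrite ltnS ltnW.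
by rewrite !intS opprD addrACA subrr add0r.
Qed.

(** Stein equation. By [proj_vecK] a polynomial is its projection plus Phi_n times
    its top coefficient, which are orthogonal for T; the companion operator forgets
    the second part, and is isometric on the first. *)
Lemma stein f g : cvdot (mxapp T (mxapp companion f)) (mxapp companion g) =
  cvdot (mxapp T f) g - '[kappa (crd f n), crd g n].
Proof.
rewrite toep_companion_proj {2}(proj_vecK f) mxappDr cvdotDl cvdot_toep_Phi addrK.
rewrite [in RHS](proj_vecK g) cvdotDr (toep_selfadjoint _ (Phi_vec _)).
rewrite [X in _ + X]cvdotC cvdot_toep_Phi.
by rewrite crd_vec // eqxx hdot0r conjC0 addr0.
Qed.

(** kappa is the Toeplitz form on the polynomials Phi_n x, whose top coefficient is x. *)
Lemma kappa_coercive : exists2 k : R, 0 < k & forall x, k * nrm x ^+ 2 <= Re '[kappa x, x].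
Proof.
have [c c0 hc] := posdef_opmx_coercive (toep_adjoint n.+1 hs) (ps (ltn0Sn n)).
exists c => // x; have := hc (Phi_vec x).
rewrite cvdot_toep_Phi crd_vec // eqxx; apply: le_trans.
rewrite ler_pM2l // cnrm2_crd big_ord_recr /= crd_vec // eqxx lerDr.
by apply: sumr_ge0 => i _; rewrite sqr_ge0.
Qed.

Lemma cn_bounded : exists2 K : R, 0 < K &
  forall j x, (j < n)%N -> nrm (cn j x) ^+ 2 <= K * nrm x ^+ 2.
Proof.
have [K K0 hK] := mxapp_bounded (toep_coef s n).
exists K => // j x jn; have := hK (\col_(i < 1) x).
have -> : cnrm2 (\col_(i < 1) x) = nrm x ^+ 2 by rewrite /cnrm2 big_ord1 mxE.
apply: le_trans; apply: le_trans (cnrm2_coord _ (Ordinal jn)).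
by rewrite mxappE big_ord1 mxE -cnE.
Qed.

Lemma nrm_sqrD_ge x y (t : R) : 0 < t ->
  (1 - t) * nrm x ^+ 2 - t^-1 * nrm y ^+ 2 <= nrm (x + y) ^+ 2.
Proof.
move=> t0; rewrite nrm_sqrD.
have h1 : - (nrm x * nrm y) <= Re '[x, y].
  by have := Re_hdot_le (- x) y; rewrite hdotNl cReN nrmN; lra.
have h2 : 2 * (nrm x * nrm y) <= t * nrm x ^+ 2 + t^-1 * nrm y ^+ 2.
  have tt : t * t^-1 = 1 by rewrite mulfV // gt_eqF.
  have s0 : 0 < t^-1 by rewrite invr_gt0.
  move: (t^-1) tt s0 => u tu u0.
  have := mulr_ge0 (ltW u0) (sqr_ge0 (t * nrm x - nrm y)).
  have -> : u * (t * nrm x - nrm y) ^+ 2 =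
    (t * u) * t * nrm x ^+ 2 - 2 * (t * u) * (nrm x * nrm y) + u * nrm y ^+ 2 by ring.
  by rewrite tu; lra.
have := sqr_ge0 (nrm y); lra.
Qed.

Definition weight f : R := \sum_(j < n.+1) j%:R * nrm (crd f j) ^+ 2.

(** The shift raises the weight of every coordinate by one; the perturbation by [cn]
    only involves the last coordinate, and cross terms are absorbed by the gain. *)
Lemma weight_companion : exists K : R, forall f,
  2^-1 * cnrm2 f - K * nrm (crd f n) ^+ 2 <=
    weight (mxapp companion f) - weight f.
Proof.
have [Kc Kc0 hKc] := cn_bounded.
pose N : R := n.+1%:R; have N0 : 0 < N by rewrite ltr0n.
pose L := 2 * N * N * Kc.
exists (\sum_(j < n) L + n%:R + 2^-1) => f.
have -> : weight (mxapp companion f) =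
    \sum_(j < n) j.+1%:R * nrm (crd (mxapp companion f) j.+1) ^+ 2.
  by rewrite /weight big_ord_recl /= mul0r add0r.
rewrite cnrm2_crd /weight !big_ord_recr /=.
set fn := nrm (crd f n) ^+ 2.
have h j : (j < n)%N -> 2^-1 * nrm (crd f j) ^+ 2 - L * fn + j%:R * nrm (crd f j) ^+ 2 <=
    j.+1%:R * nrm (crd (mxapp companion f) j.+1) ^+ 2.
  move=> jn; rewrite crd_companionS //.
  have t0 : 0 < (2 * N)^-1 by rewrite invr_gt0 mulr_gt0.
  have := nrm_sqrD_ge (crd f j) (cn j (crd f n)) t0; rewrite invrK.
  have := hKc j (crd f n) jn; rewrite -/fn.
  have jN : j.+1%:R <= N :> R by rewrite ler_nat ltnS ltnW.
  have j0 : 0 < j.+1%:R :> R by rewrite ltr0n.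
  have jS : j.+1%:R = j%:R + 1 :> R by rewrite -natr1.
  have fn0 : 0 <= fn by rewrite sqr_ge0.
  have u1 : (2 * N)^-1 * N = 2^-1 by rewrite invfM mulfVK // gt_eqF.
  move: ((2 * N)^-1) t0 u1 => u u0 u1.
  move: (nrm (crd f j) ^+ 2) (sqr_ge0 (nrm (crd f j))) => a a0.
  move: (nrm (cn j _) ^+ 2) (sqr_ge0 (nrm (cn j (crd f n)))) => b b0.
  move: (nrm _ ^+ 2) => d bK hd.
  move: (j.+1%:R) jS jN j0 hd => J jS jN J0 hd.
  have jE : j%:R = J - 1 by rewrite jS addrK.
  rewrite jE; apply: le_trans (_ : J * ((1 - u) * a - 2 * N * b) <= _); last first.
    by rewrite ler_pM2l.
  have e1 : J * u * a <= 2^-1 * a.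
    by rewrite ler_wpM2r // -u1 mulrC ler_wpM2l // ltW.
  have e2 : 2 * N * (J * b) <= 2 * N * (N * (Kc * fn)).
    rewrite ler_wpM2l ?mulr_ge0 ?(ltW N0) //.
    by apply: ler_pM => //; exact: ltW.
  rewrite /L; lra.
have hs' : \sum_(j < n) (2^-1 * nrm (crd f j) ^+ 2 - L * fn + j%:R * nrm (crd f j) ^+ 2) <=
    \sum_(j < n) j.+1%:R * nrm (crd (mxapp companion f) j.+1) ^+ 2.
  by apply: ler_sum => j _; exact: h.
move: hs'; rewrite big_split sumrB /=.
have -> : \sum_(j < n) L * fn = (\sum_(j < n) L) * fn by rewrite mulr_suml.
have -> : \sum_(j < n) 2^-1 * nrm (crd f j) ^+ 2 = 2^-1 * \sum_(j < n) nrm (crd f j) ^+ 2.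
  by rewrite mulr_sumr.
move: (\sum_(j < n) L) (\sum_(j < n) nrm (crd f j) ^+ 2) => a b.
move: (\sum_(j < n) _) (\sum_(j < n) _) => x y; lra.
Qed.

Lemma weight_le f : weight f <= n%:R * cnrm2 f.
Proof.
rewrite cnrm2_crd mulr_sumr; apply: ler_sum => j _.
by rewrite ler_wpM2r ?sqr_ge0 // ler_nat -ltnS.
Qed.

Definition weight_mx (d : R) : 'M[bop H]_n.+1 :=
  \matrix_(j, k) if j == k then (d * j%:R)%:C *: (1 : bop H) else 0.

Lemma cvdot_weight_mx d f g : cvdot (mxapp (weight_mx d) f) g =
  \sum_(j < n.+1) (d * j%:R)%:C * '[crd f j, crd g j].
Proof.
rewrite cvdot_crd; apply: eq_bigr => j _; rewrite -!crd_ord mxappE.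
rewrite (bigD1 j) //= mxE eqxx big1 ?addr0 => [|k kj].
  by rewrite bop_scaleE hdotZl.
by rewrite mxE eq_sym (negbTE kj).
Qed.

(** A strict Lyapunov function for the companion operator: the Stein equation
    only controls the last coordinate, and subtracting a small multiple of the
    diagonal matrix with entries 0, ..., n, which the shift increases, controls
    the others. *)
Lemma lyapunov : exists P : 'M[bop H]_n.+1, exists p e : R, [/\ 0 < p, 0 < e,
  forall f g, cvdot (mxapp P f) g = cvdot f (mxapp P g),
  forall f, p * cnrm2 f <= Re (cvdot (mxapp P f) f) &
  forall f, e * cnrm2 f <= Re (cvdot (mxapp P f) f) -
    Re (cvdot (mxapp P (mxapp companion f)) (mxapp companion f))].
Proof.
have [c c0 hc] := posdef_opmx_coercive (toep_adjoint n.+1 hs) (ps (ltn0Sn n)).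
have [k k0 hk] := kappa_coercive.
have [K0 hK0] := weight_companion.
pose K := Num.max K0 1.
have Kp : 0 < K by rewrite lt_max ltr01 orbT.
have hK f : 2^-1 * cnrm2 f - K * nrm (crd f n) ^+ 2 <=
    weight (mxapp companion f) - weight f.
  apply: le_trans (hK0 f); rewrite lerD2l lerN2 ler_wpM2r ?sqr_ge0 //.
  by rewrite le_max lexx.
pose N : R := n.+1%:R; have N0 : 0 < N by rewrite ltr0n.
pose d := Num.min (k / K) (c / (2 * N)).
have d0 : 0 < d by rewrite lt_min !divr_gt0 // mulr_gt0.
have dK : d * K <= k by rewrite -ler_pdivlMr // ge_min lexx.
have dN : d * n%:R <= c / 2.
  have nN : n%:R <= N :> R by rewrite ler_nat.
  apply: le_trans (_ : d * N <= _); first by rewrite ler_pM2l.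
  by rewrite -ler_pdivlMr // -mulrA -invfM ge_min lexx orbT.
exists (T - weight_mx d), (c / 2), (d / 2).
have PE f : Re (cvdot (mxapp (T - weight_mx d) f) f) =
    Re (cvdot (mxapp T f) f) - d * weight f.
  rewrite mxappBl cvdotDl cvdotNl cvdot_weight_mx cReB; congr (_ - _).
  rewrite Re_sum /weight mulr_sumr; apply: eq_bigr => j _.
  by rewrite cReZ Re_hdotxx -mulrA.
split.
- by rewrite divr_gt0.
- by rewrite divr_gt0.
- move=> f g; rewrite mxappBl mxappBl cvdotDl cvdotDr cvdotNl cvdotNr toep_selfadjoint.
  congr (_ - _); rewrite [RHS]cvdotC !cvdot_weight_mx cconj_sum; apply: eq_bigr => j _.
  by rewrite cconjM cconj_real -hdotC.
- move=> f; rewrite PE; have := hc f; have := weight_le f; have := cnrm2_ge0 f => h1 h2 h3.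
  have h4 : d * weight f <= d * n%:R * cnrm2 f by rewrite -mulrA ler_pM2l.
  have h5 : d * n%:R * cnrm2 f <= c / 2 * cnrm2 f by rewrite ler_wpM2r.
  lra.
move=> f; rewrite !PE stein cReB.
have h1 := hk (crd f n); have h2 := hK f.
have h3 : d * (2^-1 * cnrm2 f - K * nrm (crd f n) ^+ 2) <=
  d * (weight (mxapp companion f) - weight f) by rewrite ler_pM2l.
have h4 : d * K * nrm (crd f n) ^+ 2 <= k * nrm (crd f n) ^+ 2.
  by rewrite ler_wpM2r ?sqr_ge0.
lra.
Qed.

End Companion.

(** * The resolvent of the companion operator on the circle *)

Lemma lipschitz_circle_continuous {R : realType} (h : circle R -> R[i]^o) (L : R) :
  (forall z v, mod (h z - h v) <= L * mod (circle_val z - circle_val v)) ->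
  continuous h.
Proof.
move=> hL z; apply/(@cvgrPdist_lt _ _ _ (nbhs (z : circle R))) => e; rewrite ltcE /= => /andP[/eqP e1 e2].
have L1 : 0 < `|L| + 1 by rewrite ltr_wpDl.
have d0 : 0 < Re e / (`|L| + 1) by rewrite divr_gt0.
apply: filterS (circle_nbhs_ball z d0) => v /=.
rewrite ltr_pdivlMr // => hv; rewrite (_ : e = (Re e)%:C); last exact: eqcP.
rewrite modC ltcR; apply: le_lt_trans (hL z v) _; apply: le_lt_trans hv.
rewrite -(modN (circle_val v - _)) opprB mulrC ler_wpM2l ?mod_ge0 //.
by apply: le_trans (ler_norm _) _; rewrite lerDl.
Qed.

Section Resolvent.
Context {R : realType} {H : hilbertType R}.
Variables (s : int -> bop H) (n : nat).
Hypotheses (hs : hermitian_seq s) (ps : posdef_seq s).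

Local Notation T := (toep s n.+1).
Local Notation A := (companion s n).
Local Notation kappa := (kap s n).
Implicit Types (f g : 'cV[H]_n.+1) (x y : H) (z v : circle R).

(** At z this is 1 - z^-1 A. *)
Definition resm z : 'M[bop H]_n.+1 :=
  1%:M - \matrix_(i, j) ((circle_val z)^-1 *: A i j).

Definition resolvent z : 'M[bop H]_n.+1 := inverse_mx (resm z).

Lemma mxapp_resm z f : mxapp (resm z) f = f - vscale (circle_val z)^-1 (mxapp A f).
Proof.
rewrite mxappBl mxapp1; congr (_ - _); apply/colP => i.
rewrite mxappE mxE mxappE scaler_sumr; apply: eq_bigr => k _.
by rewrite mxE.
Qed.

Lemma cvdot_circle_scale z f g :
  cvdot (vscale (circle_val z)^-1 f) (vscale (circle_val z)^-1 g) = cvdot f g.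
Proof.
rewrite cvdotZl cvdotZr mulrA circle_inv conjCK.
by rewrite [Num.conj _ * _]mulrC circle_mulJ mul1r.
Qed.

(** For a strict Lyapunov form P and y = f - z^-1 A f, expanding the form at
    z^-1 A f = f - y bounds Re <P y, f> from below, uniformly on the circle. *)
Lemma resm_coercive : exists P : 'M[bop H]_n.+1, exists p e : R, [/\ 0 < p, 0 < e,
  forall f, p * cnrm2 f <= Re (cvdot (mxapp P f) f) &
  forall z f, e * cnrm2 f <= Re (cvdot (mxapp (P *m resm z) f) f)].
Proof.
have [P [p [e [p0 e0 sP hP hA]]]] := lyapunov n hs ps.
exists P, p, (e / 2); split => //; first by rewrite divr_gt0.
move=> z f; set y := mxapp (resm z) f.
have Ay : vscale (circle_val z)^-1 (mxapp A f) = f - y.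
  by rewrite /y mxapp_resm opprB addrC subrK.
have := hA f; rewrite -(cvdot_circle_scale z (mxapp P (mxapp A f))) -mxappZr Ay.
rewrite mxappBr cvdotDl cvdotDr cvdotNl cvdotDr !cvdotNr !(cReD, cReN).
have := hP y; have := cnrm2_ge0 y; rewrite mxappM -/y.
rewrite (sP f y) (Re_cvdotC f) => h1 h2.
have : 0 <= p * cnrm2 y by rewrite mulr_ge0 // ltW.
lra.
Qed.

Lemma resm_inverse z : @is_inverse 'M[bop H]_n.+1 (resm z) (resolvent z).
Proof.
apply: inverseP.
have [P [p [e [p0 e0 hP hA]]]] := resm_coercive.
have [P' hP'] := coercive_mx_invertible p0 hP.
have [B' hB'] := coercive_mx_invertible e0 (hA z).
exists (B' * P); have -> : resm z = P' * (P * resm z).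
  by rewrite mulrA hP'.2 mul1r.
apply: is_inverseM => //; exact: is_inverse_sym.
Qed.

Lemma resolventK z f : mxapp (resolvent z) (mxapp (resm z) f) = f.
Proof. by rewrite -mxappM mulmxE (resm_inverse z).2 mxapp1. Qed.

Lemma resmK z f : mxapp (resm z) (mxapp (resolvent z) f) = f.
Proof. by rewrite -mxappM mulmxE (resm_inverse z).1 mxapp1. Qed.

Lemma resolvent_bounded : exists2 C : R, 0 < C &
  forall z f, cnrm2 (mxapp (resolvent z) f) <= C * cnrm2 f.
Proof.
have [P [p [e [p0 e0 hP hA]]]] := resm_coercive.
have [M M0 hM] := mxapp_bounded P.
exists (e^-1 * e^-1 * M); first by rewrite !mulr_gt0 ?invr_gt0.
move=> z f; set u := mxapp (resolvent z) f.
have := hA z u; rewrite mxappM resmK => h1.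
have ei : 0 < e^-1 by rewrite invr_gt0.
have := cvdot_amgm (mxapp P f) u ei; rewrite invrK => h2.
have h3 := le_trans (ler_norm _) (ler_Re_mod (cvdot (mxapp P f) u)).
have h4 : e^-1 * cnrm2 (mxapp P f) <= e^-1 * (M * cnrm2 f) by rewrite ler_pM2l.
have h5 : e * cnrm2 u <= e^-1 * (M * cnrm2 f) by lra.
rewrite -(ler_pM2l e0); apply: le_trans h5 _.
by rewrite !mulrA mulfV ?gt_eqF // mul1r.
Qed.

Lemma resolvent_step z f : mxapp (resolvent z) f =
  f + vscale (circle_val z)^-1 (mxapp (resolvent z) (mxapp A f)).
Proof.
have := resolventK z f; rewrite mxapp_resm mxappBr mxappZr => /(canRL (subrK _)).
by [].
Qed.

Lemma resolvent_expansion z f g N : cvdot (mxapp (resolvent z) f) g =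
  \sum_(k < N) (circle_val z)^-1 ^+ k * cvdot (iter k (mxapp A) f) g +
  (circle_val z)^-1 ^+ N * cvdot (mxapp (resolvent z) (iter N (mxapp A) f)) g.
Proof.
elim: N => [|N ->]; first by rewrite big_ord0 add0r expr0 mul1r.
rewrite big_ord_recr /= -addrA; congr (_ + _).
by rewrite resolvent_step cvdotDl cvdotZl mulrDr exprSr mulrA.
Qed.

Lemma resolvent_form_bounded f g : exists C : R, forall z,
  mod (cvdot (mxapp (resolvent z) f) g) <= C.
Proof.
have [C C0 hC] := resolvent_bounded.
exists (C * cnrm2 f + cnrm2 g) => z.
have := cvdot_amgm (mxapp (resolvent z) f) g (@ltr01 R); rewrite invr1 !mul1r.
have := hC z f; have := mod_ge0 (cvdot (mxapp (resolvent z) f) g).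
lra.
Qed.

(** By the resolvent identity and the uniform bound, the form is Lipschitz in z. *)
Lemma resolvent_form_cmeasurable f g :
  cmeasurable (fun z => cvdot (mxapp (resolvent z) f) g).
Proof.
have [C C0 hC] := resolvent_bounded.
have [M M0 hM] := mxapp_bounded A.
apply: continuous_cmeasurable.
apply: (@lipschitz_circle_continuous _ _ (C * (M * (C * cnrm2 f)) + cnrm2 g)) => z v.
set d := mod (circle_val z - circle_val v).
rewrite -cvdotNl -cvdotDl; set u := mxapp (resolvent z) f - _.
have mu : mxapp (resm z) u =
    vscale ((circle_val z)^-1 - (circle_val v)^-1) (mxapp A (mxapp (resolvent v) f)).
  have hf := resmK v f.
  rewrite mxappBr resmK -[X in X - _]hf.
  rewrite !mxapp_resm; move: (mxapp (resolvent v) f) => w; move: (mxapp A w) => B.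
  apply/colP => i; rewrite !mxE.
  by rewrite scalerBl opprB [w i 0 - _]addrC addrACA subrr addr0 addrC.
have hu : cnrm2 u <= d ^+ 2 * (C * (M * (C * cnrm2 f))).
  rewrite -{1}(resolventK z u) mu; apply: le_trans (hC _ _) _.
  rewrite cnrm2Z !circle_inv.
  have -> : mod (Num.conj (circle_val z) - Num.conj (circle_val v)) = d.
    rewrite /d -[RHS]modJ; congr mod; apply: eqcP.
      by rewrite !(cReB, cReJ).
    by rewrite !(cImB, cImJ) opprB opprK addrC.
  rewrite mulrCA ler_wpM2l ?sqr_ge0 // ler_pM2l //.
  by apply: le_trans (hM _) _; rewrite ler_pM2l.
have [d0|dn0] := eqVneq d 0.
  have u0 : u = 0.
    apply: cnrm2_eq0; apply/eqP; rewrite eq_le cnrm2_ge0 andbT.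
    by apply: le_trans hu _; rewrite d0 expr0n mul0r.
  by rewrite u0 d0 mulr0 /cvdot big1 ?mod0 // => i _; rewrite mxE hdot0l.
have dp : 0 < d by rewrite lt_neqAle eq_sym dn0 mod_ge0.
have di : 0 < d^-1 by rewrite invr_gt0.
have := cvdot_amgm u g di; rewrite invrK.
have : d^-1 * cnrm2 u <= d^-1 * (d ^+ 2 * (C * (M * (C * cnrm2 f)))) by rewrite ler_pM2l.
rewrite expr2 -mulrA mulKf //.
have := mod_ge0 (cvdot u g); have := cnrm2_ge0 g; rewrite mulrDl.
have : 0 <= d * (C * (M * (C * cnrm2 f))).
  by rewrite !mulr_ge0 ?cnrm2_ge0 // ltW.
have : 0 <= d * cnrm2 g by rewrite mulr_ge0 ?cnrm2_ge0 // ltW.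
lra.
Qed.

(** Otherwise the Lyapunov form would decrease by a fixed amount at each step. *)
Lemma companion_power_small f (e : R) m : 0 < e ->
  exists2 N, (m <= N)%N & cnrm2 (iter N (mxapp A) f) < e.
Proof.
move=> e0; have [P [p [d [p0 d0 sP hP hA]]]] := lyapunov n hs ps.
apply: contrapT => hn.
have big N : (m <= N)%N -> e <= cnrm2 (iter N (mxapp A) f).
  by move=> mN; rewrite leNgt; apply/negP => h; apply: hn; exists N.
pose E k := Re (cvdot (mxapp P (iter k (mxapp A) f)) (iter k (mxapp A) f)).
have E0 k : 0 <= E k.
  by apply: le_trans (hP _); rewrite mulr_ge0 ?cnrm2_ge0 // ltW.
have step k : k%:R * (d * e) <= E m - E (m + k)%N.
  elim: k => [|k IH]; first by rewrite addn0 subrr mul0r.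
  rewrite addnS -natr1 mulrDl mul1r.
  have h1 := hA (iter (m + k) (mxapp A) f); rewrite -/(E (m + k)%N) -iterS -/(E (m + k).+1) in h1.
  have h2 : d * e <= d * cnrm2 (iter (m + k) (mxapp A) f).
    by rewrite ler_pM2l // big // leq_addr.
  lra.
have de : 0 < d * e by rewrite mulr_gt0.
have := step (Num.trunc (E m / (d * e))).+1.
have : E m / (d * e) < (Num.trunc (E m / (d * e))).+1%:R by apply: truncnS_gt.
rewrite ltr_pdivrMr // => h1 h2.
have := E0 (m + (Num.trunc (E m / (d * e))).+1)%N; lra.
Qed.

Lemma circleX_resolvent_cintegrable (m : int) f g : cintegrable (@circle_measure R)
  (fun z => circle_val z ^ m * cvdot (mxapp (resolvent z) f) g).
Proof.
have [C hC] := resolvent_form_bounded f g.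
apply: cintegrableM (cmeasurable_circleX m) (cbounded_circleX m) _.
exact: circle_bounded_cintegrable (resolvent_form_cmeasurable f g) hC.
Qed.

(** Integrating the Neumann expansion of the resolvent term by term; the remainder
    after N steps is small for suitable N by [companion_power_small]. *)
Lemma resolvent_fourier (m : int) f g : cintegral (@circle_measure R)
    (fun z => circle_val z ^ m * cvdot (mxapp (resolvent z) f) g) =
  if m is Posz k then cvdot (iter k (mxapp A) f) g else 0.
Proof.
set I := cintegral _ _; set J := (X in _ = X).
have [C C0 hC] := resolvent_bounded.
have cX (j : int) a : cintegrable (@circle_measure R) (fun z => circle_val z ^ j * a).
  by have /(cintegrableZ a) := @cintegrable_circleX R j; apply: eq_cintegrable => z; rewrite mulrC.
have IJ N : (`|m|%N < N)%N -> I - J = cintegral (@circle_measure R)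
    (fun z => circle_val z ^ (m - N%:Z) * cvdot (mxapp (resolvent z) (iter N (mxapp A) f)) g).
  move=> mN.
  have -> : I = cintegral (@circle_measure R) (fun z =>
      \sum_(k < N) circle_val z ^ (m - k%:Z) * cvdot (iter k (mxapp A) f) g +
      circle_val z ^ (m - N%:Z) * cvdot (mxapp (resolvent z) (iter N (mxapp A) f)) g).
    apply: eq_cintegral => z; rewrite (resolvent_expansion z f g N) mulrDr mulr_sumr.
    have e (k : nat) a : circle_val z ^ m * ((circle_val z)^-1 ^+ k * a) =
        circle_val z ^ (m - k%:Z) * a.
      by rewrite mulrA expfzDr ?circle_neq0 // exprVn exprnN.
    by rewrite e; congr (_ + _); apply: eq_bigr => k _; rewrite e.
  rewrite cintegralD; last 2 first.
  - by apply: cintegrable_sum => k _; exact: cX.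
  - exact: circleX_resolvent_cintegrable.
  rewrite cintegral_sum; last by move=> k _; exact: cX.
  suff -> : \sum_(k < N) cintegral (@circle_measure R)
      (fun z => circle_val z ^ (m - k%:Z) * cvdot (iter k (mxapp A) f) g) = J.
    by rewrite addrAC subrr add0r.
  have e (k : 'I_N) : cintegral (@circle_measure R)
      (fun z => circle_val z ^ (m - k%:Z) * cvdot (iter k (mxapp A) f) g) =
      (m == k%:Z)%:R * cvdot (iter k (mxapp A) f) g.
    rewrite -subr_eq0 -circle_fourier mulrC -cintegralZ; last first.
      exact: cintegrable_circleX.
    by apply: eq_cintegral => z; rewrite mulrC.
  under eq_bigr do rewrite e.
  rewrite /J; case: (m) mN => [j|j] jN.
    rewrite (bigD1 (Ordinal jN)) //= eqxx mul1r big1 ?addr0 // => k kj.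
    by rewrite eqz_nat eq_sym (negbTE kj : (val k == j) = false) mul0r.
  by rewrite big1 // => k _; rewrite mul0r.
apply/eqP; rewrite -subr_eq0; apply/eqP/mod_eq0/eqP; rewrite eq_le mod_ge0 andbT.
apply/ler_addgt0Pr => e e0; rewrite add0r.
pose t := (cnrm2 g + 1) / e.
have g1 : 0 < cnrm2 g + 1 by rewrite ltr_wpDl ?cnrm2_ge0.
have t0 : 0 < t by rewrite divr_gt0.
have et : 0 < e / (t * C) by rewrite divr_gt0 // mulr_gt0.
have [N mN hN] := companion_power_small f `|m|.+1 et.
have tg : t^-1 * cnrm2 g <= e.
  by rewrite ler_pdivrMl // divfK ?gt_eqF // lerDl.
rewrite (IJ N mN).
apply: le_trans (cintegral_le _ _ (_ : forall z, _ <= e)) _.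
- exact: circleX_resolvent_cintegrable.
- apply: measurable_bounded_integrable => //; first by rewrite [X in (X < _)%E]circle_measureT ltry.
  by exists e; split; rewrite ?num_real // => r er z _; rewrite /= gtr0_norm // ltW.
- move=> z; rewrite modM circle_modX mul1r.
  have := cvdot_amgm (mxapp (resolvent z) (iter N (mxapp A) f)) g t0.
  have h1 : t * cnrm2 (mxapp (resolvent z) (iter N (mxapp A) f)) <=
      t * (C * cnrm2 (iter N (mxapp A) f)) by rewrite ler_pM2l.
  move: hN; rewrite (ltr_pdivlMr _ _ (mulr_gt0 t0 C0)) => h2.
  lra.
by rewrite Rintegral_cst // [X in fine X](@circle_measureT R) mulr1.
Qed.

End Resolvent.

(** * The Bernstein-Szego density *)

Section BernsteinSzego.
Context {R : realType} {H : hilbertType R}.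
Variables (s : int -> bop H) (n : nat).
Hypotheses (hs : hermitian_seq s) (ps : posdef_seq s).

Local Notation T := (toep s n.+1).
Local Notation A := (companion s n).
Local Notation kappa := (kap s n).
Local Notation cn := (cn s n).
Implicit Types (f g : 'cV[H]_n.+1) (x y : H) (z : circle R).

Lemma PhiE (z : R[i]) x : Phi s n z x = z ^+ n *: x - \sum_(l < n) z ^+ l *: cn l x.
Proof.
rewrite /Phi bop_subE bop_scaleE -mulmxA mxE bop_suml; congr (_ - _).
apply: eq_bigr => l _; rewrite cnE [X in X * _]mxE.
done.
Qed.

(* so that simplification does not unfold the matrix products *)
Opaque kap Phi.

Lemma Phi_vecE (z : R[i]) x : Phi s n z x = \sum_(k < n.+1) z ^+ k *: crd (Phi_vec s n x) k.
Proof.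
rewrite PhiE big_ord_recr /= crd_vec // eqxx addrC -sumrN; congr (_ + _).
apply: eq_bigr => l _; rewrite crd_vec ?ltn_eqF ?scalerN // ltnS; exact: ltnW.
Qed.

(** Evaluating at z the polynomial with coefficients f - z^-1 A f: the shift cancels
    all coordinates but the last, which is multiplied by Phi_n(z). *)
Lemma Phi_resm z f :
  \sum_(j < n.+1) circle_val z ^+ j *: crd (mxapp (resm s n z) f) j =
  Phi s n (circle_val z) (crd f n).
Proof.
transitivity (\sum_(j < n.+1) circle_val z ^+ j *: crd f j -
    \sum_(j < n.+1) circle_val z ^+ j *: ((circle_val z)^-1 *: crd (mxapp A f) j)).
  rewrite -sumrB; apply: eq_bigr => j _; rewrite mxapp_resm -scalerBr; congr (_ *: _).
  by rewrite /crd !mxE.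
rewrite [X in _ - X]big_ord_recl crd_companion0 !scaler0 add0r big_ord_recr /=.
rewrite PhiE addrAC [RHS]addrC; congr (_ + _); rewrite -sumrB -sumrN.
apply: eq_bigr => j _.
rewrite -[bump 0 j]/j.+1 crd_companionS // scalerA exprS mulrAC.
by rewrite mulfV ?circle_neq0 // mul1r scalerDr opprD addrA subrr add0r.
Qed.

Definition basis_vec (k : nat) x : 'cV[H]_n.+1 := vec n (fun j => if j == k then x else 0).

Lemma companion_basis k x : (k < n)%N -> mxapp A (basis_vec k x) = basis_vec k.+1 x.
Proof.
move=> kn; apply: crdP => -[|j] jn; first by rewrite crd_companion0 crd_vec.
rewrite crd_companionS // !crd_vec //; last exact: ltnW.
by rewrite (gtn_eqF kn) bop0 addr0 eqSS.
Qed.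

(** Up to degree n no reduction takes place. *)
Lemma companion_iter_basis k x : (k <= n)%N ->
  iter k (mxapp A) (basis_vec 0 x) = basis_vec k x.
Proof.
elim: k => //= k IH kn; rewrite IH ?companion_basis //; exact: ltnW.
Qed.

Lemma companion_Phi_vec x : mxapp A (Phi_vec s n x) = 0.
Proof.
apply: crdP => -[|j] jn; first by rewrite crd_companion0 /crd mxE.
rewrite crd_companionS // !crd_vec //; last exact: ltnW.
by rewrite eqxx ltn_eqF // addNr /crd mxE.
Qed.

(** Eliminating the coordinates of a solution u of u - z^-1 A u = (x, 0, ..., 0) from
    the top down leaves Phi_n(z) u_n = x ([Phi_resm]), so this corner of the resolvent
    inverts Phi_n(z). *)
Definition Phi_inv z : bop H := resolvent s n z ord_max ord0.

Lemma crd_resolvent z f :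
  crd (mxapp (resolvent s n z) f) n = \sum_(j < n.+1) resolvent s n z ord_max j (crd f j).
Proof.
have -> : crd (mxapp (resolvent s n z) f) n = mxapp (resolvent s n z) f ord_max 0.
  by rewrite [RHS]crd_ord.
by rewrite mxappE; apply: eq_bigr => j _; rewrite crd_ord.
Qed.

Lemma crd_resolvent_basis z (j : 'I_n.+1) x :
  crd (mxapp (resolvent s n z) (basis_vec j x)) n = resolvent s n z ord_max j x.
Proof.
rewrite crd_resolvent (bigD1 j) //= crd_vec // eqxx big1 ?addr0 // => i ij.
by rewrite crd_vec // (negbTE ij : (val i == val j) = false) bop0.
Qed.

Lemma resolvent_last z k x : (k < n.+1)%N ->
  resolvent s n z ord_max (inord k) x = circle_val z ^+ k *: Phi_inv z x.
Proof.
have col := crd_resolvent_basis z.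
elim: k => [|k IH] kn.
  by rewrite expr0 scale1r /Phi_inv; congr (resolvent _ _ _ _ _ _); apply: val_inj; rewrite /= inordK.
have kn' : (k < n)%N by [].
have z0 := circle_neq0 z.
have := congr1 (fun u => crd u n) (resolvent_step hs ps z (basis_vec k x)).
rewrite companion_basis // crdD crd_scale crd_vec // gtn_eqF // add0r.
have ek : basis_vec k x = basis_vec (inord k : 'I_n.+1) x by rewrite inordK // ltnW.
have ek' : basis_vec k.+1 x = basis_vec (inord k.+1 : 'I_n.+1) x by rewrite inordK.
rewrite ek ek' !col IH; last exact: ltnW.
move=> /(congr1 ( *:%R (circle_val z))); rewrite !scalerA mulfV // scale1r => <-.
by rewrite exprS.
Qed.

Lemma Phi_inverse z : is_inverse (Phi s n (circle_val z)) (Phi_inv z).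
Proof.
split; apply: bopP => x; rewrite bop_mulE bop_oneE.
  have := Phi_resm z (mxapp (resolvent s n z) (basis_vec 0 x)).
  rewrite resmK // (crd_resolvent_basis z ord0 x) => <-.
  rewrite big_ord_recl crd_vec // eqxx expr0 scale1r big1 ?addr0 // => j _.
  by rewrite crd_vec // scaler0.
have e : mxapp (resm s n z) (Phi_vec s n x) = Phi_vec s n x.
  rewrite mxapp_resm companion_Phi_vec; apply: crdP => j _.
  by rewrite /crd !mxE scaler0 subr0.
have := congr1 (fun u => crd u n) (resolventK hs ps z (Phi_vec s n x)).
rewrite e crd_resolvent [RHS]crd_vec // eqxx => {2}<-.
rewrite Phi_vecE bop_sumr; apply: eq_bigr => k _.
by rewrite bopZ -resolvent_last // inord_val.
Qed.

(** This is the inverse of phi_n(z) phi_n(z)^*, as phi_n(z) = Phi_n(z) kappa^(-1/2)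
    ([bernstein_szego_densityE]); the square root has disappeared. *)
Definition bs_dens z : bop H := adjoint (Phi_inv z) * kappa * Phi_inv z.

Lemma bs_densE z x y : '[bs_dens z x, y] = '[kappa (Phi_inv z x), Phi_inv z y].
Proof. by rewrite [RHS]adjointEr. Qed.

(** The Stein equation at the images u, v of f, g under the resolvent, where
    z^-1 A u = u - f and z^-1 A v = v - g: the terms in both u and v cancel, and what
    is left is linear in the resolvent and its conjugate. *)
Lemma bs_dens_resolvent z x y : '[bs_dens z x, y] =
  cvdot (mxapp (resolvent s n z) (basis_vec 0 x)) (mxapp T (basis_vec 0 y)) +
  Num.conj (cvdot (mxapp (resolvent s n z) (basis_vec 0 y)) (mxapp T (basis_vec 0 x))) -
  cvdot (basis_vec 0 x) (mxapp T (basis_vec 0 y)).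
Proof.
set f := basis_vec 0 x; set g := basis_vec 0 y.
set u := mxapp (resolvent _ _ _) f; set v := mxapp (resolvent _ _ _) g.
rewrite bs_densE -(crd_resolvent_basis z ord0 x) -(crd_resolvent_basis z ord0 y) -/f -/g -/u -/v.
have Au : vscale (circle_val z)^-1 (mxapp A u) = u - f.
  by rewrite -[X in _ - X](resmK hs ps z f) -/u mxapp_resm opprB addrC subrK.
have Av : vscale (circle_val z)^-1 (mxapp A v) = v - g.
  by rewrite -[X in _ - X](resmK hs ps z g) -/v mxapp_resm opprB addrC subrK.
have := stein hs ps u v.
rewrite -(cvdot_circle_scale z) -mxappZr Au Av => h.
have -> : '[kappa (crd u n), crd v n] =
    cvdot (mxapp T u) v - cvdot (mxapp T (u - f)) (v - g) by rewrite h opprB addrC subrK.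
rewrite mxappBr !(cvdotDl, cvdotDr, cvdotNl, cvdotNr) -!(toep_selfadjoint hs).
rewrite -cvdotC -(toep_selfadjoint hs f v).
ring.
Qed.

Lemma bs_dens_nonneg z : nonneg_op (bs_dens z).
Proof.
move=> x; have [k k0 hk] := kappa_coercive n hs ps.
rewrite bs_densE selfadjoint_diag; last exact: kappa_adjoint.
rewrite ler0c; apply: le_trans (hk _).
by rewrite mulr_ge0 ?sqr_ge0 // ltW.
Qed.

(** |x| = |Phi_n(z) Phi_n(z)^-1 x| and Phi_n is bounded on the circle. *)
Lemma bs_dens_coercive : exists2 c : R, 0 < c &
  forall z x, c * nrm x ^+ 2 <= Re '[bs_dens z x, x].
Proof.
have [k k0 hk] := kappa_coercive n hs ps.
have [M M0 hM] : exists2 M : R, 0 < M & forall z x, nrm (Phi s n (circle_val z) x) <= M * nrm x.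
  have /choice[K hK] : forall l : 'I_n, exists K : R, 0 < K /\ forall x, nrm (cn l x) <= K * nrm x.
    by move=> l; have [K] := bop_bounded (cn l); exists K.
  exists (1 + \sum_l K l).
    by rewrite ltr_pwDl // sumr_ge0 // => l _; apply/ltW; exact: (hK l).1.
  move=> z x; rewrite PhiE; apply: le_trans (nrmD _ _) _.
  have mz m : mod (circle_val z ^+ m) = 1 by exact: (circle_modX z m).
  rewrite nrmN nrmZ mz mul1r mulrDl mul1r lerD2l.
  apply: le_trans (nrm_sum _ _ _) _; rewrite mulr_suml; apply: ler_sum => l _.
  by rewrite nrmZ mz mul1r; exact: (hK l).2.
exists (k / M ^+ 2); first by rewrite divr_gt0 // exprn_gt0.
move=> z x; rewrite bs_densE; apply: le_trans (hk _).
rewrite -mulrA ler_pM2l // ler_pdivrMl ?exprn_gt0 // -exprMn.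
rewrite ler_pXn2r ?nnegrE ?mulr_ge0 ?nrm_ge0 ?(ltW M0) //.
by apply: le_trans (hM z _); rewrite -bop_mulE (Phi_inverse z).1.
Qed.

Local Notation lambda := (@circle_measure R).

(** The three terms of [bs_dens_resolvent] have known Fourier coefficients: the
    first contributes T A^m at constant polynomials, and the other two cancel. *)
Lemma bs_dens_fourier (m : nat) x y :
  cintegral lambda (fun z => circle_val z ^+ m * '[bs_dens z x, y]) =
  cvdot (iter m (mxapp A) (basis_vec 0 x)) (mxapp T (basis_vec 0 y)).
Proof.
set f := basis_vec 0 x; set g := basis_vec 0 y.
have i1 := circleX_resolvent_cintegrable hs ps m f (mxapp T g).
have i2 := circleX_resolvent_cintegrable hs ps (- m%:Z) g (mxapp T f).
have i3 : cintegrable lambda (fun z => circle_val z ^ m) := cintegrable_circleX m.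
have -> : cintegral lambda (fun z => circle_val z ^+ m * '[bs_dens z x, y]) =
    cintegral lambda (fun z => circle_val z ^ m * cvdot (mxapp (resolvent s n z) f) (mxapp T g)) +
    (Num.conj (cintegral lambda (fun z => circle_val z ^ (- m%:Z) * cvdot (mxapp (resolvent s n z) g) (mxapp T f))) -
    cvdot f (mxapp T g) * cintegral lambda (fun z => circle_val z ^ m)).
  rewrite -cintegralJ // -mulNr -cintegralZ // -cintegralD //; last 2 first.
  - exact: cintegrableJ.
  - exact: cintegrableZ.
  rewrite -cintegralD //; last first.
    by apply: cintegrableD; [exact: cintegrableJ|exact: cintegrableZ].
  apply: eq_cintegral => z; rewrite bs_dens_resolvent -/f -/g cconjM circle_conjX opprK.
  by rewrite -[circle_val z ^+ m]/(circle_val z ^ m); ring.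
rewrite !(resolvent_fourier hs ps) circle_fourier.
case: m {i1 i2 i3} => [|m] /=.
  rewrite mulr1 -[X in _ + (_ X - _)]/(cvdot g (mxapp T f)).
  by rewrite -cvdotC (toep_selfadjoint hs) subrr addr0.
by rewrite conjC0 mulr0 subrr addr0.
Qed.

End BernsteinSzego.

(** * Moments of operator measures with a density *)

Section Moments.
Context {R : realType} {H : hilbertType R}.
Local Notation T := (circle R).
Local Notation lambda := (@circle_measure R).
Implicit Types (mu : set T -> bop H) (w : T -> bop H).

Lemma momentE mu w K j x y : is_povm mu -> has_density mu w -> form_density w K ->
  '[moment mu j x, y] = cintegral lambda (fun z => circle_val z ^ (- j) * '[w z x, y]).
Proof.
move=> pmu dmu dw.
exact: (povm_integralE pmu dmu dw (cmeasurable_circleX _) (cbounded_circleX _)).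
Qed.

Lemma moment_hermitian mu w K : is_povm mu -> has_density mu w -> form_density w K ->
  hermitian_seq (moment mu).
Proof.
move=> pmu dmu dw j; apply: adjoint_unique => x y.
rewrite (momentE _ _ _ pmu dmu dw) hdotC (momentE _ _ _ pmu dmu dw) -cintegralJ.
  apply: eq_cintegral => z; rewrite cconjM circle_conjX opprK; congr (_ * _).
  have [_ nw _] := dw.
  by rewrite -{1}(nonneg_op_selfadjoint (nw z)) -adjointEr hdotC.
exact: (density_cintegrableM dw (cmeasurable_circleX _) (cbounded_circleX _)).
Qed.

Lemma form_density_normalized mu w K : is_povm mu -> has_density mu w -> form_density w K ->
  moment mu 0 = 1 -> form_density w 1.
Proof.
move=> pmu dmu dw m1; have [mw nw iw] := dw; split => // h; split; first exact: (iw h).1.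
have := momentE 0 h h pmu dmu dw; rewrite m1 bop_oneE => /(congr1 (fun c : R[i] => Re c)).
rewrite Re_hdotxx mul1r => -> /=; rewrite le_eqVlt; apply/orP; left; apply/eqP.
by apply: eq_Rintegral => z _; rewrite expr0z mul1r.
Qed.

(** The quadratic form is the integral of <w P, P> for the trigonometric polynomial P
    with coefficients x and exponents e, and |P|^2 has integral |x|^2 by orthogonality.
    The exponents i and - i give the two Toeplitz matrices. *)
Lemma toeplitz_coercive mu w K (c : R) N (e : 'I_N -> int) (x : 'cV[H]_N) :
  is_povm mu -> has_density mu w -> form_density w K -> injective e ->
  (forall z h, c * nrm h ^+ 2 <= Re '[w z h, h]) ->
  c * cnrm2 x <=
    Re (cvdot (mxapp (\matrix_(j, k) moment mu (e j - e k)) x) x).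
Proof.
move=> pmu dmu dw inje cw.
pose P z : H := \sum_k circle_val z ^ e k *: x k 0.
pose t (k j : 'I_N) z : R[i] := '[w z (x k 0), x j 0] - c%:C * '[x k 0, x j 0].
have cX (m : int) : cintegrable lambda (fun z => circle_val z ^ m) := cintegrable_circleX m.
have i1 (m : int) k j : cintegrable lambda (fun z => circle_val z ^ m * '[w z (x k 0), x j 0]).
  exact: (density_cintegrableM dw (cmeasurable_circleX _) (cbounded_circleX _)).
pose G z := \sum_j \sum_k circle_val z ^ (e k - e j) * t k j z.
have iG k j : cintegrable lambda (fun z => circle_val z ^ (e k - e j) * t k j z).
  apply: (@eq_cintegrable _ _ (fun z => circle_val z ^ (e k - e j) * '[w z (x k 0), x j 0] +
     - (c%:C * '[x k 0, x j 0]) * circle_val z ^ (e k - e j))).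
    by move=> z; rewrite /t; ring.
  by apply: cintegrableD => //; exact: cintegrableZ.
have GE z : G z = '[w z (P z), P z] - c%:C * '[P z, P z].
  rewrite /P bop_sumr !hdot_sumr mulr_sumr -sumrB; apply: eq_bigr => j _.
  rewrite !hdot_suml mulr_sumr -sumrB; apply: eq_bigr => k _.
  rewrite bopZ !hdotZl !hdotZr circle_conjX expfzDr ?circle_neq0 // /t; ring.
have : 0 <= Re (cintegral lambda G).
  apply: Rintegral_ge0 => z _; rewrite GE cReB cReZ Re_hdotxx subr_ge0; exact: cw.
suff -> : cintegral lambda G =
    cvdot (mxapp (\matrix_(j, k) moment mu (e j - e k)) x) x - (c * cnrm2 x)%:C.
  by rewrite cReB /= subr_ge0.
rewrite /G cintegral_sum; last by move=> j _; exact: cintegrable_sum.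
rewrite /cvdot /cnrm2 mulr_sumr rmorph_sum -sumrB; apply: eq_bigr => j _ /=.
rewrite cintegral_sum // mxappE hdot_suml.
transitivity (\sum_k ('[moment mu (e j - e k) (x k 0), x j 0] -
    c%:C * '[x k 0, x j 0] * (e k - e j == 0)%:R)).
  apply: eq_bigr => k _; rewrite (momentE _ _ _ pmu dmu dw) opprB -circle_fourier.
  rewrite -mulNr -cintegralZ // -cintegralD //; last exact: cintegrableZ.
  by apply: eq_cintegral => z; rewrite /t; ring.
rewrite sumrB; congr (_ - _); first by apply: eq_bigr => k _; rewrite mxE.
rewrite (bigD1 j) //= subrr eqxx mulr1 big1 ?addr0 => [|k kj].
  by rewrite hdotxx -rmorphM.
by rewrite subr_eq0 (inj_eq inje) (negbTE kj) mulr0.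
Qed.

Lemma coercive_density_nontrivial mu w K (c : R) :
  is_povm mu -> has_density mu w -> form_density w K -> 0 < c ->
  (forall z h, c * nrm h ^+ 2 <= Re '[w z h, h]) -> nontrivial_povm mu.
Proof.
move=> pmu dmu dw c0 cw m m0.
have hs := moment_hermitian pmu dmu dw.
split; apply: (@coercive_posdef_opmx _ _ _ _ c) => //.
- exact: toep_adjoint.
- move=> x; apply: (@toeplitz_coercive mu w K c m (fun i => i%:Z) x pmu dmu dw _ cw).
  by move=> i j [] /val_inj.
- by apply/matrixP => j k; rewrite adjoint_mxE !mxE hs opprB.
move=> x; have := @toeplitz_coercive mu w K c m (fun i => - i%:Z) x pmu dmu dw _ cw.
have -> : \matrix_(j, k) moment mu (- j%:Z - - k%:Z) = toeplitzL mu m.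
  by apply/matrixP => j k; rewrite !mxE opprK addrC.
by apply=> i j /oppr_inj[] /val_inj.
Qed.

End Moments.

(** * The Bernstein-Szego measure *)

Section BernsteinSzegoMeasure.
Context {R : realType} {H : hilbertType R}.
Variables (s : int -> bop H) (n : nat).
Hypotheses (hs : hermitian_seq s) (ps : posdef_seq s).

Local Notation T := (toep s n.+1).
Local Notation A := (companion s n).
Local Notation lambda := (@circle_measure R).
Implicit Types (x y : H) (z : circle R).

(* so that simplification does not unfold the matrix products *)
Opaque kap Phi.

(** The first row of a Toeplitz matrix lists the moments of nonpositive order. *)
Lemma cvdot_toep_basis f y : cvdot f (mxapp T (basis_vec n 0 y)) =
  '[(\sum_(k < n.+1) s (- k%:Z) (crd f k)), y].
Proof.
rewrite -(toep_selfadjoint hs) cvdot_crd big_ord_recl big1 ?addr0 => [|k _].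
  rewrite crd_vec // eqxx (crd_toep s f (ltn0Sn n)); congr ('[_, _]).
  by apply: eq_bigr => k _; rewrite sub0r.
by rewrite crd_vec // hdot0r.
Qed.

(** By [bs_dens_resolvent] the forms of the density are bounded and measurable, like
    those of the resolvent; its total mass is the moment of order 0. *)
Lemma bs_dens_form : exists K, form_density (bs_dens s n) K.
Proof.
have mW x y : cmeasurable (fun z => '[bs_dens s n z x, y]).
  have m2 := cmeasurableJ (resolvent_form_cmeasurable hs ps (basis_vec n 0 y) (mxapp T (basis_vec n 0 x))).
  have m1 := resolvent_form_cmeasurable hs ps (basis_vec n 0 x) (mxapp T (basis_vec n 0 y)).
  have m3 := cmeasurable_cst (- cvdot (basis_vec n 0 x) (mxapp T (basis_vec n 0 y))).
  apply: eq_cmeasurable (cmeasurableD (cmeasurableD m1 m2) m3) => z.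
  by rewrite bs_dens_resolvent.
have bW x y : exists C, cbounded C (fun z => '[bs_dens s n z x, y]).
  have [C1 h1] := resolvent_form_bounded hs ps (basis_vec n 0 x) (mxapp T (basis_vec n 0 y)).
  have [C2 h2] := resolvent_form_bounded hs ps (basis_vec n 0 y) (mxapp T (basis_vec n 0 x)).
  exists (C1 + C2 + mod (cvdot (basis_vec n 0 x) (mxapp T (basis_vec n 0 y)))) => z.
  rewrite bs_dens_resolvent //; apply: le_trans (modD _ _) _; rewrite modN lerD2r.
  by apply: le_trans (modD _ _) _; rewrite modJ lerD.
have iW x y : cintegrable lambda (fun z => '[bs_dens s n z x, y]).
  by have [C hC] := bW x y; apply: circle_bounded_cintegrable (mW x y) hC.
have [M M0 hM] := bop_bounded (s 0).
exists M; split.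
- by move=> x y; have [] := mW x y.
- by move=> z; exact: bs_dens_nonneg.
move=> h; split; first by have [] := iW h h.
have := bs_dens_fourier n hs ps 0 h h; rewrite [iter 0 _ _]/= cvdot_toep_basis.
rewrite big_ord_recl big1 ?addr0 => [|k _]; last by rewrite crd_vec // bop0.
rewrite crd_vec // eqxx oppr0 => /(congr1 (fun c : R[i] => Re c)).
rewrite [LHS]/= => e.
have -> : \int[lambda]_z Re '[bs_dens s n z h, h] = Re '[s 0 h, h].
  by rewrite -e; apply: eq_Rintegral => z _; rewrite expr0 mul1r.
apply: le_trans (ler_norm _) (le_trans (ler_Re_mod _) (le_trans (hdot_le _ _) _)).
by rewrite expr2 mulrA ler_wpM2r ?nrm_ge0.
Qed.

Local Notation nu := (with_density (bs_dens s n)).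

Lemma bs_povm : is_povm nu.
Proof. by have [K /with_density_povm] := bs_dens_form. Qed.

Lemma bs_has_density : has_density nu (bs_dens s n).
Proof. by have [K /with_density_has_density] := bs_dens_form. Qed.

Lemma bs_nontrivial : nontrivial_povm nu.
Proof.
have [K dW] := bs_dens_form; have [c c0 hc] := bs_dens_coercive n hs ps.
exact: (coercive_density_nontrivial bs_povm bs_has_density dW c0 hc).
Qed.

Local Notation s' := (moment nu).

Lemma bs_hermitian : hermitian_seq s'.
Proof.
by have [K dW] := bs_dens_form; exact: (moment_hermitian bs_povm bs_has_density dW).
Qed.

Lemma bs_posdef : posdef_seq s'.
Proof. by move=> m m0; have [] := bs_nontrivial m0. Qed.

Lemma bs_momentE (m : nat) x y : '[s' (- m%:Z) x, y] =
  cvdot (iter m (mxapp A) (basis_vec n 0 x)) (mxapp T (basis_vec n 0 y)).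
Proof.
have [K dW] := bs_dens_form; rewrite -(bs_dens_fourier n hs ps).
by rewrite (momentE _ _ _ bs_povm bs_has_density dW) opprK.
Qed.

(** For m <= n the power A^m moves the constant x to x z^m, and T pairs it with the
    constants through s_(-m). *)
Lemma bs_moment_agree (j : int) : (`|j| <= n)%N -> s' j = s j.
Proof.
have neg (m : nat) : (m <= n)%N -> s' (- m%:Z) = s (- m%:Z).
  move=> mn; apply: bopP => x; apply: hdot_inj => y.
  have mn' : (m < n.+1)%N by [].
  rewrite bs_momentE companion_iter_basis // cvdot_toep_basis; congr ('[_, _]).
  rewrite (bigD1 (Ordinal mn')) //= crd_vec // eqxx big1 ?addr0 // => k km.
  by rewrite crd_vec // (negbTE km : (val k == m) = false) bop0.
case: j => m mn; last by rewrite NegzE neg.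
by rewrite -[Posz m]opprK -bs_hermitian -hs neg.
Qed.

Lemma bs_total : nu setT = s 0.
Proof.
have [K dW] := bs_dens_form; apply: bop_eq_diag => x.
rewrite -bs_moment_agree // (momentE _ _ _ bs_povm bs_has_density dW).
have [r -> ] := with_densityE x dW measurableT.
rewrite (form_density_fin x dW measurableT) => -[<-].
apply: eqcP => /=.
  by by apply: eq_Rintegral => z _; rewrite oppr0 expr0z mul1r.
have [_ nW _] := dW.
transitivity (\int[lambda]_(z in setT) (0 : R)).
  by rewrite /Rintegral integral0.
by apply: eq_Rintegral => z _; rewrite oppr0 expr0z mul1r (nonneg_op_diag x (nW z)).1.
Qed.

(** The moments satisfy, for all indices and not only for those of the normal
    equations, the recursion with characteristic polynomial Phi_n: negative indices
    come from A^(p+1+n), and A reduces x z^n to a combination of lower powers. *)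
Lemma bs_moment_recursion (i : int) : (i < n%:Z)%R ->
  \sum_(l < n) s' (i - l%:Z) * cn s n l = s' (i - n%:Z).
Proof.
case: i => [i|p] ni.
  rewrite bs_moment_agree; last by lia.
  rewrite -(cn_orth ps) //; apply: eq_bigr => l _.
  by rewrite bs_moment_agree //; have := ltn_ord l; lia.
have companion_top x : mxapp A (basis_vec n n x) =
    \sum_(l < n) basis_vec n l.+1 (cn s n l x).
  have crd_sum (F : 'I_n -> 'cV[H]_n.+1) j : crd (\sum_l F l) j = \sum_l crd (F l) j.
    by rewrite /crd summxE.
  apply: crdP => -[|j] jn.
    rewrite crd_companion0 crd_sum big1 // => l _; by rewrite crd_vec.
  rewrite crd_companionS // crd_sum !crd_vec ?eqxx //; last exact: ltnW.
  rewrite ltn_eqF // add0r (bigD1 (Ordinal (jn : (j < n)%N))) //= crd_vec // eqxx.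
  rewrite big1 ?addr0 // => l lj; rewrite crd_vec // eqSS eq_sym.
  by rewrite (negbTE lj : (val l == j) = false).
have iter_sum k (F : 'I_n -> 'cV[H]_n.+1) :
    iter k (mxapp A) (\sum_l F l) = \sum_l iter k (mxapp A) (F l).
  elim: k => //= k ->; exact: (big_morph _ (mxappDr A) (mxapp0r A)).
have cv_sum (F : 'I_n -> 'cV[H]_n.+1) g : cvdot (\sum_l F l) g = \sum_l cvdot (F l) g.
  apply: (big_morph (fun f => cvdot f g)) => [u v|]; first exact: cvdotDl.
  by rewrite /cvdot big1 // => j _; rewrite mxE hdot0l.
apply: bopP => x; apply: hdot_inj => y; rewrite bop_suml hdot_suml NegzE.
rewrite -opprD -PoszD bs_momentE iterD companion_iter_basis // iterSr companion_top.
rewrite iter_sum cv_sum; apply: eq_bigr => l _.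
rewrite bop_mulE -opprD -PoszD bs_momentE.
rewrite -(companion_iter_basis (n := n) s (k := l.+1)) //.
by rewrite -iterD addSnnS.
Qed.

End BernsteinSzegoMeasure.

(** * Verblunsky coefficients *)

Section Verblunsky.
Context {R : realType} {H : hilbertType R}.
Local Notation lambda := (@circle_measure R).
Implicit Types (mu : set (circle R) -> bop H).

(** The coefficient of index j involves only moments of order at most j + 1. *)
Lemma verblunsky_agree mu mu' (n j : nat) : (j < n)%N ->
  (forall k : int, (`|k| <= n)%N -> moment mu' k = moment mu k) ->
  verblunsky mu' j = verblunsky mu j.
Proof.
move=> jn agree.
have tR m : (m <= n.+1)%N -> toeplitzR mu' m = toeplitzR mu m.
  move=> mn; apply/matrixP => a b; rewrite !mxE agree //.
  have := ltn_ord a; have := ltn_ord b; lia.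
have tL m : (m <= n.+1)%N -> toeplitzL mu' m = toeplitzL mu m.
  move=> mn; apply/matrixP => a b; rewrite !mxE agree //.
  have := ltn_ord a; have := ltn_ord b; lia.
have eN m : (m <= n)%N -> nu mu' m = nu mu m.
  move=> mn; apply/matrixP => a b; rewrite !mxE agree //.
  have := ltn_ord a; lia.
have eX m : (m <= n)%N -> xi mu' m = xi mu m.
  move=> mn; apply/matrixP => a b; rewrite !mxE agree //.
  have := ltn_ord a; lia.
have jn1 : (j <= n.+1)%N by lia.
have jn2 : (j <= n)%N by lia.
rewrite /verblunsky /kappaR /kappaL /PhiR agree // !tR ?tL ?eN ?eX //.
Qed.

(** By the recursion, z^(d+1) (z^n - sum_l c_l z^l) solves the normal equations of
    degree d + 1 + n, so it is the orthogonal polynomial of that degree. *)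
Lemma Phi_recursion (s : int -> bop H) (n d : nat) (c : nat -> bop H) :
  posdef_seq s ->
  (forall i : int, i < n%:Z -> \sum_(l < n) s (i - l%:Z) * c l = s (i - n%:Z)) ->
  Phi s (d.+1 + n) 0 = 0.
Proof.
move=> ps rec.
pose c' : 'cV[bop H]_(d.+1 + n) := \col_k (match fintype.split k with inl _ => 0 | inr l => c l end).
have ec : c' = toep_coef s (d.+1 + n).
  apply/(toep_coefE _ ps)/matrixP => i j; rewrite !mxE big_split_ord /= big1 ?add0r.
    have := rec (i%:Z - d.+1%:Z).
    rewrite -addrA -opprD -PoszD => <-; last by have := ltn_ord i; lia.
    apply: eq_bigr => l _; rewrite !mxE.
    have := unsplitK (inr l : 'I_d.+1 + 'I_n); rewrite /= => ->.
    by congr (s _ * _); rewrite /=; lia.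
  move=> l _; rewrite !mxE.
  have := unsplitK (inl l : 'I_d.+1 + 'I_n); rewrite /= => ->.
  by rewrite mulr0.
apply: bopP => x; rewrite PhiE addSn expr0n scale0r sub0r big_ord_recl big1 ?addr0.
  have -> : cn s (d + n).+1 (ord0 : 'I_(d + n).+1) = 0.
    rewrite cnE -ec mxE.
    have := unsplitK (inl ord0 : 'I_d.+1 + 'I_n).
    have -> : unsplit (inl ord0 : 'I_d.+1 + 'I_n) = ord0 by exact: val_inj.
    by move=> ->.
  by rewrite bop_zeroE scaler0 oppr0.
by move=> l _; rewrite /= exprS mul0r scale0r.
Qed.

Lemma verblunsky_Phi0 mu j : PhiR mu j.+1 0 = 0 -> verblunsky mu j = 0.
Proof. by move=> h; rewrite /verblunsky h adjoint0 mulr0 mul0r oppr0. Qed.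

End Verblunsky.

(** * Weak convergence *)

Section WeakConvergence.
Context {R : realType} {H : hilbertType R}.
Local Notation lambda := (@circle_measure R).
Implicit Types (w : circle R -> bop H).

Lemma fejer_integral w K f N x y : form_density w K ->
  cintegral lambda (fun z => fejer_mean f N z * '[w z x, y]) =
  (N.+1%:R^-1)%:C * \sum_(a < N.+1) \sum_(b < N.+1) fourier_coef f (a%:Z - b%:Z) *
    cintegral lambda (fun z => circle_val z ^ (a%:Z - b%:Z) * '[w z x, y]).
Proof.
move=> dw.
have i1 (k : int) : cintegrable lambda (fun z => circle_val z ^ k * '[w z x, y]).
  exact: (density_cintegrableM dw (cmeasurable_circleX _) (cbounded_circleX _)).
pose F (a b : 'I_N.+1) z := fourier_coef f (a%:Z - b%:Z) * (circle_val z ^ (a%:Z - b%:Z) * '[w z x, y]).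
rewrite (@eq_cintegral _ _ _ (fun z => (N.+1%:R^-1)%:C * \sum_a \sum_b F a b z)); last first.
  move=> z; rewrite /fejer_mean -mulrA mulr_suml; congr (_ * _).
  apply: eq_bigr => a _; rewrite mulr_suml; apply: eq_bigr => b _; by rewrite /F mulrA.
have iF a b : cintegrable lambda (F a b) by exact: cintegrableZ.
rewrite cintegralZ; last first.
  by apply: cintegrable_sum => a _; exact: cintegrable_sum.
congr (_ * _); rewrite cintegral_sum => [|a _]; last exact: cintegrable_sum.
apply: eq_bigr => a _; rewrite cintegral_sum //; apply: eq_bigr => b _.
by rewrite cintegralZ.
Qed.

(** Once n exceeds the degree of a Fejer mean of f, the two integrals of the mean are
    equal; the remainder is uniformly small, and the total masses are at most 1. *)
Lemma fourier_agree_cvg (w : circle R -> bop H) (W : nat -> circle R -> bop H) f x y :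
  continuous (f : circle R -> R[i]^o) -> form_density w 1 -> (forall n, form_density (W n) 1) ->
  (forall n (k : int), (`|k| <= n)%N ->
    cintegral lambda (fun z => circle_val z ^ k * '[W n z x, y]) =
    cintegral lambda (fun z => circle_val z ^ k * '[w z x, y])) ->
  (fun n => cintegral lambda (fun z => f z * '[W n z x, y]) : R[i]^o) @ \oo -->
  (cintegral lambda (fun z => f z * '[w z x, y]) : R[i]^o).
Proof.
move=> cf dw dW agree; apply/cvgrPdist_lt => e e0.
have mf := continuous_cmeasurable cf.
have [C bf] := circle_bounded cf.
have eR : e = (Re e)%:C by apply: eqcP => //=; rewrite (ger0_Im (ltW e0)).
have e0' : 0 < Re e by move: e0; rewrite eR ltcR.
pose D := nrm x ^+ 2 + nrm y ^+ 2 + 1.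
have D0 : 0 < D by rewrite ltr_pwDr // addr_ge0 // sqr_ge0.
have d0 : 0 < Re e / (2 * D) by rewrite divr_gt0 // mulr_gt0.
have [N hN] := fejer cf d0.
pose g z := f z - fejer_mean f N z.
have mg : cmeasurable g.
  apply: cmeasurableD => //.
  have mN h : cmeasurable h -> cmeasurable (fun z => - h z).
    move=> mh; apply: eq_cmeasurable (cmeasurableM (cmeasurable_cst (-1)) mh) => z.
    by rewrite mulN1r.
  have mS (F : 'I_N.+1 -> circle R -> R[i]) : (forall a, cmeasurable (F a)) ->
      cmeasurable (fun z => \sum_a F a z).
    move=> mF; elim: (index_enum _) => [|a r IH].
      by apply: eq_cmeasurable (cmeasurable_cst 0) => z; rewrite big_nil.
    by apply: eq_cmeasurable (cmeasurableD (mF a) IH) => z; rewrite big_cons.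
  apply/mN/cmeasurableM; first exact: cmeasurable_cst.
  apply: (mS) => a; apply: mS => b; apply: cmeasurableM; first exact: cmeasurable_cst.
  exact: cmeasurable_circleX.
have bg : cbounded (Re e / (2 * D)) g by move=> z; exact/ltW/hN.
have split_int w' : form_density w' 1 ->
    cintegral lambda (fun z => f z * '[w' z x, y]) =
    cintegral lambda (fun z => fejer_mean f N z * '[w' z x, y]) +
    cintegral lambda (fun z => g z * '[w' z x, y]).
  move=> dw'; have If := density_cintegrableM dw' mf bf x y.
  have Ig := density_cintegrableM dw' mg bg x y.
  rewrite [X in _ = X + _](@eq_cintegral _ _ _
    (fun z => f z * '[w' z x, y] + -1 * (g z * '[w' z x, y]))).
    by rewrite cintegralD ?cintegralZ ?mulN1r ?subrK //; exact: cintegrableZ.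
  by move=> z; rewrite /g; ring.
near=> n.
rewrite (split_int _ dw) (split_int _ (dW n)) !(@fejer_integral _ 1) //.
set S := _ * _; set S' := _ * \sum_(a < _) _.
have -> : S' = S.
  congr (_ * _); apply: eq_bigr => a _; apply: eq_bigr => b _; rewrite agree //.
  have nN : (N <= n)%N by near: n; exact: nbhs_infty_ge.
  by have := ltn_ord a; have := ltn_ord b; lia.
rewrite opprD addrACA subrr add0r eR modC ltcR.
have h1 := density_form_le dw mg bg x y.
have h2 := density_form_le (dW n) mg bg x y.
apply: le_lt_trans (modD _ _) _; rewrite modN.
apply: le_lt_trans (lerD h1 h2) _; rewrite mulr1.
have eE : Re e = Re e / (2 * D) * (2 * D) by rewrite divfK // gt_eqF // mulr_gt0.
rewrite [ltRHS]eE; move: (Re e / (2 * D)) d0 => t t0; rewrite /D; nra.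
Unshelve. all: by end_near.
Qed.

End WeakConvergence.

(** * The Bernstein-Szego approximation *)

Section Approximation.
Context {R : realType} {H : hilbertType R}.
Variable mu : set (circle R) -> bop H.
Hypotheses (pmu : is_povm mu) (acmu : absolutely_continuous mu)
  (ntmu : nontrivial_povm mu) (mu0 : moment mu 0 = 1).
Implicit Types (z : circle R).

(** The density of mu can be regularized on a null set. *)
Lemma normalized_density : exists2 w, has_density mu w & form_density w 1.
Proof.
have [w0 /has_density_regular[w nw dmu]] := acmu.
have [K dw] := has_density_form dmu nw.
exists w => //; exact: (form_density_normalized pmu dmu dw mu0).
Qed.

Lemma mu_hermitian : hermitian_seq (moment mu).
Proof. by have [w dmu dw] := normalized_density; exact: (moment_hermitian pmu dmu dw). Qed.

Lemma mu_posdef : posdef_seq (moment mu).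
Proof. by move=> m m0; have [] := ntmu m0. Qed.

Lemma phiR_inverse n : exists2 S : bop H, S * S = kap (moment mu) n /\ adjoint S = S &
  forall z, is_inverse (phiR mu n (circle_val z)) (S * Phi_inv (moment mu) n z).
Proof.
have hs := mu_hermitian; have ps := mu_posdef.
have [c c0 hc] := kappa_coercive n hs ps.
have [[pS iS] SS] := sqrt_opP c0 (kappa_adjoint n hs ps) hc.
exists (sqrt_op (kap (moment mu) n)).
  split=> //; apply: nonneg_op_selfadjoint => x.
  by have [->|/pS/ltW//] := eqVneq x 0; rewrite hdot0r.
move=> z; have iS' := is_inverse_sym (inverseP iS).
exact: is_inverseM (Phi_inverse n hs ps z) iS'.
Qed.

(** The square root of kappa is self-adjoint, so its two occurrences multiply to
    kappa. *)
Lemma bernstein_szego_densityE n :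
  bernstein_szego_density mu n = bs_dens (moment mu) n.
Proof.
apply/funext => z; have [S [SS aS] iphi] := phiR_inverse n.
rewrite /bernstein_szego_density.
rewrite (inverseE (is_inverseM (iphi z) (adjoint_is_inverse (iphi z)))).
by rewrite adjointM aS /bs_dens -SS !mulrA.
Qed.

End Approximation.

Local Close Scope complex_scope.

Theorem theorem6p4 (R : realType) (H : hilbertType R)
    (mu : set (circle R) -> bop H)
    (H_separable : separable H)
    (mu_povm : is_povm mu)
    (mu_ac : absolutely_continuous mu)
    (mu_nontrivial : nontrivial_povm mu)
    (mu_moment0 : moment mu 0 = 1) :
  (forall n : nat,
    (* mu^(n) and its Verblunsky coefficients are well defined *)
    [/\ forall z : circle R, invertible (phiR mu n z),
        has_density (bernstein_szego mu n) (bernstein_szego_density mu n) &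
        nontrivial_povm (bernstein_szego mu n)] /\
    [/\ is_povm (bernstein_szego mu n),
        bernstein_szego mu n setT = 1,
        (forall j : nat, (j < n)%N ->
          verblunsky (bernstein_szego mu n) j = verblunsky mu j) &
        (forall j : nat, (n <= j)%N ->
          verblunsky (bernstein_szego mu n) j = 0)]) /\
  (forall f : circle R -> R[i]^o, continuous f ->
    wot_cvg (fun n => povm_integral (bernstein_szego mu n) f)
            (povm_integral mu f)).
Proof.
have hs := mu_hermitian mu_povm mu_ac mu_moment0.
have ps := mu_posdef mu_nontrivial.
have bsE n : bernstein_szego mu n = with_density (bs_dens (moment mu) n).
  by rewrite /bernstein_szego bernstein_szego_densityE.
split=> [n|f cf x y].
  rewrite bsE bernstein_szego_densityE //; split; split.
  - move=> z; have [S _ iphi] := phiR_inverse mu_povm mu_ac mu_nontrivial mu_moment0 n.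
    by exists (S * Phi_inv (moment mu) n z); exact: iphi.
  - exact: bs_has_density.
  - exact: bs_nontrivial.
  - exact: bs_povm.
  - by rewrite bs_total.
  - move=> j jn; apply: (verblunsky_agree jn) => k kn; exact: bs_moment_agree.
  - move=> j nj; apply: verblunsky_Phi0.
    have e : j.+1 = ((j - n).+1 + n)%N by lia.
    rewrite [LHS](_ : _ = Phi (moment (with_density (bs_dens (moment mu) n))) j.+1 0) // e.
    apply: (@Phi_recursion _ _ _ n (j - n) (cn (moment mu) n) (bs_posdef n hs ps)) => i; exact: (bs_moment_recursion hs ps).
have [w dmu dw] := normalized_density mu_povm mu_ac mu_moment0.
have dW n : form_density (bs_dens (moment mu) n) 1.
  have [K dW] := bs_dens_form n hs ps.
  apply: (form_density_normalized (bs_povm n hs ps) (bs_has_density n hs ps) dW).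
  by rewrite bs_moment_agree.
have mf := continuous_cmeasurable cf.
have [C bf] := circle_bounded cf.
rewrite (povm_integralE mu_povm dmu dw mf bf).
rewrite (_ : (fun n => _) = (fun n => cintegral (@circle_measure R)
    (fun z => f z * '[bs_dens (moment mu) n z x, y]))); last first.
  apply/funext => n; rewrite bsE.
  exact: (povm_integralE (bs_povm n hs ps) (bs_has_density n hs ps) (dW n) mf bf).
apply: fourier_agree_cvg => // n k kn; rewrite -[k]opprK.
rewrite -(momentE _ _ _ mu_povm dmu dw).
rewrite -(momentE _ _ _ (bs_povm n hs ps) (bs_has_density n hs ps) (dW n)).
by rewrite bs_moment_agree // abszN.
Qed.
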